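(* Let $n\ge 1$, $T\in\mathbb{R}$, and let $\varphi:\mathbb{R}^n\to\mathbb{R}$ be an admissible payoff function. For $0<\varepsilon<1$ let $u_\varepsilon$ be the unique solution of the scaled geometric-stopping dynamic programming principle $$u_\varepsilon(x)=\varepsilon^2\varphi(x)+(1-\varepsilon^2)\min_{player}\max_{market}\mathbf{E}[u_\varepsilon(x+\varepsilon\Delta x)],\qquad x\in\mathbb{R}^n,$$ in the class of functions $u:\mathbb{R}^n\to\mathbb{R}$ with $u-\varphi$ bounded, and let $w_\varepsilon$ be the unique solution, on times $t\in\{T,T-\varepsilon^2,T-2\varepsilon^2,\dots\}$, of the scaled finite-horizon dynamic programming principle $$w_\varepsilon(t,x)=\min_{player}\max_{market}\mathbf{E}[w_\varepsilon(t+\varepsilon^2,x+\varepsilon\Delta x)]\ \ (t<T),\qquad w_\varepsilon(T,x)=\varphi(x).$$ Then, as $\varepsilon\to0$, $u_\varepsilon$ converges to the unique viscosity solution $u$ with at most linear growth of $$u(x)=\varphi(x)+\tfrac12\max_{v\in\{0,1\}^n}\langle D^2u(x)\, v,v\rangle,\qquad x\in\mathbb{R}^n,$$ and $w_\varepsilon$ converges to the unique viscosity solution $w$ with at most linear growth of the final-value problem $$w_t(t,x)+\tfrac12\max_{v\in\{0,1\}^n}\langle D^2w(t,x)\, v,v\rangle=0\ \ (t<T,\ x\in\mathbb{R}^n),\qquad w(T,x)=\varphi(x).$$ The convergence is in the following sense: $u_\varepsilon(y)\to u(x)$ as $\varepsilon\to0$, $y\to x$, for every $x\in\mathbb{R}^n$;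 and $w_\varepsilon(\tau,y)\to w(t,x)$ as $\varepsilon\to0$, $\tau\to t$ (with $\tau\in\{T-k\varepsilon^2:k\ge0\}$), $y\to x$, for every $t\le T$ and $x\in\mathbb{R}^n$.
   Context: Admissible payoff: $\varphi:\mathbb{R}^n\to\mathbb{R}$ is globally Lipschitz continuous, non-decreasing in each variable, symmetric in $x_1,\dots,x_n$, satisfies $|\varphi(x)|\le C_1|x|+C_2$ for some constants, and satisfies $\varphi(x_1+c,\dots,x_n+c)=\varphi(x_1,\dots,x_n)+c$ for all $c\in\mathbb{R}$. Game operators: $\min_{player}$ is the minimum over probability vectors $\alpha=(\alpha_1,\dots,\alpha_n)$ ($\alpha_k\ge0$, $\sum_k\alpha_k=1$); $\max_{market}$ is the maximum over probability distributions $p$ on $\{0,1\}^n$. For given $\alpha,p$ and a function $g$, $$\mathbf{E}[g(x+\varepsilon\Delta x)]=\sum_{k=1}^n\alpha_k\sum_{v\in\{0,1\}^n}p(v)\,g\big(x+\varepsilon(v-v_k\vec 1)\big),\qquad \vec 1=(1,\dots,1),$$ and similarly for functions of $(t,x)$, with the time argument as indicated. It is known that each dynamic programming principle has a unique solution in the stated class and that each PDE problem has a unique viscosity solution among functions of at most linear growth in $x$ (in the time-dependent case, with growth bound uniform on bounded time intervals). Viscosity solution of the stationary equation: a continuous $u$ such that for every $x_0$ and smooth $\psi$, if $u-\psi$ has a local minimum (resp. maximum) at $x_0$, then $u(x_0)-\varphi(x_0)-\frac12\max_{v\in\{0,1\}^n}\langle D^2\psi(x_0)v,v\rangle\ge0$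 (resp. $\le0$). Viscosity solution of the final-value problem: a continuous $w$ on $(-\infty,T]\times\mathbb{R}^n$ with $w(T,\cdot)=\varphi$ such that for every $(t_0,x_0)$ with $t_0<T$ and smooth $\psi$, if $w-\psi$ has a local minimum (resp. maximum) at $(t_0,x_0)$, then $\psi_t(t_0,x_0)+\frac12\max_{v\in\{0,1\}^n}\langle D^2\psi(t_0,x_0)v,v\rangle\le0$ (resp. $\ge0$). *)

(* Defs.v *)
From mathcomp Require Export all_boot all_order all_fingroup all_algebra.
From mathcomp Require Export all_classical all_reals all_analysis.
Export Order.TTheory GRing.Theory Num.Theory.
Export numFieldNormedType.Exports.

Set Implicit Arguments.
Unset Strict Implicit.
Unset Printing Implicit Defensive.

Local Open Scope classical_set_scope.
Local Open Scope ring_scope.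

(* The space R^n is 'rV[R]_n; its library norm `|x| is the sup norm, which is
   equivalent to the Euclidean one and only enters through bounds with
   unspecified constants. *)

Section Payoff.
Context {R : realType} {n : nat}.
Implicit Types (phi f : 'rV[R]_n -> R) (x : 'rV[R]_n).

Definition linear_growth f : Prop :=
  exists C1 C2 : R, forall x, `|f x| <= C1 * `|x| + C2.

Definition admissible phi : Prop :=
  [/\ exists L : R, L.-lipschitz phi,
      forall x (i : 'I_n) (h : R), 0 <= h -> phi x <= phi (x + h *: delta_mx 0 i),
      forall x (s : 'S_n), phi (col_perm s x) = phi x,
      linear_growth phi &
      forall x (c : R), phi (x + const_mx c) = phi x + c].

End Payoff.

Section Game.
Context {R : realType} {n : nat}.
Implicit Types (g : 'rV[R]_n -> R) (x : 'rV[R]_n) (a : 'I_n -> R).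

Definition cube : finType := {ffun 'I_n -> bool}.
Definition vertex (v : cube) : 'rV[R]_n := \row_i (v i)%:R.

Definition distribution (I : finType) (p : I -> R) : Prop :=
  (forall i, 0 <= p i) /\ \sum_i p i = 1.

Definition expectation (eps : R) g x a (p : cube -> R) : R :=
  \sum_(k < n) a k *
    \sum_(v : cube) p v * g (x + eps *: (vertex v - const_mx (v k)%:R)).

(* The maximum and minimum are written with the total functions [sup] and
   [inf]; they are attained, see [max_marketP] and [minmaxP]. *)
Definition max_market (eps : R) g x a : R :=
  sup [set expectation eps g x a p | p in @distribution cube].

Definition minmax (eps : R) g x : R :=
  inf [set max_market eps g x a | a in @distribution 'I_n].

Let coef eps g x a (v : cube) : R :=
  \sum_(k < n) a k * g (x + eps *: (vertex v - const_mx (v k)%:R)).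

Let expectationE eps g x a p :
  expectation eps g x a p = \sum_v p v * coef eps g x a v.
Proof.
rewrite /expectation; under eq_bigr do rewrite mulr_sumr.
rewrite exchange_big; apply: eq_bigr => v _; rewrite mulr_sumr.
by apply: eq_bigr => k _; rewrite mulrCA.
Qed.

Let v0 : cube := [ffun=> false].
Let vmax eps g x a : cube := [arg max_(v > v0) coef eps g x a v]%O.

Let le_vmax eps g x a v : coef eps g x a v <= coef eps g x a (vmax eps g x a).
Proof. by rewrite /vmax; case: arg_maxP => // i _; apply. Qed.

Let expectation_le eps g x a p : distribution p ->
  expectation eps g x a p <= coef eps g x a (vmax eps g x a).
Proof.
move=> [p0 p1]; rewrite expectationE.
rewrite -[leRHS]mul1r -p1 mulr_suml; apply: ler_sum => v _.
by rewrite ler_wpM2l.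
Qed.

Let dirac_vmax eps g x a : exists2 p, @distribution cube p &
  expectation eps g x a p = coef eps g x a (vmax eps g x a).
Proof.
set w := vmax eps g x a.
have sumw (f : cube -> R) : \sum_v (v == w)%:R * f v = f w.
  rewrite (bigD1 w)//= eqxx mul1r big1 ?addr0// => v /negPf ->.
  by rewrite mul0r.
exists (fun v => (v == w)%:R); last by rewrite expectationE sumw.
split=> [v|]; first exact: ler0n.
by rewrite -[RHS](sumw (fun=> 1)); apply: eq_bigr => v _; rewrite mulr1.
Qed.

Let max_marketE eps g x a :
  max_market eps g x a = coef eps g x a (vmax eps g x a).
Proof.
have [p pd pE] := dirac_vmax eps g x a.
have ubE : ubound [set expectation eps g x a q | q in @distribution cube]
    (coef eps g x a (vmax eps g x a)).
  by move=> _ [q qd <-]; exact: expectation_le.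
apply/eqP; rewrite eq_le; apply/andP; split.
  by apply: ge_sup => //; exists (expectation eps g x a p); exists p.
by rewrite -pE; apply: ub_le_sup; [exists (coef eps g x a (vmax eps g x a))|exists p].
Qed.

Lemma max_marketP eps g x a :
  (exists2 p, @distribution cube p & expectation eps g x a p = max_market eps g x a)
  /\ (forall p, @distribution cube p ->
        expectation eps g x a p <= max_market eps g x a).
Proof.
by rewrite max_marketE; split=> [|p]; [exact: dirac_vmax|exact: expectation_le].
Qed.

Let simplex : set 'rV[R]_n := [set r | distribution (r 0)].

Let cont_lin (c : 'I_n -> R) :
  continuous (fun r : 'rV[R]_n => \sum_(k < n) r 0 k * c k).
Proof.
elim: (index_enum 'I_n) => [|k s IH].
  rewrite (_ : (fun=> _) = cst 0); first by exact: cst_continuous.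
  by apply/funext => r; rewrite big_nil.
rewrite (_ : (fun=> _) = (fun r : 'rV[R]_n => r 0 k * c k) \+
    (fun r : 'rV[R]_n => \sum_(j <- s) r 0 j * c j)); last first.
  by apply/funext => r; rewrite big_cons.
move=> r; apply: continuousD; last exact: IH.
by apply: continuousM; [exact: coord_continuous|exact: cst_continuous].
Qed.

Let compact_simplex : compact simplex.
Proof.
apply: bounded_closed_compact.
  exists 1; split=> // M M1 r [r0 r1]; apply: (le_trans _ (ltW M1)).
  rewrite /Num.norm/= mx_normrE; apply: bigmax_le => // -[i k] _ /=.
  rewrite (ord1 i) ger0_norm// -r1 (bigD1 k)//= lerDl.
  by apply: sumr_ge0 => j _.
have sum1E (r : 'rV[R]_n) : \sum_(k < n) r 0 k * 1 = \sum_k r 0 k.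
  by apply: eq_bigr => k _; rewrite mulr1.
have -> : simplex = (\bigcap_(k in [set: 'I_n]) [set r | 0 <= r 0 k])
    `&` [set r | \sum_(k < n) r 0 k * 1 = 1].
  apply/seteqP; split=> r [r0 r1]; split; last by move: r1 => /=; rewrite sum1E.
  - by move=> k _; exact: r0.
  - by rewrite /= sum1E.
  - by move=> k; exact: r0.
apply: closedI.
  apply: closed_bigI => k _.
  apply: (@preimage_closed _ _ (fun r : 'rV[R]_n => r 0 k) [set y | 0 <= y]).
    by move=> r _; exact: coord_continuous.
  exact: closed_ge.
apply: (@preimage_closed _ _ (fun r : 'rV[R]_n => \sum_(k < n) r 0 k * 1)
  [set y | y = 1]).
  by move=> r _; exact: cont_lin.
exact: closed_eq.
Qed.

Let cont_max_market eps g x :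
  continuous (fun r : 'rV[R]_n => max_market eps g x (r 0)).
Proof.
have -> : (fun r : 'rV[R]_n => max_market eps g x (r 0)) = fun r : 'rV[R]_n =>
    \big[Num.max/coef eps g x (r 0) v0]_(v : cube) coef eps g x (r 0) v.
  apply/funext => r; rewrite max_marketE; apply/eqP; rewrite eq_le.
  apply/andP; split; first exact: le_bigmax.
  by apply: bigmax_le => [|v _]; exact: le_vmax.
elim: (index_enum cube) => [|v s IH].
  rewrite (_ : (fun=> _) = fun r : 'rV[R]_n => coef eps g x (r 0) v0).
    exact: cont_lin.
  by apply/funext => q; rewrite big_nil.
rewrite (_ : (fun=> _) = (fun r : 'rV[R]_n => coef eps g x (r 0) v)
    \max (fun r : 'rV[R]_n =>
    \big[Num.max/coef eps g x (r 0) v0]_(j <- s) coef eps g x (r 0) j)).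
  by apply: max_fun_continuous => //; exact: cont_lin.
by apply/funext => q; rewrite big_cons.
Qed.

Lemma minmaxP eps g x : (0 < n)%N ->
  (exists2 a, @distribution 'I_n a & max_market eps g x a = minmax eps g x)
  /\ (forall a, @distribution 'I_n a -> minmax eps g x <= max_market eps g x a).
Proof.
move=> n0.
have rowE a : (\row_k a k : 'rV[R]_n) 0 = a.
  by apply/funext => k; rewrite mxE.
have simplex0 : simplex !=set0.
  pose k0 := Ordinal n0; exists (\row_k (k == k0)%:R); rewrite /simplex/= rowE.
  split=> [k|]; first exact: ler0n.
  by rewrite (bigD1 k0)//= big1 ?eqxx ?addr0// => k /negPf ->.
have [c cs cmin] := EVT_min_rV simplex0 compact_simplex
  (continuous_subspaceT (@cont_max_market eps g x)).
have cd : @distribution 'I_n (c 0) by move: cs; rewrite inE.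
have lbc : lbound [set max_market eps g x a | a in @distribution 'I_n]
    (max_market eps g x (c 0)).
  move=> _ [a ad <-]; rewrite -[a in leRHS]rowE; apply: cmin.
  by rewrite inE /simplex/= rowE.
have -> : minmax eps g x = max_market eps g x (c 0).
  apply/eqP; rewrite eq_le; apply/andP; split.
    by apply: ge_inf; [exists (max_market eps g x (c 0))|exists (c 0)].
  by apply: lb_le_inf => //; exists (max_market eps g x (c 0)); exists (c 0).
by split=> [|a ad]; [exists (c 0)|apply: lbc; exists a].
Qed.

Definition geometric_dpp (eps : R) (phi u : 'rV[R]_n -> R) : Prop :=
  forall x, u x = eps ^+ 2 * phi x + (1 - eps ^+ 2) * minmax eps u x.

Definition time_grid (T eps t : R) : Prop :=
  exists k : nat, t = T - k%:R * eps ^+ 2.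

Definition horizon_dpp (T eps : R) (phi : 'rV[R]_n -> R)
    (w : R -> 'rV[R]_n -> R) : Prop :=
  (forall x, w T x = phi x) /\
  (forall t x, time_grid T eps t -> t < T ->
     w t x = minmax eps (w (t + eps ^+ 2)) x).

End Game.

Section Viscosity.
Context {R : realType}.

(* On a finite-dimensional space this is the usual class C^k: all iterated
   directional derivatives of order at most k exist and are continuous. *)
Fixpoint Ck {V : normedModType R} (k : nat) (f : V -> R) : Prop :=
  if k is k'.+1 then
    continuous f /\
    forall d : V, (forall x, derivable f x d) /\ Ck k' (fun x => 'D_d f x)
  else continuous f.

Definition smooth {V : normedModType R} (f : V -> R) : Prop :=
  forall k, Ck k f.

Context {n : nat}.

Definition hessian (f : 'rV[R]_n -> R) (x : 'rV[R]_n) : 'M[R]_n :=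
  \matrix_(i, j) 'D_(delta_mx 0 i) (fun y => 'D_(delta_mx 0 j) f y) x.

Definition quad_form (H : 'M[R]_n) (v : 'rV[R]_n) : R := (v *m H *m v^T) 0 0.

(* The default value 0 of the maximum is the value at the vertex v = 0. *)
Definition max_quad (H : 'M[R]_n) : R :=
  \big[Num.max/0]_(v : @cube n) quad_form H (vertex v).

Definition stationary_viscosity_solution (phi u : 'rV[R]_n -> R) : Prop :=
  continuous u /\
  forall (x0 : 'rV[R]_n) (psi : 'rV[R]_n -> R), smooth psi ->
    ((\forall x \near x0, u x0 - psi x0 <= u x - psi x) ->
       0 <= u x0 - phi x0 - 2^-1 * max_quad (hessian psi x0)) /\
    ((\forall x \near x0, u x - psi x <= u x0 - psi x0) ->
       u x0 - phi x0 - 2^-1 * max_quad (hessian psi x0) <= 0).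

(* [w] is a total function of time, but only its restriction to times t <= T
   matters. *)
Definition final_value_viscosity_solution (T : R) (phi : 'rV[R]_n -> R)
    (w : R -> 'rV[R]_n -> R) : Prop :=
  [/\ {within [set z : R * 'rV[R]_n | z.1 <= T], continuous (fun z => w z.1 z.2)},
      forall x, w T x = phi x &
      forall (t0 : R) (x0 : 'rV[R]_n) (psi : R * 'rV[R]_n -> R),
        t0 < T -> smooth psi ->
        let heat := (fun t => psi (t, x0))^`()%classic t0
          + 2^-1 * max_quad (hessian (fun x => psi (t0, x)) x0) in
        ((\forall z \near (t0, x0),
            w t0 x0 - psi (t0, x0) <= w z.1 z.2 - psi z) -> heat <= 0) /\
        ((\forall z \near (t0, x0),
            w z.1 z.2 - psi z <= w t0 x0 - psi (t0, x0)) -> 0 <= heat)].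

Definition time_linear_growth (T : R) (w : R -> 'rV[R]_n -> R) : Prop :=
  forall S : R, exists C1 C2 : R,
    forall t x, S <= t <= T -> `|w t x| <= C1 * `|x| + C2.

End Viscosity.

(* Main.v *)
Require Import Defs.
From mathcomp Require Import ring lra.

Set Implicit Arguments.
Unset Strict Implicit.
Unset Printing Implicit Defensive.

Local Open Scope classical_set_scope.
Local Open Scope ring_scope.

(** The market may play a vertex and its complement with equal probability, which
    yields [minmax eps g x >= (g (x + eps v) + g (x - eps v)) / 2] for every vertex
    [v]; the player may play the gradient, so that for smooth [g] the maximum over
    [v] of these averages is also an upper bound up to [O(eps ^ 3)]. Only functions
    that are monotone and commute with adding constants ("topical" functions)
    matter, and they are 1-Lipschitz.

    Each comparison is between a supersolution and a subsolution, one of them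
    discrete. Supersolutions satisfy one linear inequality per vertex, hence can be
    mollified: no doubling of variables is needed.
    - Limit from below: the mollified discrete solution is a supersolution of the
      PDE and serves directly as a test function for the viscosity subsolution.
    - Limit from above: a viscosity supersolution [u] is first replaced by the
      largest topical function below it. On each line [x + R v] the viscosity
      inequality is integrated to an inequality between finitely many values,
      which survives this replacement and mollification; the result is a
      supersolution of the discrete scheme. *)

(** * Line averages *)

(** The order of limits makes the estimates close. A mollification width [d] is fixed first;
    [mollifier] then provides one constant [K] for the third-order remainders of all topical
    functions at once, hence for every discrete solution whatever [eps] is. Errors of size [K * eps]
    vanish while [d] stays fixed, and [d] is tied to the required accuracy only in the final
    theorem. In the finite-horizon problem about [eps ^ -2] steps are made, so each may lose only
    [O(eps ^ 3)]: the width [d] has to be paid once, not at every step. For this reason the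
    inductions carry the mollified functions, and the envelope, which is merely Lipschitz, must be
    propagated over one step up to an arbitrarily small error before it is mollified. *)

Section OneVariable.
Context {R : realType}.
Implicit Types (f g F : R -> R).

Lemma is_derive1_continuous f (a b : R) (df : R -> R) :
  (forall x, a <= x <= b -> is_derive x 1 f (df x)) ->
  {within `[a, b], continuous f}.
Proof.
move=> dF; apply: derivable_within_continuous => x.
by rewrite in_itv/= => /dF [].
Qed.

Lemma mean_value f df (a b : R) : a <= b ->
  (forall x, a <= x <= b -> is_derive x 1 f (df x)) ->
  exists2 c, a <= c <= b & f b - f a = df c * (b - a).
Proof.
move=> ab dF; have [|c] := @MVT_segment R f df a b ab _ (is_derive1_continuous dF).
  by move=> x; rewrite in_itv/= => /andP[ax xb]; apply: dF; rewrite !ltW.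
by rewrite in_itv/=; exists c.
Qed.

(** The base point -1 lies to the left of all segments [[0, l]] used below, so that the two-sided
    derivative exists at 0 as well. *)
Definition primitive g (x : R) : R :=
  (\int[@lebesgue_measure R]_(t in `[-1, x]) g t)%R.

Lemma is_derive_primitive g (x : R) : continuous g -> -1 < x ->
  is_derive x 1 (primitive g) (g x).
Proof.
move=> cg x1; have xx : x < x + 1 by rewrite ltrDl.
have ig : (@lebesgue_measure R).-integrable `[-1, x + 1] (EFin \o g).
  apply: continuous_compact_integrable; first exact: segment_compact.
  exact: continuous_subspaceT.
have : derivable (primitive g) x 1 /\ (primitive g)^`()%classic x = g x.
  exact: (continuous_FTC1_closed xx ig x1 (cg x)).
by rewrite derive1E => -[dg gE]; exact: DeriveDef dg gE.
Qed.

Lemma eq_increment F G g (a b : R) : a <= b ->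
  (forall x, a <= x <= b -> is_derive x 1 F (g x)) ->
  (forall x, a <= x <= b -> is_derive x 1 G (g x)) ->
  F b - F a = G b - G a.
Proof.
move=> ab dF dG.
have [x ax|c _] := @mean_value (F \- G) (fun=> 0) a b ab.
  by apply: is_derive_eq; [apply: is_deriveB; [exact: dF|exact: dG]|rewrite subrr].
rewrite mul0r/= => /eqP; rewrite subr_eq0 => /eqP FG; lra.
Qed.

End OneVariable.

Section Lipschitz.
Context {R : realType} {V : normedModType R}.
Implicit Types (f g : V -> R) (x y z : V).

Definition lip (L : R) f : Prop := forall x y, `|f x - f y| <= L * `|x - y|.

Definition lipschitz_fun f : Prop := exists L : R, lip L f.

Lemma lip_ge0 L f : lip L f -> lip `|L| f.
Proof.
by move=> fL x y; apply: le_trans (fL x y) _; rewrite ler_wpM2r// ler_norm.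
Qed.

Lemma lip_cst (c : R) : lip 0 (fun=> c : R).
Proof. by move=> x y; rewrite subrr normr0 mul0r. Qed.

Lemma lip_lin (a b L M : R) f g : lip L f -> lip M g ->
  lip (`|a| * L + `|b| * M) (fun x => a * f x + b * g x).
Proof.
move=> fL gM x y.
have -> : a * f x + b * g x - (a * f y + b * g y) =
  a * (f x - f y) + b * (g x - g y) by ring.
apply: le_trans (ler_normD _ _) _; rewrite !normrM mulrDl -!mulrA.
by rewrite lerD// ler_wpM2l.
Qed.

Lemma lip_shift L f z : lip L f -> lip L (fun x => f (x + z)).
Proof.
move=> fL x y; apply: le_trans (fL _ _) _.
by rewrite opprD addrACA subrr addr0.
Qed.

Lemma lipschitz_fun_cst (c : R) : lipschitz_fun (fun=> c).
Proof. by exists 0; exact: lip_cst. Qed.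

Lemma lipschitz_fun_lin (a b : R) f g : lipschitz_fun f -> lipschitz_fun g ->
  lipschitz_fun (fun x => a * f x + b * g x).
Proof. by move=> [L fL] [M gM]; eexists; exact: lip_lin fL gM. Qed.

Lemma lipschitz_fun_shift f z : lipschitz_fun f ->
  lipschitz_fun (fun x => f (x + z)).
Proof. by move=> [L fL]; exists L; exact: lip_shift. Qed.

Lemma lip_continuous L f : lip L f -> continuous f.
Proof.
move=> /lip_ge0; set M := `|L| => fL x.
have M0 : 0 < M + 1 by rewrite ltr_wpDl// normr_ge0.
apply/cvgrPdist_le => e e0; near=> y.
apply: le_trans (fL x y) _; apply: (@le_trans _ _ ((M + 1) * `|x - y|)).
  by rewrite ler_wpM2r// lerDl.
rewrite mulrC -ler_pdivlMr//; near: y; apply: cvgr_dist_le.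
  exact: cvg_id.
by rewrite divr_gt0.
Unshelve. all: by end_near. Qed.

End Lipschitz.

(** * Averaging operators and averages along a segment *)

Section Averaging.
Context {R : realType} {V : normedModType R}.
Implicit Types (f g h : V -> R) (x y z d : V) (A : (V -> R) -> V -> R).

(** Linear inequalities between shifted functions, and expansions with a uniform remainder, pass
    from [f] to [A f] by these four properties alone. Order and linearity are asked on Lipschitz
    functions only, for which the segment integrals have the expected derivatives. *)
Record averaging A : Prop := Averaging {
  averaging_le : forall f g, lipschitz_fun f -> lipschitz_fun g ->
    (forall x, f x <= g x) -> forall x, A f x <= A g x;
  averaging_lin : forall (a b : R) f g, lipschitz_fun f -> lipschitz_fun g ->
    forall x, A (fun y => a * f y + b * g y) x = a * A f x + b * A g x;
  averaging_cst : forall (c : R) x, A (fun=> c) x = c;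
  averaging_shift : forall f z x, A (fun y => f (y + z)) x = A f (x + z) }.

Lemma lip_line L f x d : lip L f -> `|d| <= 1 ->
  lip `|L| (fun s : R^o => f (x + s *: d)).
Proof.
move=> /lip_ge0 fL d1 s t; apply: le_trans (fL _ _) _.
rewrite opprD addrACA subrr add0r -scalerBl normrZ ler_wpM2l//.
by rewrite ler_piMr.
Qed.

Section Closure.
Variables (A : (V -> R) -> V -> R) (hA : averaging A).

Lemma averaging_cstD f (c : R) x : lipschitz_fun f ->
  A (fun y => f y + c) x = A f x + c.
Proof.
move=> hf; rewrite -[RHS](congr1 (+%R^~ c) (mul1r _)) -[c in RHS]mul1r.
rewrite -[c in RHS](averaging_cst hA c x) -averaging_lin//; last first.
  exact: lipschitz_fun_cst.
by congr (A _ x); apply/funext => y; rewrite !mul1r.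
Qed.

Lemma averaging_lip L f : lip L f -> lip L (A f).
Proof.
move=> fL; have hf : lipschitz_fun f by exists L.
have le x z : A f (x + z) <= A f x + L * `|z|.
  rewrite -averaging_shift// -averaging_cstD//; apply: averaging_le => //.
  - exact: lipschitz_fun_shift.
  - have [L' f'] := lipschitz_fun_lin 1 1 hf (lipschitz_fun_cst (L * `|z|)).
    by exists L' => a b; have := f' a b; rewrite !mul1r.
  - move=> y; rewrite -lerBlDl; apply: le_trans (ler_norm _) _.
    by apply: le_trans (fL _ _) _; rewrite addrC addKr.
move=> x y; rewrite ler_norml lerBrDr lerBlDl addrC lerBlDr.
have := le y (x - y); rewrite addrC subrK => ->; rewrite andbT.
by have := le x (y - x); rewrite addrC subrK distrC.
Qed.

Lemma averaging_lipschitz f : lipschitz_fun f -> lipschitz_fun (A f).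
Proof. by move=> [L fL]; exists L; exact: averaging_lip. Qed.

Lemma averaging_sum (I : Type) (s : seq I) (c : I -> R) (F : I -> V -> R) :
  (forall i, lipschitz_fun (F i)) ->
  lipschitz_fun (fun x => \sum_(i <- s) c i * F i x) /\
  forall x, A (fun y => \sum_(i <- s) c i * F i y) x = \sum_(i <- s) c i * A (F i) x.
Proof.
move=> hF; elim: s => [|i s [IHl IH]].
  split=> [|x]; last first.
    by rewrite big_nil -[RHS](averaging_cst hA 0 x); congr (A _ x); apply/funext => y; rewrite big_nil.
  by exists 0 => x y; rewrite !big_nil subrr normr0 mul0r.
have E : (fun x => \sum_(j <- i :: s) c j * F j x) =
    (fun x => c i * F i x + 1 * \sum_(j <- s) c j * F j x).
  by apply/funext => x; rewrite big_cons mul1r.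
rewrite E; split; first exact: lipschitz_fun_lin.
by move=> x; rewrite averaging_lin// IH big_cons mul1r.
Qed.

Lemma averaging_norm_le f (c : R) x : lipschitz_fun f ->
  (forall y, `|f y| <= c) -> `|A f x| <= c.
Proof.
move=> hf fc; rewrite ler_norml -[- c](averaging_cst hA _ x).
rewrite -[c in X in _ && X](averaging_cst hA _ x).
by apply/andP; split; apply: averaging_le => //;
  (exact: lipschitz_fun_cst || by move=> y; have := fc y; rewrite ler_norml => /andP[]).
Qed.

End Closure.

Lemma averaging_comp A B : averaging A -> averaging B ->
  averaging (fun f => A (B f)).
Proof.
move=> hA hB; split.
- move=> f g hf hg fg; apply: (averaging_le hA); try exact: averaging_lipschitz.
  exact: (averaging_le hB).
- move=> a b f g hf hg x; rewrite -(averaging_lin hA);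
    try exact: averaging_lipschitz.
  by congr (A _ x); apply/funext => y; rewrite (averaging_lin hB).
- move=> c x; rewrite -[RHS](averaging_cst hA c x); congr (A _ x).
  by apply/funext => y; rewrite (averaging_cst hB).
- move=> f z x; rewrite -(averaging_shift hA); congr (A _ x).
  by apply/funext => y; rewrite (averaging_shift hB).
Qed.

Lemma averaging_id : averaging id.
Proof. by split. Qed.

Definition line_average d (l : R) f x : R :=
  (primitive (fun s => f (x + s *: d)) l - primitive (fun s => f (x + s *: d)) 0) / l.

Definition line_quotient d (l : R) f x : R := (f (x + l *: d) - f x) / l.

Variables (d : V) (l : R).
Hypotheses (d1 : `|d| <= 1) (l0 : 0 < l).

Let line_continuous f x : lipschitz_fun f ->
  continuous (fun s : R => f (x + s *: d)).
Proof. by move=> [L fL]; exact: (lip_continuous (lip_line x fL d1)). Qed.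

Let line_antiderivative f x (F : R -> R) :=
  forall s : R, 0 <= s <= l -> is_derive s 1 F (f (x + s *: d)).

Let line_averageE f x F : line_antiderivative f x F ->
  lipschitz_fun f -> line_average d l f x = (F l - F 0) / l.
Proof.
move=> dF hf; rewrite /line_average; congr (_ / _).
apply: (eq_increment (ltW l0) _ dF) => s /andP[s0 _].
by apply: (@is_derive_primitive _ (fun s => f (x + s *: d)) s); [exact: line_continuous|lra].
Qed.

Let line_primitive f x : lipschitz_fun f -> exists2 F : R -> R,
  (forall s : R, 0 <= s -> is_derive s 1 F (f (x + s *: d))) &
  line_average d l f x = (F l - F 0) / l.
Proof.
move=> hf; exists (primitive (fun s => f (x + s *: d))) => // s s0.
by apply: (@is_derive_primitive _ (fun s => f (x + s *: d)) s); [exact: line_continuous|lra].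
Qed.

Lemma line_average_averaging : averaging (line_average d l).
Proof.
split.
- move=> f g hf hg fg x.
  have [F dF ->] := line_primitive x hf; have [G dG ->] := line_primitive x hg.
  rewrite ler_pM2r ?invr_gt0//.
  have [s /andP[s0 _]|c _] := @mean_value _ (G \- F)
      (fun s => g (x + s *: d) - f (x + s *: d)) 0 l (ltW l0).
    by apply: is_deriveB; [exact: dG|exact: dF].
  have : 0 <= (g (x + c *: d) - f (x + c *: d)) * (l - 0).
    by rewrite mulr_ge0 ?subr_ge0 ?subr0// ltW.
  by move=> + E; rewrite -E/=; lra.
- move=> a b f g hf hg x.
  have [F dF ->] := line_primitive x hf; have [G dG ->] := line_primitive x hg.
  have -> := @line_averageE (fun y => a * f y + b * g y) x (fun s => a * F s + b * G s).
  + by ring.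
  + move=> s /andP[s0 _]; apply: is_deriveD.
      by apply: is_deriveZ; exact: dF.
    by apply: is_deriveZ; exact: dG.
  + exact: lipschitz_fun_lin.
- move=> c x; rewrite (@line_averageE _ x (fun s => c * s)).
  + by rewrite mulr0 subr0 mulfK// gt_eqF.
  + by move=> s _; apply: is_derive_eq; rewrite ?scaler1//= /GRing.scale/= mulr1.
  + exact: lipschitz_fun_cst.
- move=> f z x; rewrite /line_average.
  by under eq_fun do rewrite addrAC.
Qed.

Lemma line_quotient_lip L f : 0 <= L -> lip L f ->
  lip (2 * L / l) (line_quotient d l f).
Proof.
move=> L0 fL x y; rewrite /line_quotient -mulrBl normrM [`|l^-1|]gtr0_norm ?invr_gt0//.
rewrite [leRHS]mulrAC ler_pM2r ?invr_gt0//.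
have := fL x y; have := fL (x + l *: d) (y + l *: d).
rewrite opprD addrACA subrr addr0 !ler_norml => /andP[? ?] /andP[? ?].
by apply/andP; split; lra.
Qed.

(** Shifting the segment by [t] trades a piece of length [t] at one end for one at the other, and a
    Lipschitz function is nearly constant on each. Averaging thus gains one derivative, the
    difference quotient. *)
Lemma line_average_expansion L f x (t : R) : 0 <= L -> lip L f ->
  `|line_average d l f (x + t *: d) - line_average d l f x
    - t * line_quotient d l f x| <= 4 * L / l * t ^+ 2.
Proof.
move=> L0 fL; have hf : lipschitz_fun f by exists L.
have pos u (s : R) : 0 <= s ->
    `|line_average d l f (u + s *: d) - line_average d l f u
      - s * line_quotient d l f u| <= 2 * L / l * s ^+ 2.
  move=> s0; have [F dF ->] := line_primitive u hf.
  have dFD (r v : R) : 0 <= r -> 0 <= v ->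
      is_derive v 1 (fun w => F (r + w)) (f (u + (r + v) *: d)).
    move=> r0 v0; rewrite -[f _]mulr1.
    apply: (@is_derive1_comp _ F (fun w => r + w)); first by apply: dF; lra.
    by apply: is_derive_eq; rewrite add0r ?mulr1.
  have -> // := @line_averageE f (u + s *: d) (fun v => F (s + v)); last first.
    by move=> v /andP[v0 _]; rewrite -addrA -scalerDl; apply: dFD.
  (* [D] collects the two traded end pieces minus their first-order value; its derivative is at most
     [2 * L * s] by the Lipschitz bound. *)
  pose D v := F (l + v) - F v - v * (f (u + l *: d) - f u).
  have -> : (F (s + l) - F (s + 0)) / l - (F l - F 0) / l - s * line_quotient d l f u =
      (D s - D 0) / l.
    by rewrite /D /line_quotient !addr0 (addrC s l); field; rewrite gt_eqF.
  rewrite normrM [`|l^-1|]gtr0_norm ?invr_gt0// [leRHS]mulrAC ler_pM2r ?invr_gt0//.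
  have [v /andP[v0 _]|c /andP[c0 cs] ->] := @mean_value _ D (fun v => f (u + (l + v) *: d) - f (u + v *: d)
      - (f (u + l *: d) - f u)) 0 s s0.
    apply: is_deriveB; first by apply: is_deriveB; [apply: dFD => //; exact: ltW|exact: dF].
    by apply: is_derive_eq; rewrite scaler0 add0r /GRing.scale/= mulr1.
  rewrite subr0 normrM (ger0_norm s0) expr2 mulrA ler_wpM2r//.
  have cd : L * `|c *: d| <= L * s.
    by rewrite ler_wpM2l// normrZ (ger0_norm c0) (le_trans _ cs)// ler_piMr.
  have : `|f (u + (l + c) *: d) - f (u + l *: d)| <= L * s.
    apply: le_trans (fL _ _) _.
    by rewrite opprD addrACA subrr add0r -scalerBl addrAC subrr add0r.
  have : `|f (u + c *: d) - f u| <= L * s.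
    by apply: le_trans (fL _ _) _; rewrite addrAC subrr add0r.
  rewrite !ler_norml => /andP[? ?] /andP[? ?].
  by apply/andP; split; lra.
have [t0|t0] := leP 0 t.
  apply: le_trans (pos x t t0) _; rewrite ler_wpM2r ?sqr_ge0//.
  rewrite ler_wpM2r ?invr_ge0 ?(ltW l0)//; by have : 2 * L <= 4 * L by lra.
(* For negative [t] the previous case is applied from [x + t *: d]; moving the quotient back to [x]
   doubles the constant. *)
have nt0 : 0 <= - t by lra.
have := pos (x + t *: d) (- t) nt0; rewrite -(addrA x) scaleNr subrr addr0 sqrrN.
have := line_quotient_lip L0 fL (x + t *: d) x.
rewrite [x + _]addrC addrK [_ + x]addrC normrZ ltr0_norm// => q1 q2.
have : 2 * L / l * (- t * `|d|) * - t <= 2 * L / l * t ^+ 2.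
  rewrite (_ : _ * _ * _ = 2 * L / l * t ^+ 2 * `|d|); last by ring.
  by rewrite ler_piMr// mulr_ge0 ?sqr_ge0// divr_ge0 ?(ltW l0)// mulr_ge0.
have {q1} := ler_wpM2r nt0 q1; rewrite -{1}[- t]ger0_norm// -normrM.
have -> : 4 * L / l * t ^+ 2 = 2 * L / l * t ^+ 2 + 2 * L / l * t ^+ 2 by ring.
move: q2; set X := 2 * L / l * _; set a := line_average _ _ _ _; set b := line_average _ _ _ _.
set p := line_quotient _ _ _ _; set q := line_quotient _ _ _ _.
rewrite !ler_norml => /andP[? ?] /andP[? ?] ?.
by apply/andP; split; lra.
Qed.

End Averaging.

(** * Taylor expansions with uniform constants *)

Section MoreAveraging.
Context {R : realType} {V : normedModType R}.
Implicit Types (f g h : V -> R) (x y z d : V) (A : (V -> R) -> V -> R).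

Lemma line_average_mean d (l : R) f x : `|d| <= 1 -> 0 < l -> lipschitz_fun f ->
  exists2 c, 0 <= c <= l & line_average d l f x = f (x + c *: d).
Proof.
move=> d1 l0 [L fL].
have [s /andP[s0 _]|c cl E] := @mean_value _ (primitive (fun s => f (x + s *: d)))
    (fun s => f (x + s *: d)) 0 l (ltW l0).
  apply: (@is_derive_primitive _ (fun s => f (x + s *: d)) s); last by lra.
  exact: (lip_continuous (lip_line x fL d1)).
by exists c => //; rewrite /line_average E subr0 mulfK// gt_eqF.
Qed.

(** The remainder is itself a linear combination of [h], its shift and the [k i], so [A] sends it to
    the remainder of [A h] and keeps its bound. *)
Lemma averaging_expansion A (I : Type) (s : seq I) h (k : I -> V -> R)
    (c : I -> R) z (b : R) : averaging A ->
  lipschitz_fun h -> (forall i, lipschitz_fun (k i)) ->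
  (forall y, `|h (y + z) - h y - \sum_(i <- s) c i * k i y| <= b) ->
  forall x, `|A h (x + z) - A h x - \sum_(i <- s) c i * A (k i) x| <= b.
Proof.
move=> hA hh hk hb x; have [Sl <-] := averaging_sum hA s c hk.
rewrite -(averaging_shift hA); set S := fun y => \sum_(i <- s) _ in Sl *.
have hz := lipschitz_fun_shift z hh.
have D := lipschitz_fun_lin 1 (-1) hz hh.
have -> : A (fun y => h (y + z)) x - A h x - A S x =
    A (fun y => 1 * (1 * h (y + z) + -1 * h y) + -1 * S y) x.
  by rewrite !(averaging_lin hA)//; ring.
apply: (averaging_norm_le hA); first exact: lipschitz_fun_lin.
by move=> y; rewrite !mul1r !mulN1r; exact: hb.
Qed.

Lemma is_derive_expansion f x d (a C : R) :
  (forall s : R, `|f (s *: d + x) - f x - s * a| <= C * s ^+ 2) ->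
  is_derive x d f a.
Proof.
move=> fE; have fcvg : (fun s : R => s^-1 *: (f (s *: d + x) - f x)) @ 0^' --> a.
  apply/cvgrPdist_le => e e0; near=> s.
  have s0 : s != 0 by near: s; exact: nbhs_dnbhs_neq.
  have -> : a - s^-1 *: (f (s *: d + x) - f x) =
      - (s^-1 * (f (s *: d + x) - f x - s * a)).
    by rewrite /GRing.scale/=; field.
  rewrite normrN normrM normfV mulrC ler_pdivrMr ?normr_gt0//.
  apply: le_trans (fE s) _; rewrite -real_normK ?num_real// expr2 mulrA.
  rewrite ler_wpM2r//; apply: (@le_trans _ _ ((`|C| + 1) * `|s|)).
    by rewrite ler_wpM2r// (le_trans (ler_norm C))// lerDl.
  rewrite mulrC -ler_pdivlMr ?ltr_wpDl//; near: s; apply: dnbhs0_le.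
  by rewrite divr_gt0// ltr_wpDl.
apply: DeriveDef; first by apply/cvg_ex; exists a.
exact: (cvg_lim _ fcvg).
Unshelve. all: by end_near. Qed.

End MoreAveraging.

Section RowVectors.
Context {R : realType} {n : nat}.
Implicit Types (x y z : 'rV[R]_n).

Lemma coord_le_norm x i : `|x 0 i| <= `|x|.
Proof.
rewrite [leRHS]/Num.norm/= mx_normrE.
exact: (le_bigmax _ (fun ij : 'I_1 * 'I_n => `|x ij.1 ij.2|) (0, i)).
Qed.

Lemma norm_le_coord x (c : R) : 0 <= c -> (forall i, `|x 0 i| <= c) -> `|x| <= c.
Proof.
move=> c0 xc; rewrite /Num.norm/= mx_normrE; apply: bigmax_le => // -[i k] _ /=.
by rewrite (ord1 i).
Qed.

Lemma norm_delta_le1 (i : 'I_n) : `|delta_mx 0 i : 'rV[R]_n| <= 1.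
Proof.
apply: norm_le_coord => // k; rewrite mxE eqxx/= normr_nat.
by case: (k == i); rewrite ?lexx ?ler01.
Qed.

Lemma row_delta_sum x : \sum_i x 0 i *: delta_mx 0 i = x.
Proof. by rewrite -row_sum_delta. Qed.

End RowVectors.

Section Taylor.
Context {R : realType} {n : nat}.
Local Notation V := 'rV[R]_n.
Implicit Types (f g h : V -> R) (x y z : V) (i j : 'I_n) (s : seq 'I_n).

Local Notation e i := (delta_mx 0 i : V).

Definition axis_expansion (C : R) i h (k : V -> R) : Prop :=
  forall x t, `|h (x + t *: e i) - h x - t * k x| <= C * t ^+ 2.

Definition expansion1 (C : R) h (k : 'I_n -> V -> R) : Prop :=
  forall x y, `|h (x + y) - h x - \sum_i y 0 i * k i x| <= C * `|y| ^+ 2.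

Definition expansion2 (K : R) h x (p : V) (H : 'M[R]_n) : Prop :=
  forall y, `|h (x + y) - h x - \sum_i y 0 i * p 0 i - 2^-1 * quad_form H y|
    <= K * `|y| ^+ 3.

Lemma quad_formE (H : 'M[R]_n) y :
  quad_form H y = \sum_i y 0 i * \sum_j y 0 j * H i j.
Proof.
rewrite /quad_form mxE.
under eq_bigr do rewrite !mxE mulr_suml.
rewrite exchange_big; apply: eq_bigr => i _; rewrite mulr_sumr.
by apply: eq_bigr => j _; ring.
Qed.

(** Coordinates are moved one at a time, and each derivative is brought back to [x] by its Lipschitz
    bound. After [m] moves the cost is at most [m ^ 2], since [m ^ 2 + m + 1 <= (m + 1) ^ 2]. *)
Lemma expansion1_axis (C : R) h k : 0 <= C ->
  (forall i, axis_expansion C i h (k i)) -> (forall i, lip C (k i)) ->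
  expansion1 (C * n%:R ^+ 2) h k.
Proof.
move=> C0 hk kC x y.
have main s : `|h (x + \sum_(i <- s) y 0 i *: e i) - h x - \sum_(i <- s) y 0 i * k i x|
    <= C * (size s)%:R ^+ 2 * `|y| ^+ 2 /\
    `|\sum_(i <- s) y 0 i *: e i| <= (size s)%:R * `|y|.
  have yi i : `|y 0 i *: e i| <= `|y|.
    by rewrite normrZ (le_trans _ (coord_le_norm y i))// ler_piMr ?norm_delta_le1.
  elim: s => [|i s [IH1 IH2]].
    rewrite !big_nil addr0 subrr subr0 !normr0 mul0r; split=> //.
    by rewrite mulr_ge0 ?mulr_ge0 ?sqr_ge0.
  rewrite !big_cons; split; last first.
    by rewrite (le_trans (ler_normD _ _))// -[size _]addn1 natrD mulrDl mul1r addrC lerD.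
  set z := \sum_(j <- s) _ in IH1 IH2 *; rewrite [_ + z]addrC addrA.
  have E1 := hk i (x + z) (y 0 i).
  have E2 := kC i (x + z) x; rewrite [x + z]addrC addrK [z + x]addrC in E2.
  have y2 : C * y 0 i ^+ 2 <= C * `|y| ^+ 2.
    rewrite ler_wpM2l// -real_normK ?num_real//.
    by rewrite ler_sqr ?nnegrE// coord_le_norm.
  have E3 : `|y 0 i * (k i (x + z) - k i x)| <= C * (size s)%:R * `|y| ^+ 2.
    rewrite normrM (le_trans (ler_wpM2l _ E2))//.
    rewrite (le_trans (ler_wpM2r _ (coord_le_norm y i))) ?mulr_ge0//.
    by rewrite (le_trans (ler_wpM2l _ (ler_wpM2l _ IH2)))// le_eqVlt; apply/orP; left; apply/eqP; ring.
  have -> : C * (size (i :: s))%:R ^+ 2 * `|y| ^+ 2 =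
     C * (size s)%:R ^+ 2 * `|y| ^+ 2 + C * (size s)%:R * `|y| ^+ 2
     + C * (size s)%:R * `|y| ^+ 2 + C * `|y| ^+ 2.
    by rewrite /= -natr1; ring.
  have : 0 <= C * (size s)%:R * `|y| ^+ 2 by rewrite !mulr_ge0.
  move: E1 E3 IH1; rewrite !ler_norml => /andP[? ?] /andP[? ?] /andP[? ?] ?.
  by apply/andP; split; lra.
have [+ _] := main (enum 'I_n).
by rewrite !big_enum/= row_delta_sum size_enum_ord.
Qed.

Lemma expansion1_averaging A C h k : averaging A ->
  lipschitz_fun h -> (forall i, lipschitz_fun (k i)) ->
  expansion1 C h k -> expansion1 C (A h) (fun i => A (k i)).
Proof.
move=> hA hh hk hC x y; apply: (averaging_expansion hA hh hk) => z.
exact: hC.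
Qed.

Lemma expansion1_quotient (d : V) (l C : R) h k : 0 < l -> 0 <= C ->
  expansion1 C h k ->
  expansion1 (2 * C / l) (line_quotient d l h) (fun i => line_quotient d l (k i)).
Proof.
move=> l0 C0 hC x y; have h1 := hC (x + l *: d) y; have h2 := hC x y.
rewrite /line_quotient.
have -> : \sum_i y 0 i * ((k i (x + l *: d) - k i x) / l) =
  (\sum_i y 0 i * k i (x + l *: d) - \sum_i y 0 i * k i x) / l.
  by rewrite -sumrB mulr_suml; apply: eq_bigr => i _; ring.
rewrite -!mulrBl normrM [`|l^-1|]gtr0_norm ?invr_gt0// [leRHS]mulrAC.
rewrite ler_pM2r ?invr_gt0// [x + y + _]addrAC; move: h1 h2.
rewrite !ler_norml => /andP[? ?] /andP[? ?].
by apply/andP; split; lra.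
Qed.

(** Taylor's formula along the segment from [x] to [x + y]: the derivative of [D] is a sum of
    first-order remainders of the [k i], weighted by the coordinates of [y]. *)
Lemma expansion2_intro (C : R) h k (m : 'I_n -> 'I_n -> V -> R) : 0 <= C ->
  expansion1 C h k -> (forall i, expansion1 C (k i) (m i)) ->
  forall x, expansion2 (C * n%:R) h x (\row_i k i x) (\matrix_(i, j) m i j x).
Proof.
move=> C0 hk km x y.
pose a := \sum_i y 0 i * k i x.
pose b := \sum_i y 0 i * \sum_j y 0 j * m i j x.
have -> : \sum_i y 0 i * (\row_i k i x) 0 i = a.
  by apply: eq_bigr => i _; rewrite mxE.
have -> : quad_form (\matrix_(i, j) m i j x) y = b.
  rewrite quad_formE; apply: eq_bigr => i _; congr (_ * _).
  by apply: eq_bigr => j _; rewrite mxE.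
pose D t := h (x + t *: y) - t * a - 2^-1 * t ^+ 2 * b.
have dD (t : R) : is_derive t 1 D
    (\sum_i y 0 i * k i (x + t *: y) - a - t * b).
  have dh : is_derive t 1 (fun t => h (x + t *: y)) (\sum_i y 0 i * k i (x + t *: y)).
    apply: (@is_derive_expansion _ R _ _ _ _ (C * `|y| ^+ 2)) => s.
    have := hk (x + t *: y) (s *: y); rewrite normrZ.
    have -> : x + t *: y + s *: y = x + (s *: 1 + t) *: y.
      by rewrite [s *: 1]mulr1 scalerDl -addrA [t *: y + _]addrC.
    have -> : \sum_i (s *: y) 0 i * k i (x + t *: y) =
        s * \sum_i y 0 i * k i (x + t *: y).
      by rewrite mulr_sumr; apply: eq_bigr => i _; rewrite mxE mulrA.
    by rewrite exprMn real_normK ?num_real// [s ^+ 2 * _]mulrC mulrA.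
  by apply: is_derive_eq; rewrite /GRing.scale/=; field.
have [c /andP[c0 c1]] := @mean_value _ D
    (fun t => \sum_i y 0 i * k i (x + t *: y) - a - t * b) 0 1 ler01 (fun t _ => dD t).
rewrite /D !scale1r scale0r addr0 => E.
have -> : h (x + y) - h x - a - 2^-1 * b =
  \sum_i y 0 i * k i (x + c *: y) - a - c * b by lra.
rewrite /a /b mulr_sumr -!sumrB (le_trans (ler_norm_sum _ _ _))//.
have -> : C * n%:R * `|y| ^+ 3 = \sum_(i < n) `|y| * (C * `|y| ^+ 2).
  by rewrite sumr_const card_ord -mulr_natr; ring.
apply: ler_sum => i _.
have := km i x (c *: y).
have -> : \sum_j (c *: y) 0 j * m i j x = c * \sum_j y 0 j * m i j x.
  by rewrite mulr_sumr; apply: eq_bigr => j _; rewrite mxE mulrA.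
set S := \sum_j _ => kE.
have -> : y 0 i * k i (x + c *: y) - y 0 i * k i x - c * (y 0 i * S) =
  y 0 i * (k i (x + c *: y) - k i x - c * S) by ring.
rewrite normrM ler_pM// ?coord_le_norm// (le_trans kE)// ler_wpM2l//.
by rewrite ler_sqr ?nnegrE// normrZ ger0_norm// ler_piMl.
Qed.

End Taylor.

(** * Topical functions and their mollification *)

Section Topical.
Context {R : realType} {n : nat}.
Local Notation V := 'rV[R]_n.
Implicit Types (f g : V -> R) (x y z : V).

Definition topical f : Prop :=
  forall x z c, (forall i, z 0 i <= c) -> f (x + z) <= f x + c.

Lemma topical_lip f : topical f -> lip 1 f.
Proof.
move=> hf; have le x z : f (x + z) <= f x + `|z|.
  by apply: hf => i; apply: le_trans (ler_norm _) (coord_le_norm z i).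
move=> x y; rewrite mul1r ler_norml.
have := le y (x - y); rewrite addrC subrK => ?.
have := le x (y - x); rewrite addrC subrK distrC => ?.
by apply/andP; split; lra.
Qed.

Lemma topical_lipschitz f : topical f -> lipschitz_fun f.
Proof. by exists 1; exact: topical_lip. Qed.

Lemma topical_const f x c : topical f -> f (x + const_mx c) = f x + c.
Proof.
move=> hf; apply/eqP; rewrite eq_le hf/=; last by move=> i; rewrite mxE.
have := hf (x + const_mx c) (const_mx (- c)) (- c).
rewrite -addrA (_ : const_mx c + const_mx (- c) = 0) ?addr0; last first.
  by apply/rowP => i; rewrite !mxE subrr.
have H (i : 'I_n) : (const_mx (- c) : V) 0 i <= - c by rewrite mxE.
by move=> /(_ H) ?; lra.
Qed.

Lemma topical_averaging A f : averaging A -> topical f -> topical (A f).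
Proof.
move=> hA hf x z c zc; have lf := topical_lipschitz hf.
rewrite -(averaging_shift hA) -(averaging_cstD hA)//; apply: (averaging_le hA).
- exact: lipschitz_fun_shift.
- have [L lL] := lipschitz_fun_lin 1 1 lf (lipschitz_fun_cst c).
  by exists L => a b; have := lL a b; rewrite !mul1r.
- by move=> y; exact: hf.
Qed.

Lemma topical_convex (a b : R) f g : 0 <= a -> 0 <= b -> a + b = 1 ->
  topical f -> topical g -> topical (fun x => a * f x + b * g x).
Proof.
move=> a0 b0 ab hf hg x z c zc.
have -> : a * f x + b * g x + c = a * (f x + c) + b * (g x + c).
  by rewrite -[c in LHS]mul1r -ab; ring.
by rewrite lerD// ler_wpM2l//; [exact: hf|exact: hg].
Qed.

Lemma topical_addc f c : topical f -> topical (fun x => f x + c).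
Proof. by move=> hf x z c' zc; rewrite addrAC lerD2r; exact: hf. Qed.

Lemma topical_shift f y : topical f -> topical (fun x => f (x + y)).
Proof. by move=> hf x z c zc; rewrite addrAC; exact: hf. Qed.

(** The point [x + const_mx c] is reached from [x + z] by raising each coordinate [i] by the
    nonnegative amount [c - z 0 i]. *)
Lemma admissible_topical f : admissible f -> topical f.
Proof.
move=> [_ fmon _ _ fc] x z c zc; rewrite -fc.
have -> : x + const_mx c = x + z + \sum_i (c - z 0 i) *: delta_mx 0 i.
  rewrite -addrA; congr (_ + _); rewrite -{1}(row_delta_sum z) -big_split/=.
  rewrite -[LHS]row_delta_sum; apply: eq_bigr => i _.
  by rewrite -scalerDl mxE; congr (_ *: _); ring.
move: (x + z) => y; elim/big_rec: _ => [|i w _ IH]; first by rewrite addr0.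
by rewrite addrCA addrC; apply: le_trans IH (fmon _ _ _ _); rewrite subr_ge0.
Qed.

End Topical.

(** * Box averages and their derivatives *)

Section Mollifier.
Context {R : realType} {n : nat}.
Local Notation V := 'rV[R]_n.
Implicit Types (f g h : V -> R) (x y z : V) (i j : 'I_n) (s : seq 'I_n).

Local Notation e i := (delta_mx 0 i : V).

Lemma expansion1W (C D : R) h k : C <= D -> expansion1 C h k -> expansion1 D h k.
Proof. by move=> CD hC x y; apply: le_trans (hC x y) _; rewrite ler_wpM2r. Qed.

Variable l : R.
Hypothesis l0 : 0 < l.

Definition box_average s f : V -> R :=
  foldr (fun i => line_average (e i) l) f s.

(** This is the partial derivative of the box average in direction [i]: the average along that axis
    becomes a difference quotient. *)
Fixpoint box_derivative s i f : V -> R :=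
  if s is j :: s' then
    if j == i then line_quotient (e i) l (box_average s' f)
    else line_average (e j) l (box_derivative s' i f)
  else fun=> 0.

Let avg i := line_average_averaging (norm_delta_le1 i : `|e i| <= 1) l0.

Lemma box_average_averaging s : averaging (box_average s).
Proof.
elim: s => [|i s IH]; first exact: averaging_id.
exact: averaging_comp (avg i) IH.
Qed.

Lemma box_derivative_lip L s i f : 0 <= L -> lip L f ->
  lip (2 * L / l) (box_derivative s i f).
Proof.
move=> L0 fL; have c0 : 0 <= 2 * L / l by rewrite divr_ge0 ?mulr_ge0 ?(ltW l0).
elim: s => [|j s IH] /=.
  by move=> x y; rewrite subrr normr0 mulr_ge0.
case: eqP => _; last exact: (averaging_lip (avg j)).
by apply: line_quotient_lip => //; exact: (averaging_lip (box_average_averaging s)).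
Qed.

Lemma box_average_axis L s i f : 0 <= L -> lip L f -> i \in s ->
  axis_expansion (4 * L / l) i (box_average s f) (box_derivative s i f).
Proof.
move=> L0 fL; elim: s => //= j s IH; rewrite inE eq_sym.
have [->|ji] := eqVneq j i => /= [_ x t|/IH {}IH x t].
  apply: (line_average_expansion (norm_delta_le1 i) l0) => //.
  exact: (averaging_lip (box_average_averaging s)).
have hB : lipschitz_fun (box_average s f).
  by exists L; exact: (averaging_lip (box_average_averaging s)).
have hD : lipschitz_fun (box_derivative s i f).
  by exists (2 * L / l); exact: box_derivative_lip.
have H y : `|box_average s f (y + t *: e i) - box_average s f y
    - \sum_(u <- [:: tt]) t * box_derivative s i f y| <= 4 * L / l * t ^+ 2.
  by rewrite big_seq1; exact: IH.
by have := averaging_expansion (avg j) hB (fun=> hD) H x; rewrite big_seq1.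
Qed.

Lemma box_average_expansion1 L f : 0 <= L -> lip L f ->
  expansion1 (4 * L / l * n%:R ^+ 2) (box_average (enum 'I_n) f)
    (fun i => box_derivative (enum 'I_n) i f).
Proof.
move=> L0 fL; apply: expansion1_axis.
- by rewrite divr_ge0 ?mulr_ge0 ?(ltW l0).
- by move=> i; apply: box_average_axis => //; rewrite mem_enum.
- move=> i x y; apply: le_trans (box_derivative_lip _ _ L0 fL x y) _.
  rewrite ler_wpM2r// ler_wpM2r ?invr_ge0 ?(ltW l0)//.
  by have : 2 * L <= 4 * L by lra.
Qed.

(** Difference quotients and averages both preserve first-order expansions, so the gradient of a
    second box average is again differentiable with a uniform remainder. The constant covers both
    operations. *)
Lemma box_derivative_expansion1 C g k s i : 0 <= C ->
  lipschitz_fun g -> (forall i, lipschitz_fun (k i)) -> expansion1 C g k ->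
  exists2 m, forall j, lipschitz_fun (m j) &
    expansion1 (C + 2 * C / l) (box_derivative s i g) m.
Proof.
move=> C0 hg hk gk; have Cl : 0 <= 2 * C / l.
  by rewrite divr_ge0 ?mulr_ge0 ?(ltW l0).
elim: s => [|j s [m hm IH]].
  exists (fun _ _ => 0) => [_|x y]; first exact: lipschitz_fun_cst.
  rewrite /= big1 ?subr0 ?normr0; last by move=> ? _; rewrite mulr0.
  by rewrite mulr_ge0// addr_ge0.
rewrite /=; case: eqP => _.
  exists (fun j => line_quotient (e i) l (box_average s (k j))).
    move=> j'; have [L /(averaging_lip (box_average_averaging s)) /lip_ge0 kL] := hk j'.
    by eexists; apply: line_quotient_lip kL.
  apply: (@expansion1W (2 * C / l)); first by rewrite lerDr.
  apply: expansion1_quotient => //.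
  exact: expansion1_averaging (box_average_averaging s) hg hk gk.
have hB : lipschitz_fun (box_derivative s i g).
  by have [L /lip_ge0 gL] := hg; eexists; apply: box_derivative_lip gL.
exists (fun j' => line_average (e j) l (m j')).
  by move=> j'; exact: (averaging_lipschitz (avg j)).
exact: expansion1_averaging (avg j) hB hm IH.
Qed.

(** Each average is a value at a point moved by at most [l] in a nonnegative direction, so
    monotonicity puts the mollification on one side of [f]. *)
Lemma box_average_topical s f x : topical f ->
  f x <= box_average s f x <= f x + (size s)%:R * l.
Proof.
move=> hf; elim: s x => [|i s IH] x; first by rewrite /= mul0r addr0 lexx.
have tB := topical_averaging (box_average_averaging s) hf.
have [c /andP[c0 cl] /= ->] := line_average_mean x (norm_delta_le1 i : `|e i| <= 1) l0
  (topical_lipschitz tB).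
have ei k : 0 <= (e i) 0 k <= 1 by rewrite mxE eqxx/=; case: (k == i); rewrite ?lexx ler01.
have /andP[lo up] := IH x.
rewrite -[(size s).+1]addn1 natrD mulrDl mul1r addrA; apply/andP; split.
  apply: (le_trans lo).
  have := tB (x + c *: e i) (- (c *: e i)) 0.
  rewrite addrK addr0; apply => k.
  by rewrite mxE oppr_le0 mxE mulr_ge0//; case/andP: (ei k).
apply: (@le_trans _ _ (box_average s f x + l)); last by rewrite lerD2r.
apply: tB => k; rewrite mxE (le_trans _ cl)// ler_piMr//.
by case/andP: (ei k).
Qed.

End Mollifier.

Section MollifierExists.
Context {R : realType} {n : nat}.
Local Notation V := 'rV[R]_n.
Implicit Types (f : V -> R) (x : V).

(* Two successive box averages: the first makes a Lipschitz function C^{1,1},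
   and the second one integrates the resulting gradient expansion once more. *)
Lemma mollifier (d : R) : 0 < d ->
  exists (M : (V -> R) -> V -> R) (K : R), [/\ 0 < K, averaging M,
    (forall f, topical f -> forall x, f x <= M f x <= f x + d) &
    forall f, topical f -> forall x, exists p H, expansion2 K (M f) x p H].
Proof.
(* Two box averages raise a function by at most [2 * n * l]; the [+ 1] keeps the denominator
   positive also for [n = 0]. *)
move=> d0; pose l : R := d / (2 * n%:R + 1).
have l0 : 0 < l by rewrite divr_gt0// ltr_wpDl// mulr_ge0.
have ld : n%:R * l + n%:R * l <= d.
  rewrite /l -mulrDl mulrA ler_pdivrMr ?ltr_wpDl ?mulr_ge0//.
  by have : 0 <= n%:R :> R by []; nra.
pose N := box_average l (enum 'I_n); pose C1 : R := 4 * 1 / l * n%:R ^+ 2.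
have C10 : 0 <= C1 by rewrite /C1 mulr_ge0 ?sqr_ge0// divr_ge0// ltW.
have Cl : 0 <= 2 * C1 / l by apply: divr_ge0 (ltW l0); exact: mulr_ge0.
pose C := C1 + 2 * C1 / l; have C0 : 0 <= C by exact: addr_ge0.
have hN : averaging N := box_average_averaging l0 _.
exists (fun f => N (N f)), (C * n%:R + 1); split.
- by rewrite ltr_wpDl// mulr_ge0.
- exact: averaging_comp.
- move=> f tf x; have := box_average_topical l0 (enum 'I_n) x tf.
  have := box_average_topical l0 (enum 'I_n) x (topical_averaging hN tf).
  rewrite size_enum_ord -/N => /andP[? ?] /andP[? ?].
  by apply/andP; split; lra.
- move=> f tf x; have f1 := topical_lip tf.
  have N1 : lip 1 (N f) := averaging_lip hN f1.
  have E1 := box_average_expansion1 l0 ler01 f1.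
  have E2 := box_average_expansion1 l0 ler01 N1.
  have hk i : lipschitz_fun (box_derivative l (enum 'I_n) i f).
    by eexists; exact: (box_derivative_lip l0 _ _ ler01 f1).
  have /choice[m mE] : forall i, exists m,
      expansion1 C (box_derivative l (enum 'I_n) i (N f)) m.
    move=> i; have [m _ ?] := box_derivative_expansion1 l0 (enum 'I_n) i C10
      (ex_intro (fun L => lip L (N f)) 1 N1) hk E1.
    by exists m.
  have CC : C1 <= C by rewrite lerDl.
  have E := expansion2_intro C0 (expansion1W CC E2) mE x.
  eexists; eexists => y; apply: le_trans (E y) _.
  by rewrite ler_wpM2r ?exprn_ge0// lerDl.
Qed.

End MollifierExists.

(** * The game operator *)

(** Stands in for passages to the limit [t -> 0] throughout: it suffices to exhibit an error linear
    in [t]. *)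
Lemma ge0_linear_bound {R : realFieldType} (a c : R) :
  (forall t, 0 < t <= 1 -> - (t * c) <= a) -> 0 <= a.
Proof.
move=> H; rewrite leNgt; apply/negP => a0.
have c1 : 0 < `|c| + 1 by rewrite ltr_wpDl.
pose t := Num.min 1 (- a / (`|c| + 1) / 2).
have t0 : 0 < t by rewrite lt_min ltr01/= !divr_gt0// oppr_gt0.
have t1 : t <= 1 by rewrite ge_min lexx.
have := H t; rewrite t0 t1 => /(_ isT).
have : t * (`|c| + 1) <= - a / 2.
  by rewrite -ler_pdivlMr// mulrAC ge_min lexx orbT.
have : t * c <= t * (`|c| + 1).
  by rewrite ler_wpM2l ?(ltW t0)// (le_trans (ler_norm c))// lerDl.
lra.
Qed.

Section GameBounds.
Context {R : realType} {n : nat}.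
Local Notation V := 'rV[R]_n.
Implicit Types (f g U : V -> R) (x y z : V) (v : @cube n).

Definition binary (h : R) (w : V) g x : R := 2^-1 * (g (x + h *: w) + g (x - h *: w)).

Lemma vertex_norm v : `|vertex v : V| <= 1.
Proof.
by apply: norm_le_coord => // i; rewrite mxE normr_nat; case: (v i); rewrite ?lexx ?ler01.
Qed.

Lemma vertex0 : vertex [ffun=> false] = 0 :> V.
Proof. by apply/rowP => i; rewrite !mxE ffunE. Qed.

Lemma binary0 h g x : binary h 0 g x = g x.
Proof. by rewrite /binary scaler0 subr0 addr0; field. Qed.

Lemma quad_formZ (H : 'M[R]_n) (t : R) y : quad_form H (t *: y) = t ^+ 2 * quad_form H y.
Proof.
rewrite !quad_formE mulr_sumr; apply: eq_bigr => i _; rewrite mxE.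
have -> : \sum_j (t *: y) 0 j * H i j = t * \sum_j y 0 j * H i j.
  by rewrite mulr_sumr; apply: eq_bigr => j _; rewrite mxE mulrA.
by ring.
Qed.

Lemma le_max_quad (H : 'M[R]_n) v : quad_form H (vertex v) <= max_quad H.
Proof. exact: (le_bigmax 0 (fun u => quad_form H (vertex u))). Qed.

Lemma max_quad_ge0 (H : 'M[R]_n) : 0 <= max_quad H.
Proof. exact: bigmax_ge_id. Qed.

Lemma max_quad_le (H : 'M[R]_n) (b : R) : 0 <= b ->
  (forall v, quad_form H (vertex v) <= b) -> max_quad H <= b.
Proof. by move=> b0 Hb; apply: bigmax_le. Qed.

Lemma expectation_le eps g1 g2 x y c a p :
  @distribution R 'I_n a -> @distribution R (@cube n) p ->
  (forall d, g1 (x + d) <= g2 (y + d) + c) ->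
  expectation eps g1 x a p <= expectation eps g2 y a p + c.
Proof.
move=> [a0 a1] [p0 p1] H; rewrite /expectation.
have cE : c = \sum_k a k * c by rewrite -mulr_suml a1 mul1r.
rewrite [in leRHS]cE -big_split/=.
apply: ler_sum => k _; rewrite -mulrDr ler_wpM2l//.
have {}cE : c = \sum_v p v * c by rewrite -mulr_suml p1 mul1r.
rewrite [in leRHS]cE -big_split/=.
by apply: ler_sum => v _; rewrite -mulrDr ler_wpM2l.
Qed.

Hypothesis n0 : (0 < n)%N.

(** The player copies an optimal mix for [g2] at [y]; the bound then holds against every answer of
    the market. *)
Lemma le_minmax eps g1 g2 x y c :
  (forall d, g1 (x + d) <= g2 (y + d) + c) ->
  minmax eps g1 x <= minmax eps g2 y + c.
Proof.
move=> H; have [[a ad <-] _] := minmaxP eps g2 y n0.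
have [_ /(_ a ad) /le_trans ->//] := minmaxP eps g1 x n0.
have [[p pd <-] _] := max_marketP eps g1 x a.
have [_ /(_ p pd) pm] := max_marketP eps g2 y a.
by apply: (le_trans (expectation_le eps ad pd H)); rewrite lerD2r.
Qed.

Lemma topical_minmax eps g : topical g -> topical (minmax eps g).
Proof.
move=> tg x z c zc; apply: le_minmax => d.
by rewrite addrAC; exact: tg.
Qed.

(** The diagonal part of each displacement leaves [g] as a constant, so the player's mix [a] enters
    only through a term linear in [a]. *)
Lemma expectation_topical eps g x a p : topical g -> @distribution R 'I_n a ->
  expectation eps g x a p =
  \sum_v p v * (g (x + eps *: vertex v) - eps * \sum_k a k * (v k)%:R).
Proof.
move=> tg [_ a1]; rewrite /expectation; under eq_bigr do rewrite mulr_sumr.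
rewrite exchange_big; apply: eq_bigr => v _.
under eq_bigr do rewrite mulrCA.
rewrite -mulr_sumr; congr (_ * _).
have E k : g (x + eps *: (vertex v - const_mx (v k)%:R)) =
    g (x + eps *: vertex v) - eps * (v k)%:R.
  rewrite -(topical_const _ _ tg); congr (g _); rewrite scalerBr addrA.
  by congr (_ + _); apply/rowP => i; rewrite !mxE.
under eq_bigr do rewrite E mulrBr.
rewrite sumrB -mulr_suml a1 mul1r; congr (_ - _).
by rewrite mulr_sumr; apply: eq_bigr => k _; rewrite mulrCA.
Qed.

(* The market plays v and its complement with equal probability, which makes the
   player's choice irrelevant. *)
Lemma binary_le_minmax eps g x v : topical g ->
  binary eps (vertex v) g x <= minmax eps g x.
Proof.
move=> tg; have [[a ad <-] _] := minmaxP eps g x n0.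
pose vc : @cube n := [ffun i => ~~ v i].
pose p (u : @cube n) : R := 2^-1 * ((u == v)%:R + (u == vc)%:R).
have sump (F : @cube n -> R) : \sum_u p u * F u = 2^-1 * (F v + F vc).
  rewrite /p; under eq_bigr do rewrite -mulrA mulrDl.
  rewrite -mulr_sumr big_split/=; congr (_ * (_ + _)).
    rewrite (bigD1 v)//= eqxx mul1r big1 ?addr0// => u /negPf ->.
    by rewrite mul0r.
  rewrite (bigD1 vc)//= eqxx mul1r big1 ?addr0// => u /negPf ->.
  by rewrite mul0r.
have pd : distribution p.
  split=> [u|]; first by rewrite mulr_ge0 ?addr_ge0.
  have := sump (fun=> 1); under eq_bigr do rewrite mulr1.
  by move=> ->; rewrite mulVf.
have [_ /(_ p pd)] := max_marketP eps g x a; apply: le_trans.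
rewrite (expectation_topical _ _ _ tg ad) sump /binary.
(* Since [vc] is the complement of [v], its value is that of [- v] raised by [eps]. This [eps], and
   the mix [a] with it, cancels because the weights of [a] on [v] and on [vc] add up to 1. *)
have -> : g (x + eps *: vertex vc) = g (x - eps *: vertex v) + eps.
  rewrite -(topical_const _ _ tg); congr (g _); rewrite -addrA; congr (_ + _).
  by apply/rowP => i; rewrite !mxE ffunE; case: (v i) => /=; ring.
case: ad => _ a1.
have : \sum_k a k * (vc k)%:R = 1 - \sum_k a k * (v k)%:R.
  rewrite -[X in X - _]a1 -sumrB; apply: eq_bigr => k _; rewrite ffunE.
  by case: (v k) => /=; ring.
by move=> ->; lra.
Qed.

Lemma expansion2_binary (h K : R) U x p H w : `|w| <= 1 -> 0 <= K -> 0 <= h ->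
  expansion2 K U x p H ->
  `|binary h w U x - U x - h ^+ 2 / 2 * quad_form H w| <= K * h ^+ 3.
Proof.
move=> w1 K0 h0 UE; have := UE (h *: w); have := UE (- (h *: w)).
rewrite normrN -scaleNr !quad_formZ sqrrN.
have -> : \sum_i (- h *: w) 0 i * p 0 i = - \sum_i (h *: w) 0 i * p 0 i.
  by rewrite -sumrN; apply: eq_bigr => i _; rewrite !mxE; ring.
have : K * `|h *: w| ^+ 3 <= K * h ^+ 3.
  by rewrite ler_wpM2l// lerXn2r ?nnegrE// normrZ ger0_norm// ler_piMr.
rewrite /binary scaleNr; move=> Kh.
rewrite !ler_norml => /andP[? ?] /andP[? ?].
by apply/andP; split; lra.
Qed.

(** Lowering a coordinate does not increase [U], which makes the entries nonnegative; moving along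
    the diagonal adds exactly the displacement, which makes their sum 1. Hence the gradient is a
    legitimate mix for the player. *)
Lemma expansion2_gradient K U x p H : 0 <= K -> topical U ->
  expansion2 K U x p H -> @distribution R 'I_n (p 0).
Proof.
move=> K0 tU UE.
have q1 (t Q : R) : `|2^-1 * t ^+ 2 * Q| <= t ^+ 2 * `|Q|.
  rewrite 2!normrM (ger0_norm (sqr_ge0 t)) gtr0_norm ?invr_gt0//.
  have : 0 <= t ^+ 2 * `|Q| by rewrite mulr_ge0 ?sqr_ge0.
  by rewrite -mulrA; lra.
split.
  move=> i; apply: (@ge0_linear_bound _ _ (`|quad_form H (delta_mx 0 i)| + K)) => t /andP[t0 t1].
  have := UE (- (t *: delta_mx 0 i)); rewrite normrN -scaleNr quad_formZ sqrrN.
  have -> : \sum_j (- t *: (delta_mx 0 i : V)) 0 j * p 0 j = - (t * p 0 i).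
    rewrite (bigD1 i)//= big1 ?addr0; last first.
      by move=> j /negPf ji; rewrite !mxE ji andbF mulr0 mul0r.
    by rewrite !mxE !eqxx mulr1 mulNr.
  have dom : U (x - t *: delta_mx 0 i) <= U x.
    rewrite -[leRHS]addr0; apply: tU => j; rewrite !mxE.
    by rewrite oppr_le0 mulr_ge0// ltW.
  have : K * `|t *: delta_mx 0 i : V| ^+ 3 <= t * (t * K).
    have : `|t *: delta_mx 0 i : V| ^+ 3 <= t ^+ 3.
      by rewrite lerXn2r ?nnegrE ?(ltW t0)// normrZ gtr0_norm// ler_piMr ?norm_delta_le1 ?ltW.
    move=> /(ler_wpM2l K0) /le_trans; apply.
    rewrite (_ : K * t ^+ 3 = t * (t * K) * t); last by ring.
    by rewrite ler_piMr// !mulr_ge0// ltW.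
  have := q1 t (quad_form H (delta_mx 0 i)); rewrite scaleNr in dom *.
  rewrite !ler_norml => /andP[Q _] KE /andP[E _].
  rewrite -(ler_pM2l t0); move: Q KE E dom.
  set Q := quad_form _ _; set N := `|Q|; set M := `|t *: _|.
  have -> : t * - (t * (N + K)) = - (t ^+ 2 * N) - t * (t * K) by ring.
  lra.
have UE1 t : 0 < t -> `|t * (1 - \sum_i p 0 i) - 2^-1 * t ^+ 2 * quad_form H (const_mx 1)| <= K * t ^+ 3.
  move=> t0; have := UE (t *: const_mx 1); rewrite quad_formZ.
  have -> : t *: const_mx 1 = const_mx t :> V by apply/rowP => i; rewrite !mxE mulr1.
  rewrite topical_const//.
  have -> : \sum_i (const_mx t : V) 0 i * p 0 i = t * \sum_i p 0 i.
    by rewrite mulr_sumr; apply: eq_bigr => i _; rewrite mxE.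
  have : `|const_mx t : V| ^+ 3 <= t ^+ 3.
    rewrite lerXn2r ?nnegrE ?(ltW t0)//; apply: norm_le_coord; first exact: ltW.
    by move=> i; rewrite mxE gtr0_norm.
  move=> /(ler_wpM2l K0) + E; apply: le_trans; apply: le_trans E.
  by rewrite le_eqVlt; apply/orP; left; apply/eqP; congr (`|_|); ring.
set Q := quad_form _ _ in UE1.
have bound t : 0 < t <= 1 -> `|1 - \sum_i p 0 i| <= t * (`|Q| + K).
  move=> /andP[t0 t1]; rewrite -(ler_pM2l t0).
  have := UE1 t t0.
  have k1 : K * t ^+ 3 <= t * (t * K).
    rewrite (_ : K * t ^+ 3 = t * (t * K) * t); last by ring.
    by rewrite ler_piMr// !mulr_ge0// ltW.
  have -> : t * `|1 - \sum_i p 0 i| = `|t * (1 - \sum_i p 0 i)| by rewrite normrM gtr0_norm.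
  move=> E.
  have := ler_normD (t * (1 - \sum_i p 0 i) - 2^-1 * t ^+ 2 * Q) (2^-1 * t ^+ 2 * Q).
  by rewrite subrK; have := q1 t Q; lra.
apply/eqP; rewrite -subr_eq0 -normr_eq0 eq_le normr_ge0 andbT distrC -oppr_ge0.
apply: (@ge0_linear_bound _ _ (`|Q| + K)) => t /bound.
by rewrite lerN2.
Qed.

(* The player answers with the gradient of U, so that only the second-order
   term survives, whatever the market does. *)
Lemma minmax_expansion2 (eps K : R) U x p H : 0 <= eps -> 0 <= K -> topical U ->
  expansion2 K U x p H ->
  minmax eps U x <= U x + eps ^+ 2 / 2 * max_quad H + K * eps ^+ 3.
Proof.
move=> e0 K0 tU UE; have pd := expansion2_gradient K0 tU UE.
have [_ /(_ _ pd) /le_trans ->//] := minmaxP eps U x n0.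
have [[q [q0 q1] <-] _] := max_marketP eps U x (p 0).
rewrite (expectation_topical _ _ _ tU pd); set B := (X in _ <= X).
have -> : B = \sum_v q v * B by rewrite -mulr_suml q1 mul1r.
apply: ler_sum => v _; rewrite ler_wpM2l//.
have := UE (eps *: vertex v); rewrite quad_formZ.
have -> : \sum_i (eps *: vertex v) 0 i * p 0 i = eps * \sum_k p 0 k * (v k)%:R.
  by rewrite mulr_sumr; apply: eq_bigr => i _; rewrite !mxE; ring.
have : K * `|eps *: vertex v : V| ^+ 3 <= K * eps ^+ 3.
  by rewrite ler_wpM2l// lerXn2r ?nnegrE// normrZ ger0_norm// ler_piMr// vertex_norm.
have : eps ^+ 2 / 2 * quad_form H (vertex v) <= eps ^+ 2 / 2 * max_quad H.
  by rewrite ler_wpM2l ?le_max_quad// divr_ge0// sqr_ge0.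
by move=> ? ?; rewrite /B ler_norml => /andP[? ?]; lra.
Qed.

Lemma topical_binary (h : R) w g : topical g -> topical (binary h w g).
Proof.
move=> tg; rewrite /binary.
rewrite (_ : (fun x => _) = (fun x => 2^-1 * g (x + h *: w) + 2^-1 * g (x + - (h *: w)))).
  apply: topical_convex; rewrite ?invr_ge0//; first by field.
    exact: topical_shift.
  exact: topical_shift.
by apply/funext => x; rewrite mulrDr.
Qed.

Lemma averaging_binary A (h : R) w g x : averaging A -> lipschitz_fun g ->
  A (binary h w g) x = binary h w (A g) x.
Proof.
move=> hA lg; rewrite /binary -!(averaging_shift hA) mulrDr -(averaging_lin hA);
  try exact: lipschitz_fun_shift.
by congr (A _ x); apply/funext => y; rewrite mulrDr.
Qed.

End GameBounds.

(** * Polynomial test functions *)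

Section Smooth.
Context {R : realType} {V : normedModType R}.
Implicit Types (f g : V -> R) (c : R) (k : nat).

Lemma CkW k f : Ck k.+1 f -> Ck k f.
Proof.
elim: k f => [f []//|k IH f [cf df]]; split=> // d; have [ddf Cdf] := df d.
by split=> //; exact: IH.
Qed.

Lemma eq_Ck k f g : g =1 f -> Ck k f -> Ck k g.
Proof. by move=> /funext ->. Qed.

Lemma Ck_cst k c : Ck k (fun _ : V => c).
Proof.
elim: k c => [|k IH] c; first exact: cst_continuous.
split=> [|d]; first exact: cst_continuous.
split=> [x|]; first exact: derivable_cst.
by apply: (eq_Ck _ (IH 0)) => x; rewrite derive_cst.
Qed.

Lemma Ck_add k f g : Ck k f -> Ck k g -> Ck k (fun x => f x + g x).
Proof.
elim: k f g => [|k IH] f g.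
  by move=> cf cg x; apply: cvgD; [exact: cf|exact: cg].
move=> [cf df] [cg dg]; split=> [x|d].
  by apply: cvgD; [exact: cf|exact: cg].
have [ddf Cdf] := df d; have [ddg Cdg] := dg d.
split=> [x|]; first exact: derivableD.
by apply: (eq_Ck _ (IH _ _ Cdf Cdg)) => x; rewrite -deriveD.
Qed.

Lemma Ck_mul k f g : Ck k f -> Ck k g -> Ck k (fun x => f x * g x).
Proof.
elim: k f g => [|k IH] f g.
  by move=> cf cg x; apply: cvgM; [exact: cf|exact: cg].
move=> Cf Cg; have [cf df] := Cf; have [cg dg] := Cg; split=> [x|d].
  by apply: cvgM; [exact: cf|exact: cg].
have [ddf Cdf] := df d; have [ddg Cdg] := dg d.
split=> [x|]; first exact: derivableM.
apply: (@eq_Ck _ (fun x => f x * 'D_d g x + g x * 'D_d f x)).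
  by move=> x; rewrite [LHS]deriveM.
by apply: Ck_add; apply: IH => //; exact: CkW.
Qed.

Lemma eq_smooth f g : g =1 f -> smooth f -> smooth g.
Proof. by move=> /funext ->. Qed.

Lemma smooth_cst c : smooth (fun _ : V => c).
Proof. by move=> k; exact: Ck_cst. Qed.

Lemma smooth_add f g : smooth f -> smooth g -> smooth (fun x => f x + g x).
Proof. by move=> Cf Cg k; exact: Ck_add. Qed.

Lemma smooth_mul f g : smooth f -> smooth g -> smooth (fun x => f x * g x).
Proof. by move=> Cf Cg k; exact: Ck_mul. Qed.

Lemma smooth_sub f g : smooth f -> smooth g -> smooth (fun x => f x - g x).
Proof.
move=> Cf Cg; apply: (@eq_smooth (fun x => f x + -1 * g x)).
  by move=> x; rewrite mulN1r.
by apply: smooth_add => //; apply: smooth_mul => //; exact: smooth_cst.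
Qed.

Lemma smooth_exp f k : smooth f -> smooth (fun x => f x ^+ k).
Proof.
move=> Cf; elim: k => [|k IH]; first exact: smooth_cst.
apply: (@eq_smooth (fun x => f x * f x ^+ k)); last exact: smooth_mul.
by move=> x; rewrite exprS.
Qed.

Lemma smooth_sum (I : Type) (s : seq I) (F : I -> V -> R) :
  (forall i, smooth (F i)) -> smooth (fun x => \sum_(i <- s) F i x).
Proof.
move=> CF; elim: s => [|i s IH].
  by apply: (@eq_smooth (fun=> 0)); [move=> x; rewrite big_nil|exact: smooth_cst].
apply: (@eq_smooth (fun x => F i x + \sum_(j <- s) F j x)).
  by move=> x; rewrite big_cons.
exact: smooth_add.
Qed.

Lemma smooth_linear f : continuous f ->
  (forall x d (s : R), f (s *: d + x) = s * f d + f x) -> smooth f.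
Proof.
move=> cf lf [|k] //; split=> // d.
have df x : is_derive x d f (f d).
  apply: (@is_derive_expansion _ _ _ _ _ _ 0) => s.
  by rewrite lf addrK subrr normr0 mul0r.
split=> [x|]; first by have [] := df x.
by apply: (eq_Ck _ (Ck_cst k (f d))) => x; have [] := df x.
Qed.

End Smooth.

(** * Second-order calculus of polynomial test functions *)

Section Jets.
Context {R : realType} {n : nat}.
Local Notation V := 'rV[R]_n.
Implicit Types (f : V -> R) (x y z v : V) (p : V) (H : 'M[R]_n).

Definition dot x y : R := \sum_i x 0 i * y 0 i.

(** Test functions penalise with the Euclidean square because the sup norm is not smooth;
    [norm_le_sqnorm] and [sqnorm_le_norm] compare the two. *)
Definition sqnorm x : R := dot x x.

Lemma dotC x y : dot x y = dot y x.
Proof. by apply: eq_bigr => i _; rewrite mulrC. Qed.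

Lemma dotDl x y z : dot (x + y) z = dot x z + dot y z.
Proof. by rewrite -big_split; apply: eq_bigr => i _; rewrite mxE mulrDl. Qed.

Lemma dotZl (t : R) x z : dot (t *: x) z = t * dot x z.
Proof. by rewrite mulr_sumr; apply: eq_bigr => i _; rewrite mxE mulrA. Qed.

Lemma dotBl x y z : dot (x - y) z = dot x z - dot y z.
Proof. by rewrite dotDl -scaleN1r dotZl mulN1r. Qed.

Lemma dot0l x : dot 0 x = 0.
Proof. by rewrite -(scale0r x) dotZl mul0r. Qed.

Lemma sqnorm0 : sqnorm 0 = 0.
Proof. exact: dot0l. Qed.

Lemma sqnormB x y : sqnorm (x - y) = sqnorm x - 2 * dot x y + sqnorm y.
Proof.
by rewrite /sqnorm dotBl (dotC x (x - y)) (dotC y (x - y)) !dotBl (dotC y x); ring.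
Qed.

Lemma sqnormZ (t : R) x : sqnorm (t *: x) = t ^+ 2 * sqnorm x.
Proof. by rewrite /sqnorm dotZl dotC dotZl; ring. Qed.

Lemma quad_form0 H : quad_form H 0 = 0.
Proof. by rewrite -(scale0r (0 : V)) quad_formZ expr0n mul0r. Qed.

Lemma dot_delta x (i : 'I_n) : dot x (delta_mx 0 i) = x 0 i.
Proof.
rewrite /dot (bigD1 i)//= big1 ?addr0; last first.
  by move=> j /negPf ji; rewrite [X in _ * X]mxE ji andbF mulr0.
by rewrite [X in _ * X]mxE !eqxx mulr1.
Qed.

Lemma dot_row H x (i : 'I_n) : dot x (row i H) = \sum_j x 0 j * H i j.
Proof. by apply: eq_bigr => j _; rewrite mxE. Qed.

Lemma sqnorm_ge0 x : 0 <= sqnorm x.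
Proof. by apply: sumr_ge0 => i _; rewrite -expr2 sqr_ge0. Qed.

Lemma norm_le_sqnorm x : `|x| ^+ 2 <= sqnorm x.
Proof.
rewrite -[leRHS]sqr_sqrtr ?sqnorm_ge0// lerXn2r ?nnegrE ?sqrtr_ge0//.
apply: norm_le_coord; first exact: sqrtr_ge0.
move=> i; rewrite -sqrtr_sqr ler_sqrt ?sqnorm_ge0// /sqnorm /dot (bigD1 i)//=.
by rewrite expr2 lerDl sumr_ge0// => j _; rewrite -expr2 sqr_ge0.
Qed.

Lemma sqnorm_le_norm x : sqnorm x <= n%:R * `|x| ^+ 2.
Proof.
rewrite -[n in n%:R]card_ord -sum1_card natr_sum mulr_suml; apply: ler_sum => i _.
rewrite mul1r -expr2 -real_normK ?num_real// lerXn2r ?nnegrE//.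
exact: coord_le_norm.
Qed.

Lemma dot_le x p : `|dot x p| <= n%:R * `|p| * `|x|.
Proof.
apply: le_trans (ler_norm_sum _ _ _) _.
rewrite -[n in n%:R]card_ord -sum1_card natr_sum !mulr_suml; apply: ler_sum => i _.
by rewrite mul1r normrM mulrC ler_pM// coord_le_norm.
Qed.

Lemma lip_dot p : lip (n%:R * `|p|) (fun x => dot x p).
Proof. by move=> x y; rewrite -dotBl dot_le. Qed.

Lemma dot_continuous p : continuous (fun x => dot x p).
Proof. exact: lip_continuous (lip_dot p). Qed.

(** Partial derivatives are hidden and only the linear form [g] and the quadratic form [q] are
    exposed. Sum and product rules then become identities between scalars, and [jet_hessian]
    evaluates the Hessian of a composite test function without computing its entries. *)
Definition jet f (g q : V -> V -> R) : Prop :=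
  exists (G : V -> 'I_n -> R) (S : V -> 'I_n -> 'I_n -> R),
  [/\ forall x i, is_derive x (delta_mx 0 i) f (G x i),
      forall x i j, is_derive x (delta_mx 0 i) (fun y => G y j) (S x i j),
      forall x v, g x v = \sum_i v 0 i * G x i &
      forall x v, q x v = \sum_i v 0 i * \sum_j v 0 j * S x i j].

Lemma jet_hessian f g q x v : jet f g q -> quad_form (hessian f x) v = q x v.
Proof.
move=> [G [S [fG GS _ ->]]]; rewrite quad_formE; apply: eq_bigr => i _.
congr (_ * _); apply: eq_bigr => j _; rewrite mxE; congr (_ * _).
rewrite (_ : (fun y => _) = fun y => G y j); first by have [] := GS x i j.
by apply/funext => y; have [] := fG y j.
Qed.

Lemma jet_cst (c : R) : jet (fun=> c) (fun _ _ => 0) (fun _ _ => 0).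
Proof.
exists (fun _ _ => 0), (fun _ _ _ => 0); split.
- by move=> x i; exact: is_derive_cst.
- by move=> x i j; exact: is_derive_cst.
- by move=> x v; rewrite big1// => i _; rewrite mulr0.
- by move=> x v; rewrite big1// => i _; rewrite big1 ?mulr0// => j _; rewrite mulr0.
Qed.

Lemma jet_dot p xb : jet (fun x => dot (x - xb) p) (fun _ v => dot v p) (fun _ _ => 0).
Proof.
exists (fun _ i => p 0 i), (fun _ _ _ => 0); split.
- move=> x i; apply: (@is_derive_expansion _ _ _ _ _ _ 0) => s.
  rewrite mul0r normr_le0 !dotBl dotDl dotZl; apply/eqP.
  by rewrite (dotC (delta_mx 0 i)) dot_delta; ring.
- by move=> x i j; exact: is_derive_cst.
- by [].
- by move=> x v; rewrite big1// => i _; rewrite big1 ?mulr0// => j _; rewrite mulr0.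
Qed.

Lemma jet_add f1 g1 q1 f2 g2 q2 : jet f1 g1 q1 -> jet f2 g2 q2 ->
  jet (fun x => f1 x + f2 x) (fun x v => g1 x v + g2 x v)
    (fun x v => q1 x v + q2 x v).
Proof.
move=> [G1 [S1 [fG1 GS1 gE1 qE1]]] [G2 [S2 [fG2 GS2 gE2 qE2]]].
exists (fun x i => G1 x i + G2 x i), (fun x i j => S1 x i j + S2 x i j); split.
- by move=> x i; apply: is_deriveD.
- by move=> x i j; apply: is_deriveD.
- by move=> x v; rewrite gE1 gE2 -big_split; apply: eq_bigr => i _; rewrite mulrDr.
- move=> x v; rewrite qE1 qE2 -big_split; apply: eq_bigr => i _.
  rewrite /= -mulrDr -big_split; congr (_ * _).
  by apply: eq_bigr => j _; rewrite mulrDr.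
Qed.

Lemma jet_mul f1 g1 q1 f2 g2 q2 : jet f1 g1 q1 -> jet f2 g2 q2 ->
  jet (fun x => f1 x * f2 x) (fun x v => f1 x * g2 x v + f2 x * g1 x v)
    (fun x v => f1 x * q2 x v + 2 * (g1 x v * g2 x v) + f2 x * q1 x v).
Proof.
move=> [G1 [S1 [fG1 GS1 gE1 qE1]]] [G2 [S2 [fG2 GS2 gE2 qE2]]].
exists (fun x i => f1 x * G2 x i + f2 x * G1 x i).
exists (fun x i j => (f1 x * S2 x i j + G2 x j * G1 x i) +
                     (f2 x * S1 x i j + G1 x j * G2 x i)); split.
- by move=> x i; apply: is_deriveM.
- by move=> x i j; apply: is_deriveD; apply: is_deriveM.
- move=> x v; rewrite gE1 gE2 !mulr_sumr -big_split; apply: eq_bigr => i _ /=.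
  by ring.
- move=> x v; rewrite qE1 qE2; apply/esym.
  transitivity (\sum_i (f1 x * (v 0 i * \sum_j v 0 j * S2 x i j) +
      (v 0 i * G1 x i * g2 x v + v 0 i * G2 x i * g1 x v) +
      f2 x * (v 0 i * \sum_j v 0 j * S1 x i j))).
    apply: eq_bigr => i _; rewrite gE1 gE2.
    rewrite -[_ * G1 x i * _]mulrA -[_ * G2 x i * _]mulrA ![f1 x * _]mulrCA ![f2 x * _]mulrCA.
    rewrite -!mulrDr; congr (_ * _); rewrite !mulr_sumr -!big_split/=.
    by apply: eq_bigr => j _; ring.
  rewrite !big_split/= -!mulr_sumr -!mulr_suml -gE1 -gE2.
  by ring.
Qed.

Lemma eq_jet f g1 q1 g2 q2 : (forall x v, g1 x v = g2 x v) ->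
  (forall x v, q1 x v = q2 x v) -> jet f g1 q1 -> jet f g2 q2.
Proof.
by move=> gE qE [G [S [? ? ? ?]]]; exists G, S; split => // x v; rewrite -?gE -?qE.
Qed.

Lemma jet_sum (I : Type) (s : seq I) (F : I -> V -> R) (g q : I -> V -> V -> R) :
  (forall i, jet (F i) (g i) (q i)) ->
  jet (fun x => \sum_(i <- s) F i x) (fun x v => \sum_(i <- s) g i x v)
    (fun x v => \sum_(i <- s) q i x v).
Proof.
move=> jF; elim: s => [|i s IH].
  have -> : (fun x => \sum_(i <- [::]) F i x) = fun=> 0.
    by apply/funext => x; rewrite big_nil.
  by apply: eq_jet (jet_cst 0) => x v; rewrite big_nil.
have -> : (fun x => \sum_(j <- i :: s) F j x) = fun x => F i x + \sum_(j <- s) F j x.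
  by apply/funext => x; rewrite big_cons.
by apply: eq_jet (jet_add (jF i) IH) => x v; rewrite big_cons.
Qed.

Lemma jet_scale (c : R) f g q : jet f g q ->
  jet (fun x => c * f x) (fun x v => c * g x v) (fun x v => c * q x v).
Proof.
by move=> jf; apply: eq_jet (jet_mul (jet_cst c) jf) => x v; ring.
Qed.

Lemma jet_quad H xb : jet (fun x => quad_form H (x - xb))
  (fun x v => \sum_i ((x - xb) 0 i * \sum_j v 0 j * H i j + v 0 i * \sum_j (x - xb) 0 j * H i j))
  (fun _ v => 2 * quad_form H v).
Proof.
have -> : (fun x => quad_form H (x - xb)) =
    fun x => \sum_i dot (x - xb) (delta_mx 0 i) * dot (x - xb) (row i H).
  apply/funext => x; rewrite quad_formE; apply: eq_bigr => i _.
  by rewrite dot_delta dot_row.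
apply: eq_jet (jet_sum _ (fun i => jet_mul (jet_dot (delta_mx 0 i) xb) (jet_dot (row i H) xb))) => x v.
  by apply: eq_bigr => i _; rewrite !dot_delta !dot_row [_ * v 0 i]mulrC.
rewrite quad_formE mulr_sumr; apply: eq_bigr => i _.
by rewrite !dot_delta !dot_row !mulr0 addr0 add0r.
Qed.

Lemma quad_form1 x : quad_form 1%:M x = sqnorm x.
Proof. by rewrite /quad_form mulmx1 mxE; apply: eq_bigr => i _; rewrite mxE. Qed.

Lemma jet_sqnorm xb : jet (fun x => sqnorm (x - xb))
  (fun x v => 2 * dot (x - xb) v) (fun _ v => 2 * sqnorm v).
Proof.
have -> : (fun x => sqnorm (x - xb)) = fun x => quad_form 1%:M (x - xb).
  by apply/funext => x; rewrite quad_form1.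
apply: eq_jet (jet_quad 1%:M xb) => x v; last by rewrite quad_form1.
have E (w : V) (i : 'I_n) : \sum_j w 0 j * (1%:M : 'M[R]_n) i j = w 0 i.
  rewrite (bigD1 i)//= big1 ?addr0; last first.
    by move=> j ji; rewrite mxE eq_sym (negPf ji) mulr0.
  by rewrite mxE eqxx mulr1.
by rewrite mulr_sumr; apply: eq_bigr => i _; rewrite !E; ring.
Qed.

End Jets.

(** * Smooth forms composed with a linear map: the identity, or the projection of space-time to
    space *)

Section SmoothForms.
Context {R : realType} {n : nat} {W : normedModType R}.
Local Notation V := 'rV[R]_n.
Variable L : W -> V.
Hypotheses (cL : continuous L) (lL : forall x d (s : R), L (s *: d + x) = s *: L d + L x).

Lemma smooth_dot (p xb : V) : smooth (fun z => dot (L z - xb) p).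
Proof.
apply: (@eq_smooth _ _ (fun z => dot (L z) p - dot xb p)); first by move=> z; rewrite dotBl.
apply: smooth_sub; last exact: smooth_cst.
apply: smooth_linear => [z|x d s].
  by apply: (@continuous_comp _ _ _ L (fun x => dot x p)); [exact: cL|exact: dot_continuous].
by rewrite lL dotDl dotZl.
Qed.

Lemma smooth_quad (H : 'M[R]_n) (xb : V) : smooth (fun z => quad_form H (L z - xb)).
Proof.
apply: (@eq_smooth _ _ (fun z => \sum_i dot (L z - xb) (delta_mx 0 i) * dot (L z - xb) (row i H))).
  by move=> z; rewrite quad_formE; apply: eq_bigr => i _; rewrite dot_delta dot_row.
by apply: smooth_sum => i; apply: smooth_mul; exact: smooth_dot.
Qed.

Lemma smooth_sqnorm (xb : V) : smooth (fun z => sqnorm (L z - xb)).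
Proof.
apply: (@eq_smooth _ _ (fun z => quad_form 1%:M (L z - xb))); last exact: smooth_quad.
by move=> z; rewrite quad_form1.
Qed.

End SmoothForms.

(** * The stationary problem *)

(** The supremum [S] is finite and satisfies [S <= r * S] with [r < 1]. For the discounted scheme
    [r] is [1 - eps ^ 2]. *)
Lemma contraction_le0 {R : realType} {T : Type} (f : T -> R) (r C : R) :
  0 <= r < 1 -> (forall x, f x <= C) ->
  (forall B, (forall x, f x <= B) -> forall x, f x <= r * B) ->
  forall x, f x <= 0.
Proof.
move=> /andP[r0 r1] fC H x; set S := range f.
have Sub : has_ubound S by exists C => _ [y _ <-].
have fS y : f y <= sup S by apply: ub_le_sup => //; exists y.
have : sup S <= r * sup S.
  by apply: ge_sup; [exists (f x); exists x|move=> _ [y _ <-]; exact: H].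
move=> SS; apply: le_trans (fS x) _.
rewrite leNgt; apply/negP => S0.
by move: SS; rewrite leNgt gtr_pMl ?r1.
Qed.

Lemma continuous_sub {R : realType} {T : topologicalType} (f g : T -> R) :
  continuous f -> continuous g -> continuous (fun x => f x - g x).
Proof. by move=> cf cg x; exact: (continuousB (cf x) (cg x)). Qed.

Section ContinuousReal.
Context {R : realType} {T : topologicalType}.
Implicit Types (f : T -> R) (c : R).

Lemma closed_sublevel f c : continuous f -> closed [set z | f z <= c].
Proof.
move=> cf; apply: (@preimage_closed _ _ f [set y | y <= c]); last exact: closed_le.
by move=> x _; exact: cf.
Qed.

Lemma closed_superlevel f c : continuous f -> closed [set z | c <= f z].
Proof.
move=> cf; apply: (@preimage_closed _ _ f [set y | c <= y]); last exact: closed_ge.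
by move=> x _; exact: cf.
Qed.

Lemma open_sublevel f c : continuous f -> open [set z | f z < c].
Proof.
move=> cf; apply: (@open_comp _ _ f [set y | y < c]); last exact: open_lt.
by move=> x _; exact: cf.
Qed.

Lemma open_superlevel f c : continuous f -> open [set z | c < f z].
Proof.
move=> cf; apply: (@open_comp _ _ f [set y | c < y]); last exact: open_gt.
by move=> x _; exact: cf.
Qed.

Lemma compact_lower_bound f (D : set T) : compact D -> {within D, continuous f} ->
  exists b, forall z, D z -> b <= f z.
Proof.
move=> cD cf; have [D0|/set0P/negP/negPn/eqP ->] := pselect (D !=set0); last by exists 0.
have [z0 _ z0m] := compact_EVT_min D0 cD cf.
by exists (f z0) => z Dz; apply: z0m; rewrite inE.
Qed.

End ContinuousReal.

Lemma continuous_ball {R : realType} {V : normedModType R} (f : V -> R) (x : V) (g : R) :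
  continuous f -> 0 < g -> exists2 r, 0 < r & forall y, `|y| <= r -> `|f (x + y) - f x| < g.
Proof.
move=> cf g0; have /cvgrPdist_lt/(_ g g0)/nbhs_normP[e /= e0 He] := cf x.
exists (e / 2) => [|y ye]; first by rewrite divr_gt0.
rewrite distrC; apply: (He (x + y)); rewrite /= opprD addrA subrr add0r normrN.
by apply: le_lt_trans ye _; rewrite ltr_pdivrMr// ltr_pMr// ltrDl.
Qed.

(** * The discrete stationary scheme: topicality and comparison *)

Section StationaryScheme.
Context {R : realType} {n : nat}.
Local Notation V := 'rV[R]_n.
Hypothesis n0 : (0 < n)%N.
Variables (eps : R) (phi u : V -> R).
Hypotheses (eps01 : 0 < eps < 1) (tphi : topical phi).
Hypotheses (dpp : geometric_dpp eps phi u)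
  (ubd : exists C : R, forall x, `|u x - phi x| <= C).

Let e0 : 0 < eps. Proof. by case/andP: eps01. Qed.
Let e2 : 0 < eps ^+ 2. Proof. exact: exprn_gt0. Qed.
Let e21 : 0 <= 1 - eps ^+ 2 < 1.
Proof.
rewrite subr_ge0 ltrBlDr ltrDl e2 andbT expr_le1 ?ltW//.
by case/andP: eps01.
Qed.

(** The gap [u (y + z) - u y - c] is bounded above because [u - phi] is bounded and [phi] is
    topical; the equation improves any upper bound by the factor [1 - eps ^ 2]. *)
Lemma geometric_topical : topical u.
Proof.
move=> x z c zc; have [C uC] := ubd.
pose f y := u (y + z) - u y - c.
suff /(_ x) : forall y, f y <= 0 by rewrite /f; lra.
have pz y : phi (y + z) <= phi y + c by exact: tphi.
apply: (@contraction_le0 _ _ _ (1 - eps ^+ 2) (2 * C)) => //.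
  move=> y; have := uC (y + z); have := uC y; have := pz y.
  by rewrite !ler_norml /f => ? /andP[? ?] /andP[? ?]; lra.
move=> B fB y; have [e20 _] := andP e21.
have : minmax eps u (y + z) <= minmax eps u y + (B + c).
  by apply: le_minmax => // d; have := fB (y + d); rewrite /f (addrAC y d z); lra.
move=> /(ler_wpM2l e20).
have := ler_wpM2l (ltW e2) (pz y).
by rewrite /f !dpp; lra.
Qed.

(** The bound [phi <= W] makes [u - W] bounded above, and the discount then contracts this bound to
    0. *)
Lemma geometric_le W :
  (forall x, eps ^+ 2 * phi x + (1 - eps ^+ 2) * minmax eps W x <= W x) ->
  (forall x, phi x <= W x) -> forall x, u x <= W x.
Proof.
move=> Wsup phiW x; have [C uC] := ubd.
suff /(_ x) : forall y, u y - W y <= 0 by rewrite subr_le0.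
apply: (@contraction_le0 _ _ _ (1 - eps ^+ 2) C) => //.
  by move=> y; have := uC y; have := phiW y; rewrite ler_norml => ? /andP[? ?]; lra.
move=> B fB y; have [e20 _] := andP e21.
have : minmax eps u y <= minmax eps W y + B.
  by apply: le_minmax => // d; have := fB (y + d); lra.
move=> /(ler_wpM2l e20); have := Wsup y; rewrite dpp; lra.
Qed.

End StationaryScheme.

Section CoerciveMax.
Context {R : realType} {n : nat}.
Local Notation V := 'rV[R]_n.

Lemma lip_norm_sub (x : V) : lip 1 (fun z : V => `|z - x|).
Proof.
move=> y z; rewrite mul1r; apply: le_trans (ler_dist_dist _ _) _.
by rewrite opprB addrA subrK.
Qed.

Lemma norm_ball_compact (x : V) (r : R) : compact [set z : V | `|z - x| <= r].
Proof.
apply: bounded_closed_compact; last first.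
  have cn := lip_continuous (lip_norm_sub x).
  exact: (@closed_sublevel R V (fun z => `|z - x|) r cn).
exists (r + `|x|); split; first exact: num_real.
move=> M rM z /= zr; apply: le_trans (ltW rM).
by rewrite -[z in leLHS](subrK x) (le_trans (ler_normD _ _))// lerD2r.
Qed.

Lemma quadratic_dominates (A B i c : R) : 0 < i -> exists2 r, 0 <= r &
  forall t, r < t -> A + B * t - i * t ^+ 2 < c.
Proof.
move=> i0; pose r := (`|A| + `|B| + `|c| + 1) / i + 1.
have r0 : 0 <= (`|A| + `|B| + `|c| + 1) / i by rewrite divr_ge0 ?(ltW i0)// !addr_ge0.
exists r; first by rewrite /r; lra.
move=> t rt; have t1 : 1 < t by rewrite /r in rt; lra.
have : `|A| + `|B| + `|c| + 1 < t * i.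
  by rewrite -ltr_pdivrMr//; apply: lt_trans rt; rewrite /r; lra.
have t0 : 0 < t by lra.
rewrite -(ltr_pM2l t0).
have := ler_norm A; have := ler_norm (- c); rewrite normrN => cc AA.
have BB : t * B <= t * `|B| by rewrite ler_pM2l// ler_norm.
have A1 : `|A| <= t * `|A| by rewrite ler_peMl// ltW.
have A2 : `|c| <= t * `|c| by rewrite ler_peMl// ltW.
lra.
Qed.

Lemma coercive_max (f : V -> R) (A B i : R) : 0 < i -> continuous f ->
  (forall x, f x <= A + B * `|x| - i * `|x| ^+ 2) ->
  exists x0, forall x, f x <= f x0.
Proof.
move=> i0 cf fAB; have [r r0 rf] := quadratic_dominates A B (f 0) i0.
have [|||x0 x0r fx0] := @EVT_max_rV _ _ f [set x : V | `|x - 0| <= r].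
- by exists 0; rewrite /= subr0 normr0.
- exact: norm_ball_compact.
- exact: continuous_subspaceT.
exists x0 => x; have [xr|rx] := leP `|x| r; first by apply: fx0; rewrite inE/= subr0.
apply: (le_trans (fAB x)); apply: (le_trans (ltW (rf _ rx))).
by apply: fx0; rewrite inE/= subr0 normr0.
Qed.

End CoerciveMax.

Section ViscositySubsolution.
Context {R : realType} {n : nat}.
Local Notation V := 'rV[R]_n.
Variables (phi u : V -> R).
Hypotheses (visc : stationary_viscosity_solution phi u) (lg : linear_growth u).

Let id_lin (x d : V) (s : R) : id (s *: d + x) = s *: id d + id x. Proof. by []. Qed.
Let id_cont : continuous (@id V). Proof. by move=> x; exact: cvg_id. Qed.

(** At a maximum of [u - U] penalised by [i * sqnorm], the function [U] is replaced by its
    second-order polynomial, so a mere expansion of [U] at each point serves as a smooth test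
    function. Then [i] tends to 0. *)
Lemma viscosity_subsolution_le (U : V -> R) (K eta : R) : 0 < K -> lip 1 U ->
  (forall x, exists p H, expansion2 K U x p H /\
    forall v, 2^-1 * quad_form H (vertex v) <= U x - phi x + eta) ->
  (forall x, 0 <= U x - phi x + eta) ->
  forall x, u x <= U x + eta.
Proof.
move=> K0 U1 UH Uphi; have [cu _] := visc.
have [C1 [C2 uC]] := lg.
have key (i : R) : 0 < i -> forall x, u x <= U x + eta + i * (2 * n%:R + sqnorm x).
  move=> i0; pose f x := u x - U x - i * sqnorm x.
  have cf : continuous f.
    have c2 : continuous (fun x : V => i * sqnorm x).
      apply: (@eq_Ck _ _ 0 (fun x : V => i * sqnorm (x - 0))).
        by move=> x; rewrite subr0.
      exact: (smooth_mul (smooth_cst i) (smooth_sqnorm id_cont id_lin 0) 0%N).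
    apply: continuous_sub c2.
    exact: continuous_sub cu (lip_continuous U1).
  have [x|x0 fx0] := @coercive_max _ _ f (C2 - U 0) (C1 + 1) i i0 cf.
    have := uC x; have := U1 x 0; rewrite subr0 mul1r !ler_norml => /andP[? ?] /andP[? ?].
    have := norm_le_sqnorm x; rewrite -(ler_pM2l i0) /f; lra.
  have [p [H [UE Hq]]] := UH x0.
  (* The square centred at [x0] dominates the cubic remainder of [U] near [x0]; the square centred
     at 0 is the penalty. *)
  pose psi x := dot (x - x0) p + 2^-1 * quad_form H (x - x0)
    + i * sqnorm (x - x0) + i * sqnorm (x - 0).
  have spsi : smooth psi.
    apply: smooth_add; last first.
      apply: smooth_mul; [exact: smooth_cst|exact: (smooth_sqnorm id_cont id_lin)].
    apply: smooth_add; last first.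
      apply: smooth_mul; [exact: smooth_cst|exact: (smooth_sqnorm id_cont id_lin)].
    apply: smooth_add; first exact: (smooth_dot id_cont id_lin).
    apply: smooth_mul; [exact: smooth_cst|exact: (smooth_quad id_cont id_lin)].
  have jpsi := jet_add (jet_add (jet_add (jet_dot p x0)
     (jet_scale 2^-1 (jet_quad H x0))) (jet_scale i (jet_sqnorm x0)))
     (jet_scale i (jet_sqnorm 0)).
  have psi0 : psi x0 = i * sqnorm x0.
    by rewrite /psi subrr dot0l quad_form0 sqnorm0 !mulr0 !add0r subr0.
  have touch : \forall x \near x0, u x - psi x <= u x0 - psi x0.
    have iK : 0 < i / K by rewrite divr_gt0.
    near=> x; rewrite psi0; have := fx0 x; rewrite /f /psi subr0.
    have := UE (x - x0); rewrite (addrC x0) subrK.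
    have -> : \sum_j (x - x0) 0 j * p 0 j = dot (x - x0) p by [].
    have : K * `|x - x0| ^+ 3 <= i * sqnorm (x - x0).
      apply: le_trans (ler_wpM2l (ltW i0) (norm_le_sqnorm _)).
      rewrite exprS mulrA ler_wpM2r ?exprn_ge0//.
      rewrite mulrC -(ler_pdivlMr _ _ K0) distrC.
      by near: x; exact: (@cvgr_dist_le _ _ _ (nbhs x0) _ id x0 (@cvg_id _ (nbhs x0)) _ iK).
    by move=> ?; rewrite ler_norml => /andP[? ?]; lra.
  have [_ /(_ x0 psi spsi)[_ /(_ touch) ineq]] := visc.
  (* Each of the two squares adds [2 * i * sqnorm v <= 2 * i * n] to the Hessian form at a vertex,
     hence [2 * n * i] in total after halving. *)
  have mq : 2^-1 * max_quad (hessian psi x0) <= U x0 - phi x0 + eta + 2 * n%:R * i.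
    rewrite mulrC ler_pdivrMr//; apply: max_quad_le => [|v].
      have : 0 <= n%:R * i by rewrite mulr_ge0// ltW.
      by have := Uphi x0; lra.
    rewrite (jet_hessian x0 _ jpsi).
    have : sqnorm (vertex v : V) <= n%:R.
      apply: le_trans (sqnorm_le_norm _) _; rewrite ler_piMr//.
      by rewrite expr_le1// vertex_norm.
    move=> /(ler_wpM2l (ltW i0)); have := Hq v; lra.
  move=> x; have := fx0 x; rewrite /f.
  have := sqnorm_ge0 x0; move=> /(mulr_ge0 (ltW i0)); lra.
move=> x; rewrite -subr_ge0; apply: (@ge0_linear_bound _ _ (2 * n%:R + sqnorm x)).
by move=> t /andP[t0 _]; have := key t t0 x; lra.
Unshelve. all: by end_near. Qed.

End ViscositySubsolution.

Section StationaryLower.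
Context {R : realType} {n : nat}.
Local Notation V := 'rV[R]_n.
Hypothesis n0 : (0 < n)%N.
Variables (phi u : V -> R).
Hypotheses (tphi : topical phi)
  (visc : stationary_viscosity_solution phi u) (lg : linear_growth u).

(** For each vertex the dynamic programming equation yields an inequality linear in [ue]. It is
    mollified, expanded and divided by [eps ^ 2], which makes [M ue] a supersolution up to
    [O(eps)]. *)
Lemma stationary_lower (d : R) : 0 < d -> exists2 C : R, 0 <= C &
  forall eps ue, 0 < eps < 1 -> geometric_dpp eps phi ue ->
    (exists C : R, forall x, `|ue x - phi x| <= C) ->
    forall x, u x <= ue x + d + C * eps.
Proof.
move=> d0; have [M [K [K0 hM Md M2]]] := mollifier (n := n) d0.
have C0 : 0 <= 1 + 2 * K by lra.
exists (1 + 2 * K) => // eps ue eps01 dpp ubd x.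
have [e0 e1] := andP eps01.
have e2 : 0 < eps ^+ 2 by exact: exprn_gt0.
have e21 : 0 <= 1 - eps ^+ 2 by rewrite subr_ge0 expr_le1 ?ltW.
have tu := geometric_topical n0 eps01 tphi dpp ubd.
have lu := topical_lipschitz tu.
have tU : topical (M ue) := topical_averaging hM tu.
suff : M ue x <= ue x + d /\ u x <= M ue x + (1 + 2 * K) * eps by move=> [? ?]; lra.
split; first by case/andP: (Md _ tu x).
apply: (viscosity_subsolution_le visc lg K0 (topical_lip tU)); last first.
  move=> y; have /andP[? _] := Md _ tu y.
  (* The market may play the zero vertex, so the game value is at least [ue y]; the equation then
     leaves [phi y <= ue y]. *)
  have pu : phi y <= ue y.
    have := binary_le_minmax n0 eps y [ffun=> false] tu; rewrite vertex0 binary0.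
    move=> /(ler_wpM2l e21); have := dpp y => E F.
    by rewrite -(ler_pM2l e2); lra.
  have : 0 <= (1 + 2 * K) * eps by rewrite mulr_ge0// ltW.
  lra.
move=> y; have [p [H UE]] := M2 _ tu y; exists p, H; split=> // v.
set Q := quad_form H (vertex v); pose b := binary eps (vertex v) ue.
(* A step of size 1 and the Lipschitz bound control [Q] a priori. This pays for removing the factor
   [1 - eps ^ 2], at the price [(1 + K) * eps]; the Taylor remainder adds [K * eps]. *)
have Q1 : 2^-1 * Q <= 1 + K.
  have := expansion2_binary (vertex_norm v) (ltW K0) ler01 UE.
  have U1 : binary 1 (vertex v) (M ue) y <= M ue y + 1.
    have h1 : M ue (y + 1 *: vertex v) <= M ue y + 1.
      by apply: tU => i; rewrite scale1r; apply: le_trans (ler_norm _) (le_trans (coord_le_norm _ _) (vertex_norm v)).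
    have h2 : M ue (y - 1 *: vertex v) <= M ue y + 1.
      apply: tU => i; rewrite scale1r; apply: le_trans (ler_norm _) _.
      by apply: le_trans (coord_le_norm _ _) _; rewrite normrN vertex_norm.
    by rewrite /binary; lra.
  by rewrite ler_norml !expr1n -/Q => /andP[? ?]; lra.
have tb : topical b by exact: topical_binary.
have tc : topical (fun x => eps ^+ 2 * phi x + (1 - eps ^+ 2) * b x).
  by apply: topical_convex; rewrite ?(ltW e2)//; ring.
have : M (fun x => eps ^+ 2 * phi x + (1 - eps ^+ 2) * b x) y <= M ue y.
  apply: (averaging_le hM) => [||z]; [exact: topical_lipschitz|done|].
  by rewrite [leRHS]dpp lerD2l ler_wpM2l//; exact: binary_le_minmax.
rewrite (averaging_lin hM); try exact: topical_lipschitz.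
rewrite (averaging_binary _ _ _ hM lu).
have /andP[Mphi _] := Md _ tphi y; have := ler_wpM2l (ltW e2) Mphi.
have := expansion2_binary (vertex_norm v) (ltW K0) (ltW e0) UE.
rewrite ler_norml -/Q => /andP[E _] ? main.
have {}E : M ue y + eps ^+ 2 * (2^-1 * Q - K * eps) <= binary eps (vertex v) (M ue) y.
  by move: E; rewrite exprS expr2; lra.
have := ler_wpM2l e21 E => {}E.
have : eps ^+ 2 * ((1 - eps ^+ 2) * (2^-1 * Q - K * eps)) <= eps ^+ 2 * (M ue y - phi y).
  by lra.
rewrite ler_pM2l// => F.
have : eps ^+ 2 * (2^-1 * Q - K * eps) <= eps ^+ 2 * (1 + K).
  rewrite ler_pM2l//; have : 0 <= K * eps by rewrite mulr_ge0// ltW.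
  by lra.
have : eps ^+ 2 * (1 + K) <= eps * (1 + K).
  by rewrite ler_wpM2r ?expr2 ?ler_piMl// ?ltW//; lra.
by lra.
Qed.

End StationaryLower.

Section Envelope.
Context {R : realType} {n : nat}.
Local Notation V := 'rV[R]_n.
Implicit Types (u phi g : V -> R).

(* The largest topical function below u. *)
Definition envelope u (x : V) : R :=
  inf [set r | exists (z : V) (c : R), (forall i, z 0 i <= c) /\ r = u (x - z) + c].

Section Bounds.
Variables (u phi : V -> R).
Hypotheses (tphi : topical phi) (phiu : forall x, phi x <= u x).

Let S (x : V) := [set r | exists (z : V) (c : R), (forall i, z 0 i <= c) /\ r = u (x - z) + c].

Let lbS g x : topical g -> (forall y, g y <= u y) -> lbound (S x) (g x).
Proof.
move=> tg gu _ [z [c [zc ->]]].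
have := tg (x - z) z c zc; rewrite subrK => /le_trans; apply.
by rewrite lerD2r.
Qed.

Let S0 x : S x !=set0.
Proof.
by exists (u (x - 0) + 0), 0, 0; split=> // i; rewrite mxE.
Qed.

Lemma envelope_le_shift x (z : V) c : (forall i, z 0 i <= c) ->
  envelope u x <= u (x - z) + c.
Proof.
move=> zc; apply: ge_inf; last by exists z, c.
by exists (phi x); exact: lbS.
Qed.

Lemma envelope_le x : envelope u x <= u x.
Proof.
have := @envelope_le_shift x 0 0; rewrite subr0 addr0; apply.
by move=> i; rewrite mxE.
Qed.

Lemma le_envelope g x : topical g -> (forall y, g y <= u y) -> g x <= envelope u x.
Proof. by move=> tg gu; apply: lb_le_inf; [exact: S0|exact: lbS]. Qed.

Lemma envelope_ge x b : (forall (z : V) c, (forall i, z 0 i <= c) -> b <= u (x - z) + c) ->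
  b <= envelope u x.
Proof. by move=> H; apply: lb_le_inf; [exact: S0|move=> _ [z [c [zc ->]]]; exact: H]. Qed.

Lemma envelope_topical : topical (envelope u).
Proof.
move=> x z c zc; rewrite -lerBlDr; apply: envelope_ge => z' c' zc'.
rewrite lerBlDr -addrA.
have -> : x - z' = x + z - (z + z') by rewrite opprD addrA addrK.
by apply: envelope_le_shift => i; rewrite mxE addrC lerD.
Qed.

(** The balance [a = b + e] lets the inequality at [x - z], raised by [c], bound the one at [x] for
    every competitor [(z, c)] of the infimum on the right. On the left the nonnegative weights only
    require upper bounds of the envelope. *)
Lemma envelope_binary (a b e k h : R) w : 0 < a -> 0 <= b -> 0 <= e -> a = b + e ->
  (forall x, b * binary h w u x + e * phi x + k <= a * u x) ->
  forall x, b * binary h w (envelope u) x + e * phi x + k <= a * envelope u x.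
Proof.
move=> a0 b0 e0 abe H x; rewrite -ler_pdivrMl//.
apply: envelope_ge => z c zc; rewrite ler_pdivrMl// mulrDr.
have h1 := @envelope_le_shift (x + h *: w) z c zc.
have h2 := @envelope_le_shift (x - h *: w) z c zc.
have Ep := tphi (x - z) zc; rewrite subrK in Ep.
apply: le_trans (_ : b * (binary h w u (x - z) + c) + e * (phi (x - z) + c) + k <= _).
  rewrite lerD2r lerD// ler_wpM2l//; move: h1 h2; rewrite /binary ![x - z + _]addrAC; lra.
by have := H (x - z); rewrite abe; lra.
Qed.

End Bounds.
End Envelope.

Lemma interior_min {R : realType} {T : topologicalType} (f : T -> R)
    (D O : set T) (x : T) : compact D -> open O -> O `<=` D -> O x ->
  {within D, continuous f} -> (forall z, D z -> ~ O z -> f x < f z) ->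
  exists z0, [/\ O z0, f z0 <= f x & \forall z \near z0, f z0 <= f z].
Proof.
move=> cD oO OD Ox cf bd.
have [|z0 z0D z0min] := @compact_EVT_min _ _ f D _ cD cf; first by exists x; exact: OD.
have z0x : f z0 <= f x by apply: z0min; rewrite inE; exact: OD.
have Oz0 : O z0.
  apply: contrapT => nO; move: z0D; rewrite inE => z0D.
  by have := bd z0 z0D nO; rewrite ltNge z0x.
exists z0; split => //; apply: filterS (open_nbhs_nbhs (conj oO Oz0)) => z Oz.
by apply: z0min; rewrite inE; exact: OD.
Qed.

Section StationaryUpper.
Context {R : realType} {n : nat}.
Local Notation V := 'rV[R]_n.
Variables (phi u : V -> R).
Hypotheses (tphi : topical phi) (visc : stationary_viscosity_solution phi u).

Let id_lin (x d : V) (s : R) : id (s *: d + x) = s *: id d + id x. Proof. by []. Qed.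
Let id_cont : continuous (@id V). Proof. by move=> x; exact: cvg_id. Qed.
Let sdot p xb : smooth (fun z : V => dot (z - xb) p) := smooth_dot id_cont id_lin p xb.
Let ssq xb : smooth (fun z : V => sqnorm (z - xb)) := smooth_sqnorm id_cont id_lin xb.

Let cu : continuous u. Proof. by have [] := visc. Qed.

(** The zero vertex makes the maximum of the Hessian form nonnegative for any test function. It is
    thus enough to touch [u] from below near [x], by a steep concave paraboloid, and the Lipschitz
    bound brings [phi] back to [x]. *)
Lemma supersolution_ge x : phi x <= u x.
Proof.
rewrite -subr_ge0; apply: (@ge0_linear_bound _ _ 1) => r /andP[r0 _].
pose D := [set z : V | `|z - x| <= r]; pose O := [set z : V | `|z - x| < r].
have cD : compact D := @norm_ball_compact R n x r.
have oO : open O := open_sublevel r (lip_continuous (lip_norm_sub x)).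
have [b bu] := compact_lower_bound cD (continuous_subspaceT cu).
(* Steep enough that [u - psi] exceeds [u x] on the sphere of radius [r]. *)
pose k := (`|u x - b| + 1) / r ^+ 2.
have k0 : 0 < k by rewrite divr_gt0 ?exprn_gt0// ltr_wpDl.
pose psi z := - k * sqnorm (z - x).
have spsi : smooth psi by apply: smooth_mul; [exact: smooth_cst|exact: ssq].
have [||||z0 [Oz0 fz0 touch]] := @interior_min _ _ (fun z => u z - psi z) D O x cD oO.
- by move=> z; exact: ltW.
- by rewrite /O/= subrr normr0.
- exact: continuous_subspaceT (continuous_sub cu (spsi 0%N)).
- move=> z Dz /negP; rewrite -leNgt => rz.
  have := bu z Dz; rewrite /psi subrr sqnorm0.
  have : k * r ^+ 2 <= k * sqnorm (z - x).
    rewrite ler_pM2l// (le_trans _ (norm_le_sqnorm _))//.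
    by rewrite lerXn2r ?nnegrE// ltW.
  rewrite /k divfK ?gt_eqF ?exprn_gt0//.
  by have := ler_norm (u x - b); rewrite -/k; lra.
have [_ /(_ z0 psi spsi)[/(_ touch) ineq _]] := visc.
have := max_quad_ge0 (hessian psi z0).
have := topical_lip tphi z0 x; rewrite mul1r ler_norml => /andP[lo _].
have : 0 <= k * sqnorm (z0 - x) by rewrite mulr_ge0 ?sqnorm_ge0// ltW.
by move: fz0 Oz0 ineq lo; rewrite /O/= /psi subrr sqnorm0; lra.
Qed.

(** On the line [x + R v], the function [f = u - phi x + 2 * h] satisfies [f'' <= 2 * f] in the
    viscosity sense, because [phi >= phi x - 2 * h] within distance [2 * h]. It is compared with a
    combination of [E(h + s)] and [E(h - s)], where [E(y) = y + c * y ^ 3]; the factors in the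
    statement are [E(h) / h] and [E(2 * h) / (2 * h)]. The relation between [c] and [h] ensures
    [3 * c >= 1 + c * y ^ 2] on [[0, 2 * h]]. *)
Lemma supersolution_line x (v : @cube n) (h c : R) :
  0 < h <= 2^-1 -> 0 < sqnorm (vertex v : V) -> 3 * c = 1 + 4 * h ^+ 2 ->
  (1 + c * h ^+ 2) * (binary h (vertex v) u x - phi x + 2 * h) <=
  (1 + 4 * c * h ^+ 2) * (u x - phi x + 2 * h).
Proof.
have near_lt (a b d : R) : `|a - b| < d -> b - d < a.
  by rewrite ltr_norml => /andP[? _]; lra.
have range (a d : R) : - d < a -> a < d ->
    [/\ 0 <= a + d, a + d <= 2 * d, 0 <= d + -1 * a & d + -1 * a <= 2 * d].
  by move=> ? ?; split; lra.
have cube_le (d y : R) : 0 < c -> c <= 1 -> 3 * c = 1 + 4 * d ^+ 2 ->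
    0 <= y -> y <= 2 * d -> y + c * (y * (y * y)) <= 3 * c * y.
  move=> c0 c1 cd y0 yd.
  have : y * y <= (2 * d) * (2 * d) by apply: ler_pM.
  move=> /(ler_wpM2l (ltW c0)) yy.
  have : c * (2 * d * (2 * d)) <= 4 * d ^+ 2.
    rewrite (_ : c * _ = 4 * d ^+ 2 * c); last by ring.
    by rewrite ler_piMr// mulr_ge0 ?sqr_ge0.
  move=> cc; have : y * (1 + c * (y * y)) <= y * (3 * c) by rewrite ler_wpM2l//; lra.
  lra.
move=> /andP[h0 h12] m0 cR; rewrite leNgt; apply/negP => contra.
set w : V := vertex v in m0 contra; set m := sqnorm w in m0.
pose p := m^-1 *: w; have wp : dot w p = 1 by rewrite /p dotC dotZl mulVf ?gt_eqF.
(* [s] is the coordinate along [w] and [N] the squared distance to the line. As [N] is constant in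
   direction [w], a steep penalty in [N] does not affect the second derivative in that direction. *)
pose s z := dot (z - x) p; pose N z := sqnorm (z - x) - m * (s z * s z).
have dotw z : dot (z - x) w = m * s z.
  by rewrite /s /p [in RHS]dotC dotZl mulrA mulfV ?gt_eqF// mul1r dotC.
have NE z : sqnorm (z - x - s z *: w) = N z.
  by rewrite sqnormB sqnormZ dotC dotZl dotC dotw /N -/m; ring.
have N0 z : 0 <= N z by rewrite -NE sqnorm_ge0.
have h2 : h ^+ 2 <= 4^-1 by rewrite expr2; nra.
have hh : 0 < h ^+ 2 by exact: exprn_gt0.
have c0 : 0 < c by lra.
have c1 : c <= 1 by lra.
pose c2 := phi x - 2 * h.
pose al := u (x + h *: w) - c2; pose be := u (x - h *: w) - c2.
pose gap := (1 + c * h ^+ 2) * ((al + be) / 2) - (1 + 4 * c * h ^+ 2) * (u x - c2).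
have gap0 : 0 < gap by move: contra; rewrite /gap /al /be /binary /c2; lra.
(* A margin for the end values: [g <= h] keeps [A] and [B] nonnegative, and [g <= gap / 4] keeps
   [q x] above [u x]. *)
pose g := Num.min h (gap / 4).
have g0 : 0 < g by rewrite lt_min h0/= divr_gt0.
have gh : g <= h by rewrite ge_min lexx.
have ggap : g <= gap / 4 by rewrite ge_min lexx orbT.
have phil y : `|y| <= 2 * h -> c2 <= phi (x + y).
  move=> yh; have := topical_lip tphi (x + y) x; rewrite (addrC x y) addrK (addrC y x) mul1r ler_norml => /andP[? _].
  by rewrite /c2; lra.
have phi1 y : `|y| <= h -> c2 + h <= phi (x + y).
  move=> yh; have := topical_lip tphi (x + y) x; rewrite (addrC x y) addrK (addrC y x) mul1r ler_norml => /andP[? _].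
  by rewrite /c2; lra.
have hw : `|h *: w| <= h by rewrite normrZ gtr0_norm// ler_piMr ?vertex_norm// ltW.
have al0 : h <= al by have := phi1 _ hw; have := supersolution_ge (x + h *: w); rewrite /al; lra.
have be0 : h <= be.
  have : `|- (h *: w)| <= h by rewrite normrN.
  by move=> /phi1; have := supersolution_ge (x - h *: w); rewrite /be; lra.
pose D0 := 2 * h * (1 + 4 * c * h ^+ 2).
have ch0 : 0 < c * h ^+ 2 by exact: mulr_gt0.
have ch1 : c * h ^+ 2 <= h ^+ 2 by rewrite ler_piMl// ltW.
have D00 : 0 < D0 by rewrite /D0 !mulr_gt0//; lra.
pose A := (al - g) / D0; pose B := (be - g) / D0.
have A0 : 0 <= A by rewrite divr_ge0 ?(ltW D00)//; lra.
have B0 : 0 <= B by rewrite divr_ge0 ?(ltW D00)//; lra.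
(* E'' >= 2 E on [0, 2 h]: a cubic substitute for sinh, the solution of E'' = 2 E. *)
pose E (y : R) := y + c * (y * (y * y)).
pose q z := c2 + A * E (s z + h) + B * E (h + -1 * s z).
have AD : A * D0 = al - g by rewrite /A divfK ?gt_eqF.
have BD : B * D0 = be - g by rewrite /B divfK ?gt_eqF.
have qx : u x < q x.
  have sx : s x = 0 by rewrite /s subrr dot0l.
  rewrite /q /E sx.
  have : (1 + 4 * c * h ^+ 2) * (u x - c2) < (1 + c * h ^+ 2) * ((al - g + (be - g)) / 2).
    have : (1 + c * h ^+ 2) * g <= 2 * (gap / 4).
      by apply: ler_pM => //; lra.
    by move: gap0; rewrite /gap; lra.
  rewrite -AD -BD.
  have -> : (1 + c * h ^+ 2) * ((A * D0 + B * D0) / 2) =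
    (1 + 4 * c * h ^+ 2) * ((A + B) * (h * (1 + c * h ^+ 2))).
    by rewrite /D0; field.
  rewrite ltr_pM2l; last by lra.
  by lra.
(* Radius of a tube around the segment on whose two end caps [u] stays above its end values lowered
   by [g], which are the values of [q] there. *)
have [r [r0 rh ru]] : exists r : R, [/\ 0 < r, r <= h & forall y : V, `|y| <= r ->
    u (x + h *: w) - g < u (x + h *: w + y) /\ u (x - h *: w) - g < u (x - h *: w + y)].
  have [r1 r10 H1] := continuous_ball (x + h *: w) cu g0.
  have [r2 r20 H2] := continuous_ball (x - h *: w) cu g0.
  exists (Num.min h (Num.min r1 r2)); split; first by rewrite !lt_min h0 r10.
    by rewrite ge_min lexx.
  move=> y; rewrite !le_min => /and3P[_ /H1 + /H2].
  by move=> /near_lt ? /near_lt ?; split.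
pose D := [set z : V | [/\ - h <= s z, s z <= h & N z <= r ^+ 2]].
pose O := [set z : V | [/\ - h < s z, s z < h & N z < r ^+ 2]].
have cs : continuous s := sdot p x 0%N.
have cN : continuous N.
  have ss : smooth (fun z => m * (s z * s z)).
    by apply: smooth_mul; [exact: smooth_cst|apply: smooth_mul; exact: sdot].
  exact: (smooth_sub (ssq x) ss 0%N).
have oO : open O.
  have -> : O = [set z | - h < s z] `&` ([set z | s z < h] `&` [set z | N z < r ^+ 2]).
    by apply/seteqP; split=> [z [? ? ?]|z [? [? ?]]].
  apply: openI; first exact: open_superlevel.
  by apply: openI; exact: open_sublevel.
have clD : closed D.
  have -> : D = [set z | - h <= s z] `&` ([set z | s z <= h] `&` [set z | N z <= r ^+ 2]).
    by apply/seteqP; split=> [z [? ? ?]|z [? [? ?]]].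
  apply: closedI; first exact: closed_superlevel.
  by apply: closedI; exact: closed_sublevel.
have OD : O `<=` D by move=> z [? ? ?]; split; exact: ltW.
have Nx : N x = 0 by rewrite /N /s subrr sqnorm0 dot0l !mulr0 subr0.
have Ox : O x.
  by split; rewrite ?Nx ?exprn_gt0// /s subrr dot0l ?oppr_lt0.
have Dy z : D z -> `|z - x - s z *: w| <= r.
  by move=> [_ _ Nr]; rewrite -(@ler_pXn2r _ 2) ?nnegrE ?(ltW r0)//
    (le_trans (norm_le_sqnorm _))// NE.
have D2h z : D z -> `|z - x| <= 2 * h.
  move=> Dz; rewrite -(subrK (s z *: w) (z - x)).
  apply: le_trans (ler_normD _ _) _; have := Dy z Dz.
  have : `|s z *: w| <= h.
    rewrite normrZ; apply: le_trans (_ : `|s z| <= _); first by rewrite ler_piMr ?vertex_norm.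
    by case: Dz => ? ? _; rewrite ler_norml; apply/andP; split.
  lra.
have Dphi z : D z -> c2 <= phi z.
  by move=> /D2h zh; have -> : z = x + (z - x); [rewrite addrC subrK|exact: phil].
have cD : compact D.
  apply: (subclosed_compact clD (@norm_ball_compact R n x (2 * h))).
  by move=> z /D2h.
have sE f : smooth f -> smooth (fun z : V => E (f z)).
  move=> sf; apply: smooth_add => //; apply: smooth_mul; first exact: smooth_cst.
  by apply: smooth_mul => //; exact: smooth_mul.
have ss : smooth s := sdot p x.
have sq : smooth q.
  have sc := @smooth_cst R V.
  apply: smooth_add.
    apply: smooth_add => //; apply: smooth_mul => //; apply: (sE (fun z => s z + h)).
    exact: smooth_add.
  apply: smooth_mul => //; apply: (sE (fun z => h + -1 * s z)).
  by apply: smooth_add => //; exact: smooth_mul.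
have sN : smooth N.
  apply: smooth_sub; first exact: ssq.
  by apply: smooth_mul; [exact: smooth_cst|exact: smooth_mul].
have [b bq] := compact_lower_bound cD (continuous_subspaceT (continuous_sub cu (sq 0%N))).
(* On the lateral side [N = r ^ 2] the penalty is [|b| + 1], which makes [u - psi] positive there,
   whereas it is negative at [x]. *)
pose ka := (`|b| + 1) / r ^+ 2.
have ka0 : 0 < ka by rewrite divr_gt0 ?exprn_gt0// ltr_wpDl.
pose psi z := q z + - ka * (sqnorm (z - x) + - m * (s z * s z)).
have psiE z : psi z = q z - ka * N z by rewrite /psi /N !mulNr.
have spsi : smooth psi.
  apply: (@eq_smooth _ _ (fun z => q z - ka * N z)) => //.
  by apply: smooth_sub => //; apply: smooth_mul => //; exact: smooth_cst.
have jet_psi z : quad_form (hessian psi z) w = 6 * c * (A * (s z + h) + B * (h + -1 * s z)).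
  have js := jet_dot p x.
  have j1 := jet_add js (jet_cst h); have j2 := jet_add (jet_cst h) (jet_scale (-1) js).
  have jE f (g : V -> V -> R) (k : V -> V -> R) (jf : jet f g k) := jet_scale c (jet_mul jf (jet_mul jf jf)).
  have j := jet_add (jet_add (jet_add (jet_cst c2) (jet_scale A (jet_add j1 (jE _ _ _ j1))))
    (jet_scale B (jet_add j2 (jE _ _ _ j2))))
    (jet_scale (- ka) (jet_add (jet_sqnorm x) (jet_scale (- m) (jet_mul js js)))).
  rewrite (jet_hessian z w j) wp -/m /s; ring.
have [z1 Dz1 nOz1|z0 [Oz0 fz0 touch]] := @interior_min _ _ (fun z => u z - psi z) D O x cD oO OD Ox
  (continuous_subspaceT (continuous_sub cu (spsi 0%N))).
  have Nz1 := N0 z1; have kN : 0 <= ka * N z1 by rewrite mulr_ge0// ltW.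
  apply: (@lt_le_trans _ _ 0); rewrite !psiE ?Nx ?mulr0; first by lra.
  have Dyz1 := Dy _ Dz1.
  have [s1 s2 Nr] := Dz1; have zE : z1 = x + s z1 *: w + (z1 - x - s z1 *: w).
    by rewrite -addrA [_ *: w + _]addrC subrK addrC subrK.
  have [sE1|sN1] := eqVneq (s z1) (- h).
    have [_] := ru _ Dyz1; move: zE; rewrite sE1 scaleNr => <-.
    have -> : q z1 = c2 + B * D0 by rewrite /q /E sE1 /D0; ring.
    by rewrite BD /be; lra.
  have [sE2|sN2] := eqVneq (s z1) h.
    have [+ _] := ru _ Dyz1; move: zE; rewrite sE2 => <-.
    have -> : q z1 = c2 + A * D0 by rewrite /q /E sE2 /D0; ring.
    by rewrite AD /al; lra.
  have : r ^+ 2 <= N z1.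
    rewrite leNgt; apply/negP => Nlt; apply: nOz1; split=> //.
      by rewrite lt_neqAle eq_sym sN1.
    by rewrite lt_neqAle sN2.
  move=> /(ler_wpM2l (ltW ka0)).
  rewrite {1}/ka divfK ?gt_eqF ?exprn_gt0// => kaN.
  have := bq _ Dz1; have := ler_norm (- b); rewrite normrN; lra.
(* At the touching point [u z0 < q z0], whereas the viscosity inequality in direction [v] together
   with [E'' >= 2 * E] gives [u z0 >= q z0]. *)
have [_ /(_ z0 psi spsi)[/(_ touch) ineq _]] := visc.
have := le_max_quad (hessian psi z0) v; rewrite jet_psi.
have := Dphi z0 (OD _ Oz0); have [s1 s2 _] := Oz0.
have : psi z0 <= q z0 by rewrite psiE lerBlDr lerDl mulr_ge0// ltW.
have psix : psi x = q x by rewrite psiE Nx mulr0 subr0.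
move: fz0; rewrite psix.
have [l1 u1 l2 u2] := range _ _ s1 s2.
have y1 : A * E (s z0 + h) <= A * (3 * c * (s z0 + h)).
  by rewrite ler_wpM2l// (cube_le h).
have y2 : B * E (h + -1 * s z0) <= B * (3 * c * (h + -1 * s z0)).
  by rewrite ler_wpM2l// (cube_le h).
by rewrite {2}/q; lra.
Qed.

Hypothesis n0 : (0 < n)%N.

(** The line inequality is linear with balanced coefficients, so it passes to the envelope and then
    to its mollification. There it is expanded and divided by [h ^ 2]; as [h] tends to 0, [3 * c]
    tends to 1. *)
Lemma supersolution_mollified M K x p H (v : @cube n) : 0 < K -> averaging M ->
  (forall f, topical f -> forall x, f x <= M f x) ->
  expansion2 K (M (envelope u)) x p H ->
  2^-1 * quad_form H (vertex v) <= M (envelope u) x - phi x.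
Proof.
move=> K0 hM Mge UE; set w : V := vertex v; set U := M (envelope u) in UE *.
have te := envelope_topical tphi supersolution_ge.
set Q := quad_form H w.
have phiU : phi x <= U x.
  by apply: le_trans (Mge _ te x); exact: (le_envelope _ tphi supersolution_ge).
rewrite -subr_ge0.
(* The coefficient collects the errors left after division by [h ^ 2]. Taking [h = h2 / 2] turns
   [h2 <= 1] into the bound [h <= 1/2] of [supersolution_line]. *)
apply: (@ge0_linear_bound _ _ (4 * (U x - phi x) + `|Q| + 2 * K + 4)) => h2 /andP[h20 h21].
pose h := h2 / 2; pose c : R := (1 + 4 * h ^+ 2) / 3.
have h0 : 0 < h by rewrite divr_gt0.
have h12 : h <= 2^-1 by rewrite /h; lra.
have cR : 3 * c = 1 + 4 * h ^+ 2 by rewrite /c mulrC divfK.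
have hh0 : 0 < h ^+ 2 by exact: exprn_gt0.
have hh : h ^+ 2 <= h * 2^-1 by rewrite expr2 ler_pM2l.
have c0 : 0 < c by lra.
have c1 : c <= 1 by lra.
have ch0 : 0 < c * h ^+ 2 by exact: mulr_gt0.
have ch1 : c * h ^+ 2 <= h ^+ 2 by rewrite ler_piMl// ltW.
have line y : (1 + c * h ^+ 2) * binary h w u y + 3 * c * h ^+ 2 * phi y
    + - (6 * c * h ^+ 2 * h) <= (1 + 4 * c * h ^+ 2) * u y.
  have [m0|m0] := ltP 0 (sqnorm w).
    by have := supersolution_line y (introT andP (conj h0 h12)) m0 cR; rewrite -/w; lra.
  (* For the zero vertex there is no line, and the inequality reduces to [phi <= u]. *)
  have w0 : w = 0.
    apply/eqP; rewrite -normr_eq0 -sqrf_eq0 eq_le sqr_ge0 andbT.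
    exact: le_trans (norm_le_sqnorm w) m0.
  rewrite w0 binary0; have := ler_wpM2l (ltW ch0) (supersolution_ge y).
  have : 0 < c * h ^+ 2 * h by rewrite mulr_gt0.
  by lra.
have env0 := envelope_binary tphi supersolution_ge _ _ _ _ line.
have env : forall y, (1 + c * h ^+ 2) * binary h w (envelope u) y + 3 * c * h ^+ 2 * phi y
    + - (6 * c * h ^+ 2 * h) <= (1 + 4 * c * h ^+ 2) * envelope u y.
  by apply: env0; lra.
have le := topical_lipschitz te; have lphi := topical_lipschitz tphi.
have tb := topical_binary h w te.
have a0 : 0 < 1 + 4 * c * h ^+ 2 by lra.
(* After division by [a] the weights sum to 1, so the left side is topical, hence Lipschitz, as the
   monotonicity of [M] requires. *)
pose a := 1 + 4 * c * h ^+ 2; pose be := (1 + c * h ^+ 2) / a; pose ga := 3 * c * h ^+ 2 / a.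
have be0 : 0 <= be by rewrite divr_ge0 ?(ltW a0)//; lra.
have ga0 : 0 <= ga by rewrite divr_ge0 ?(ltW a0)//; lra.
have bega : be + ga = 1.
  by rewrite /be /ga -mulrDl -[RHS](@divff _ a) ?gt_eqF//; congr (_ / _); rewrite /a; ring.
have tc := topical_convex be0 ga0 bega tb tphi.
have : M (fun y => be * binary h w (envelope u) y + ga * phi y) x <= U x + 6 * c * h ^+ 2 * h / a.
  rewrite -(averaging_cstD hM)//; apply: (averaging_le hM).
  - exact: topical_lipschitz.
  - exact: topical_lipschitz (topical_addc _ te).
  - move=> y; rewrite -(ler_pM2l a0).
    have -> : (1 + 4 * c * h ^+ 2) * (envelope u y + 6 * c * h ^+ 2 * h / a) =
        (1 + 4 * c * h ^+ 2) * envelope u y + 6 * c * h ^+ 2 * h.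
      by rewrite -/a; field; rewrite gt_eqF.
    have -> : (1 + 4 * c * h ^+ 2) * (be * binary h w (envelope u) y + ga * phi y) =
      (1 + c * h ^+ 2) * binary h w (envelope u) y + 3 * c * h ^+ 2 * phi y.
      by rewrite -/a /be /ga; field; rewrite gt_eqF.
    by have := env y; lra.
rewrite (averaging_lin hM)//; last exact: topical_lipschitz.
rewrite (averaging_binary _ _ _ hM le) -/U => main.
have {}main : be * binary h w U x + ga * phi x <= U x + 6 * c * h ^+ 2 * h / a.
  by apply: le_trans main; rewrite lerD2l ler_wpM2l// Mge.
have {main} : (1 + c * h ^+ 2) * binary h w U x + 3 * c * h ^+ 2 * phi x <=
    a * U x + 6 * c * h ^+ 2 * h.
  have := ler_wpM2l (ltW a0) main.
  have -> : (1 + 4 * c * h ^+ 2) * (be * binary h w U x + ga * phi x) =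
      (1 + c * h ^+ 2) * binary h w U x + 3 * c * h ^+ 2 * phi x.
    by rewrite -/a /be /ga; field; rewrite gt_eqF.
  have -> // : (1 + 4 * c * h ^+ 2) * (U x + 6 * c * h ^+ 2 * h / a) =
      a * U x + 6 * c * h ^+ 2 * h.
  by rewrite -/a; field; rewrite gt_eqF.
have := expansion2_binary (vertex_norm v) (ltW K0) (ltW h0) UE.
rewrite ler_norml -/w -/Q => /andP[E _].
have {}E : U x + h ^+ 2 * (2^-1 * Q - K * h) <= binary h w U x.
  by move: E; rewrite exprS expr2; lra.
have cp : 0 <= 1 + c * h ^+ 2 by lra.
have {}E := ler_wpM2l cp E => main.
have : h ^+ 2 * ((1 + c * h ^+ 2) * (2^-1 * Q - K * h)) <=
    h ^+ 2 * (3 * c * (U x - phi x + 2 * h)).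
  by move: main; rewrite /a; lra.
rewrite ler_pM2l// cR => {}main.
have hX : c * h ^+ 2 <= h by lra.
have q1 : - (h * `|Q|) <= c * h ^+ 2 * (2^-1 * Q).
  have : c * h ^+ 2 * `|Q| <= h * `|Q| by rewrite ler_wpM2r.
  have : c * h ^+ 2 * - Q <= c * h ^+ 2 * `|Q|.
    by rewrite ler_pM2l// -normrN ler_norm.
  have : 0 <= c * h ^+ 2 * `|Q| by rewrite mulr_ge0// ltW.
  by lra.
have q2 : c * h ^+ 2 * (K * h) <= K * h.
  by rewrite ler_piMl//; [rewrite mulr_ge0// ltW|lra].
have q3 : h ^+ 2 * (U x - phi x) <= h * (U x - phi x).
  by rewrite ler_wpM2r ?subr_ge0//; lra.
have q4 : h ^+ 2 * h <= 4^-1 * h by rewrite ler_pM2r//; lra.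
have q5 : 0 <= h * (U x - phi x) by rewrite mulr_ge0 ?subr_ge0// ltW.
have q6 : 0 <= K * h by rewrite mulr_ge0// ltW.
have q7 : 0 <= h * `|Q| by rewrite mulr_ge0// ltW.
have -> : h2 = 2 * h by rewrite /h; lra.
have -> : - (2 * h * (4 * (U x - phi x) + `|Q| + 2 * K + 4)) =
  - (8 * (h * (U x - phi x)) + 2 * (h * `|Q|) + 4 * (K * h) + 8 * h) by ring.
by move: main; lra.
Qed.

Lemma stationary_upper (d : R) : 0 < d -> exists2 C : R, 0 <= C &
  forall eps ue, 0 < eps < 1 -> geometric_dpp eps phi ue ->
    (exists C : R, forall x, `|ue x - phi x| <= C) ->
    forall x, ue x <= u x + d + C * eps.
Proof.
move=> d0; have [M [K [K0 hM Md M2]]] := mollifier (n := n) d0.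
exists K => [|eps ue eps01 dpp ubd x]; first exact: ltW.
have [e0 e1] := andP eps01.
have te := envelope_topical tphi supersolution_ge.
have tU := topical_averaging hM te; set U := M (envelope u) in tU.
have Mge f : topical f -> forall y, f y <= M f y by move=> tf y; case/andP: (Md _ tf y).
have phiU y : phi y <= U y.
  by apply: le_trans (Mge _ te y); exact: (le_envelope _ tphi supersolution_ge).
have eps2 : 0 < eps ^+ 2 by exact: exprn_gt0.
have e21 : 0 <= 1 - eps ^+ 2 by rewrite subr_ge0 expr_le1 ?ltW.
have Ke : 0 <= K * eps by rewrite mulr_ge0// ltW.
have : ue x <= U x + K * eps.
  (* The discount turns the added constant [K * eps] into a gain of [eps ^ 2 * (K * eps)], exactly
     the Taylor remainder of one step. *)
  apply: (geometric_le n0 eps01 dpp ubd (W := fun y => U y + K * eps)) => y; last first.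
    by rewrite (le_trans (phiU y))// lerDl.
  have [p [H UE]] := M2 _ te y.
  have mU := minmax_expansion2 n0 (ltW e0) (ltW K0) tU UE.
  have mq : max_quad H <= 2 * (U y - phi y).
    apply: max_quad_le; first by rewrite mulr_ge0 ?subr_ge0.
    move=> v; have := supersolution_mollified v K0 hM Mge UE; rewrite -/U; lra.
  have mW : minmax eps (fun y => U y + K * eps) y <= minmax eps U y + K * eps.
    by apply: le_minmax.
  have {}mq := ler_wpM2l (ltW eps2) mq.
  have {}mW : minmax eps (fun y => U y + K * eps) y <=
      U y + eps ^+ 2 * (U y - phi y) + eps ^+ 2 * (K * eps) + K * eps.
    by move: mU mW; lra.
  have {mW} := ler_wpM2l e21 mW.
  have : 0 <= eps ^+ 2 * (eps ^+ 2 * (U y - phi y)).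
    by apply: mulr_ge0; [exact: ltW|apply: mulr_ge0; [exact: ltW|rewrite subr_ge0]].
  have : 0 <= eps ^+ 2 * (eps ^+ 2 * (K * eps)).
    by apply: mulr_ge0; [exact: ltW|apply: mulr_ge0; [exact: ltW|]].
  lra.
have := envelope_le tphi supersolution_ge x.
have /andP[_] := Md _ te x; rewrite -/U; lra.
Qed.

End StationaryUpper.

(** * The final-value problem *)

Section Barrier.
Context {R : realType} {n : nat}.
Local Notation V := 'rV[R]_n.

Lemma quad_form_bound (H : 'M[R]_n) : exists2 C : R, 0 <= C &
  forall y, `|quad_form H y| <= C * `|y| ^+ 2.
Proof.
exists (\sum_i \sum_j `|H i j|) => [|y].
  by apply: sumr_ge0 => i _; apply: sumr_ge0.
rewrite quad_formE (le_trans (ler_norm_sum _ _ _))// mulr_suml.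
apply: ler_sum => i _; rewrite normrM.
have : `|\sum_j y 0 j * H i j| <= `|y| * \sum_j `|H i j|.
  rewrite (le_trans (ler_norm_sum _ _ _))// mulr_sumr; apply: ler_sum => j _.
  by rewrite normrM ler_wpM2r// coord_le_norm.
move=> h; apply: le_trans (ler_pM _ _ (coord_le_norm y i) h) _ => //.
by rewrite expr2 mulrA [leRHS]mulrC.
Qed.

(** Young's inequality with weight [k]: the cubic Taylor remainder is dominated by smooth terms,
    whose sizes balance at distance [k]. *)
Lemma norm_cube_le (k : R) (y : V) : 0 < k ->
  `|y| ^+ 3 <= k * sqnorm y + k^-1 * (sqnorm y * sqnorm y).
Proof.
move=> k0; set s := `|y|; have s0 : 0 <= s := normr_ge0 y.
have s2 : s ^+ 2 <= sqnorm y := norm_le_sqnorm y.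
have h1 : k * s ^+ 2 <= k * sqnorm y by rewrite ler_pM2l.
have h2 : k^-1 * (s ^+ 2 * s ^+ 2) <= k^-1 * (sqnorm y * sqnorm y).
  by rewrite ler_pM2l ?invr_gt0// ler_pM// sqr_ge0.
have : 0 <= k^-1 * (s * (k - s)) ^+ 2 by rewrite mulr_ge0 ?sqr_ge0// invr_ge0 ltW.
have -> : k^-1 * (s * (k - s)) ^+ 2 = k * s ^+ 2 - 2 * s ^+ 3 + k^-1 * (s ^+ 2 * s ^+ 2).
  by field; rewrite gt_eqF.
have : 0 <= s ^+ 3 by rewrite exprn_ge0.
lra.
Qed.

Variables (xb p : V) (H : 'M[R]_n) (a b e1 e2 e3 m s t1 : R) (j : nat).

(** The first line is a second-order polynomial moving with speed [b] backwards in time. In the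
    second, [s] is 1 or -1 for a bound from above or below, [e1] and [e2] dominate the cubic
    remainder, [e3] compensates the Hessian of the quartic term, and the power of [t1 - z.1] closes
    the strip at its past end. *)
Definition barrier (z : R * V) : R :=
  a + dot (z.2 - xb) p + 2^-1 * quad_form H (z.2 - xb) + (t1 - z.1) * b
  + s * (e1 * sqnorm (z.2 - xb) + e2 * (sqnorm (z.2 - xb) * sqnorm (z.2 - xb))
         + e3 * ((t1 - z.1) * sqnorm (z.2 - xb)) + m * (t1 - z.1) ^+ j.+1).

Lemma smooth_barrier : smooth barrier.
Proof.
have c2 : continuous (@snd R V) by move=> z; exact: cvg_snd.
have l2 (x d : R * V) (r : R) : (r *: d + x).2 = r *: d.2 + x.2 by [].
have sc c := @smooth_cst R (R * V)%type c.
have sr : smooth (fun z : R * V => t1 - z.1).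
  apply: smooth_sub => //; apply: smooth_linear; last by [].
  by move=> z; exact: cvg_fst.
have sn := smooth_sqnorm c2 l2 xb.
apply: smooth_add.
  apply: smooth_add; last exact: smooth_mul.
  apply: smooth_add; last by apply: smooth_mul => //; exact: (smooth_quad c2 l2).
  by apply: smooth_add => //; exact: (smooth_dot c2 l2).
apply: smooth_mul => //; apply: smooth_add.
  apply: smooth_add; last by apply: smooth_mul => //; exact: smooth_mul.
  by apply: smooth_add; apply: smooth_mul => //; exact: smooth_mul.
by apply: smooth_mul => //; exact: smooth_exp.
Qed.

Lemma barrier_time_derivative t x :
  (fun r => barrier (r, x))^`()%classic t =
  - (b + s * (e3 * sqnorm (x - xb) + m * (j.+1%:R * (t1 - t) ^+ j))).
Proof.
rewrite derive1E /barrier /=.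
set c1 := a + _ + _; set N := sqnorm _.
have dr : is_derive t 1 (fun r : R => t1 - r) (-1).
  by apply: is_derive_eq; ring.
have dX : is_derive t 1 (fun r : R => (t1 - r) ^+ j.+1) (- (j.+1%:R * (t1 - t) ^+ j)).
  have := is_deriveX j.+1 dr; rewrite exprfctE => d.
  by apply: (is_derive_eq d); rewrite /GRing.scale/= mulrN1.
have D : is_derive t 1 (fun r : R => c1 + (t1 - r) * b
    + s * (e1 * N + e2 * (N * N) + e3 * ((t1 - r) * N) + m * (t1 - r) ^+ j.+1))
    (- (b + s * (e3 * N + m * (j.+1%:R * (t1 - t) ^+ j)))).
  by apply: is_derive_eq; rewrite /GRing.scale/=; ring.
by have [] := D.
Qed.

Lemma barrier_hessian t x v :
  quad_form (hessian (fun y => barrier (t, y)) x) v =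
  quad_form H v + s * (2 * e1 * sqnorm v
    + e2 * (8 * dot (x - xb) v ^+ 2 + 4 * sqnorm (x - xb) * sqnorm v)
    + 2 * e3 * (t1 - t) * sqnorm v).
Proof.
have jn := jet_sqnorm (n := n) xb.
have J := jet_add (jet_add (jet_add (jet_add (jet_cst a) (jet_dot p xb))
    (jet_scale 2^-1 (jet_quad H xb))) (jet_cst ((t1 - t) * b)))
  (jet_scale s (jet_add (jet_add (jet_add (jet_scale e1 jn)
      (jet_scale e2 (jet_mul jn jn))) (jet_scale e3 (jet_scale (t1 - t) jn)))
    (jet_cst (m * (t1 - t) ^+ j.+1)))).
by rewrite (jet_hessian x v J); field.
Qed.

End Barrier.

Section Strip.
Context {R : realType} {n : nat}.
Local Notation V := 'rV[R]_n.

Lemma strip_maximum_principle (T t0 t1 A B i : R) (xb : V) (f : R * V -> R) :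
  t1 <= T -> 0 < i ->
  {within [set z : R * V | z.1 <= T], continuous f} ->
  (forall x, f (t0, x) <= 0) -> (forall x, f (t1, x) <= 0) ->
  (forall t x, t0 <= t <= t1 ->
     f (t, x) <= A + B * `|x - xb| - i * `|x - xb| ^+ 2) ->
  (forall t x, t0 < t < t1 -> ~ \forall z \near (t, x), f z <= f (t, x)) ->
  forall t x, t0 <= t <= t1 -> f (t, x) <= 0.
Proof.
move=> t1T i0 cf f0 f1 fAB nomax t x tt; rewrite leNgt; apply/negP => fpos.
have [r0 r00 rf] := quadratic_dominates A B 0 i0.
pose r := r0 + `|x - xb| + 1.
have r0r : r0 < r by rewrite /r -addrA ltrDl ltr_wpDl.
have xr : `|x - xb| < r by rewrite /r; lra.
pose D : set (R * V) := `[t0, t1]%classic `*` [set z : V | `|z - xb| <= r].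
pose O : set (R * V) := `]t0, t1[%classic `*` [set z : V | `|z - xb| < r].
have cD : compact D.
  by apply: compact_setX; [exact: segment_compact|exact: norm_ball_compact].
have oO : open O.
  have c1 : continuous (@fst R V) by move=> z; exact: cvg_fst.
  have c2 : continuous (fun z : R * V => `|z.2 - xb|).
    move=> z; apply: (@continuous_comp _ _ _ (@snd R V) (fun y : V => `|y - xb|)).
      exact: cvg_snd.
    exact: (lip_continuous (lip_norm_sub xb)).
  have -> : O = [set z | t0 < z.1] `&` ([set z | z.1 < t1] `&` [set z | `|z.2 - xb| < r]).
    apply/seteqP; split=> z; rewrite /O /= in_itv/=.
      by move=> [/andP[? ?] ?].
    by move=> [? [? ?]]; split => //; apply/andP.
  by apply: openI; [exact: open_superlevel|apply: openI; exact: open_sublevel].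
have OD : O `<=` D.
  move=> z; rewrite /O /D /= !in_itv/= => -[/andP[? ?] ?].
  by split; [rewrite !ltW|exact: ltW].
have DT : D `<=` [set z | z.1 <= T].
  by move=> z; rewrite /D /= in_itv/= => -[/andP[_ ?] _]; exact: le_trans t1T.
have tne : t0 < t < t1.
  have [l u] := andP tt; apply/andP; split; rewrite lt_neqAle ?l ?u andbT; apply/eqP => E.
    by move: fpos; rewrite -E ltNge f0.
  by move: fpos; rewrite E ltNge f1.
have Ox : O (t, x) by rewrite /O /= in_itv/=.
have cnf : {within D, continuous (fun z => - f z)}.
  move=> z; apply: continuousN.
  exact: (continuous_subspaceW DT cf).
have [z nDz nOz|[t' x'] [Oz _ touch]] := interior_min cD oO OD Ox cnf.
  rewrite ltrN2; apply: le_lt_trans fpos.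
  case: z nDz nOz => t' x'; rewrite /D /O /= !in_itv/= => -[/andP[l u] xr'] nO.
  have [/eqP E|l'] := eqVneq t0 t'; first by rewrite -(eqP E).
  have [/eqP E|u'] := eqVneq t' t1; first by rewrite (eqP E).
  apply: (le_trans (fAB t' x' _)); first by rewrite l u.
  apply/ltW/rf; apply: (lt_le_trans r0r); rewrite leNgt; apply/negP => xr2.
  by apply: nO; split=> //; rewrite !lt_neqAle l' u' l u.
have tt' : t0 < t' < t1 by move: Oz; rewrite /O /= in_itv/= => -[].
by apply: (nomax t' x' tt'); apply: filterS touch => z; rewrite lerN2.
Qed.

End Strip.

(** The summand [K * n] is due to the term [K * k * sqnorm] of the barrier. The other is due to the
    [e3] term over a strip of length [2 * k ^ 2]; there [4 * n ^ 2 + 2 * n] is half the bound on the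
    Hessian form of the squared [sqnorm] at a vertex, per unit of [sqnorm]. *)
Definition step_constant {R : realType} (n : nat) (K : R) : R :=
  K * n%:R + 2 * n%:R * (K * (4 * n%:R ^+ 2 + 2 * n%:R)).

Lemma step_constant_ge0 {R : realType} (n : nat) (K : R) :
  0 <= K -> 0 <= step_constant n K.
Proof.
move=> K0; have nn : 0 <= (n%:R : R) by [].
by rewrite addr_ge0 ?mulr_ge0// addr_ge0// ?mulr_ge0// sqr_ge0.
Qed.

Section ParabolicStep.
Context {R : realType} {n : nat}.
Local Notation V := 'rV[R]_n.
Variables (T : R) (phi : V -> R) (w : R -> V -> R).
Hypotheses (visc : final_value_viscosity_solution T phi w)
  (lg : time_linear_growth T w).

Local Notation dim := (4 * n%:R ^+ 2 + 2 * n%:R : R).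
Local Notation step_constant := (step_constant n).

Let step_barrier (s b t1 k K : R) (g : V -> R) (xb p : V) (H : 'M[R]_n) (m : R) (j : nat) :=
  barrier xb p H (g xb) b (K * k) (K / k) (K * dim / k) m s t1 j.

(* The power of t1 - t is large at the past end t1 - 2 k^2 of the strip, where
   nothing is known about w, and negligible at t1 - k^2. *)
Let barrier_step (s b t1 k K : R) (g : V -> R) (xb p : V) (H : 'M[R]_n) :
  (s = 1 \/ s = -1) -> t1 <= T -> 0 < k -> 0 < K -> expansion2 K g xb p H ->
  (forall x, s * w t1 x <= s * g x) ->
  (forall m j t x, 0 <= m -> t1 - 2 * k ^+ 2 < t < t1 ->
    ~ \forall z \near (t, x),
      s * (w z.1 z.2 - step_barrier s b t1 k K g xb p H m j z) <=
      s * (w t x - step_barrier s b t1 k K g xb p H m j (t, x))) ->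
  s * w (t1 - k ^+ 2) xb <= s * (g xb + k ^+ 2 * b).
Proof.
move=> s1 t1T k0 K0 gE wg nomax.
have ss : s * s = 1 by case: s1 => ->; ring.
have sn : `|s| = 1 by case: s1 => ->; rewrite ?normrN normr1.
have sle (y : R) : s * y <= `|y|.
  by apply: le_trans (ler_norm _) _; rewrite normrM sn mul1r.
pose tau := k ^+ 2; have tau0 : 0 < tau by exact: exprn_gt0.
have [C1 [C2 wC]] := lg (t1 - 2 * tau).
have [CH CH0 HC] := quad_form_bound H.
pose e2 := K / k; have e20 : 0 < e2 by rewrite divr_gt0.
(* [CH / 2] controls the quadratic form of [H], and the extra 1 leaves the coercive term of the
   strip. The quartic term pays for both by completing the square, whence [q ^ 2 / (4 * e2)] in
   [A]. *)
pose q := 2^-1 * CH + 1.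
pose A := `|C1| * `|xb| + C2 + `|g xb| + 2 * tau * `|b| + q ^+ 2 / (4 * e2).
pose B := `|C1| + n%:R * `|p|.
pose F (m : R) j (z : R * V) := s * (w z.1 z.2 - step_barrier s b t1 k K g xb p H m j z).
have dim0 : 0 <= dim by rewrite addr_ge0// mulr_ge0// ?sqr_ge0.
have e30 : 0 <= K * dim / k by rewrite divr_ge0 ?(ltW k0)// mulr_ge0// ltW.
have FE (m : R) j t x : F m j (t, x) = s * w t x
   - s * (g xb + dot (x - xb) p + 2^-1 * quad_form H (x - xb) + (t1 - t) * b)
   - (K * k * sqnorm (x - xb) + K / k * (sqnorm (x - xb) * sqnorm (x - xb))
      + K * dim / k * ((t1 - t) * sqnorm (x - xb)) + m * (t1 - t) ^+ j.+1).
  rewrite /F /step_barrier /barrier /= mulrBr mulrDr (mulrA s s) ss mul1r.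
  by ring.
have growth (m : R) j t x : t1 - 2 * tau <= t <= t1 ->
    F m j (t, x) <= A + B * `|x - xb| - 1 * `|x - xb| ^+ 2 - m * (t1 - t) ^+ j.+1.
  move=> /andP[tl tu]; rewrite FE.
  set z := x - xb; set N := sqnorm z.
  have N0 : 0 <= N := sqnorm_ge0 z; have zN : `|z| ^+ 2 <= N := norm_le_sqnorm z.
  have r0 : 0 <= t1 - t by lra.
  have b1 : s * w t x <= `|C1| * `|xb| + `|C1| * `|z| + C2.
    apply: le_trans (sle _) _; apply: le_trans (wC t x _) _.
      by rewrite tl (le_trans tu).
    rewrite lerD2r -mulrDr; apply: le_trans (_ : `|C1| * `|x| <= _).
      by rewrite ler_wpM2r// ler_norm.
    rewrite ler_wpM2l// -[x in leLHS](subrK xb) addrC.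
    exact: ler_normD.
  have b2 := sle (- g xb); have b3 := sle (- dot z p); have b4 := sle (- quad_form H z).
  have b5 := sle (- b); rewrite !normrN in b2 b3 b4 b5.
  have b5' : (t1 - t) * (s * - b) <= 2 * tau * `|b|.
    apply: le_trans (ler_wpM2l r0 b5) _.
    by rewrite ler_wpM2r//; lra.
  have b3' := dot_le z p; have b4' := HC z.
  have d1 : 0 <= K * k * N by rewrite !mulr_ge0// ltW.
  have d2 : 0 <= K * dim / k * ((t1 - t) * N) by apply: mulr_ge0 => //; exact: mulr_ge0.
  have d3 : q * `|z| ^+ 2 - q ^+ 2 / (4 * e2) <= e2 * (N * N).
    have : e2 * (`|z| ^+ 2 * `|z| ^+ 2) <= e2 * (N * N).
      by rewrite ler_pM2l// ler_pM// sqr_ge0.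
    apply: le_trans; rewrite -subr_ge0.
    have -> : e2 * (`|z| ^+ 2 * `|z| ^+ 2) - (q * `|z| ^+ 2 - q ^+ 2 / (4 * e2)) =
       (2 * e2 * `|z| ^+ 2 - q) ^+ 2 / (4 * e2) by field; rewrite gt_eqF.
    by rewrite divr_ge0 ?sqr_ge0// mulr_ge0// ltW.
  rewrite -/e2; rewrite /A /B.
  have qE : q * `|z| ^+ 2 = 2^-1 * (CH * `|z| ^+ 2) + `|z| ^+ 2 by rewrite /q; ring.
  rewrite qE in d3; have mr : s * (t1 - t) * b = - ((t1 - t) * (s * - b)) by ring.
  lra.
pose M := `|A| + B ^+ 2 + 1.
have M0 : 0 < M by rewrite /M ltr_wpDl// addr_ge0 ?sqr_ge0.
have slice0 x : A + B * `|x - xb| - 1 * `|x - xb| ^+ 2 <= M.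
  have := sqr_ge0 (B / 2 - `|x - xb|); have := ler_norm A; have := sqr_ge0 B.
  by rewrite /M; lra.
suff eb (i : R) : 0 < i -> s * w (t1 - tau) xb <= s * (g xb + tau * b) + i.
  by apply/ler_addgt0Pr => i; exact: eb.
move=> i0.
(* The size of [m] is dictated by the past end, at elapsed time [2 * tau]. At elapsed time [tau] the
   power is smaller by [2 ^ j.+1], which is made larger than [M / i]. *)
have [j [m [m0 mM mi]]] : exists (j : nat) (m : R),
    [/\ 0 <= m, m * (2 * tau) ^+ j.+1 = M & m * tau ^+ j.+1 <= i].
  pose j := Num.truncn (M / i).
  have jM : M / i < j.+1%:R by exact: truncnS_gt.
  have j2 : (j.+1%:R : R) <= 2 ^+ j.+1 by rewrite -natrX ler_nat ltnW// ltn_expl.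
  have tj : 0 < (2 * tau) ^+ j.+1 by rewrite exprn_gt0// mulr_gt0.
  exists j, (M / (2 * tau) ^+ j.+1); split.
  - by rewrite divr_ge0 ?(ltW tj)// ltW.
  - by rewrite divfK// gt_eqF.
  - rewrite exprMn.
    have -> : M / (2 ^+ j.+1 * tau ^+ j.+1) * tau ^+ j.+1 = M / 2 ^+ j.+1.
      by rewrite invfM mulrA divfK// gt_eqF ?exprn_gt0.
    rewrite ler_pdivrMr ?exprn_gt0// mulrC -ler_pdivrMr//.
    exact: le_trans (ltW jM) j2.
have sb := smooth_barrier xb p H (g xb) b (K * k) (K / k) (K * dim / k) m s t1 j.
have [cw _ _] := visc.
have cF : {within [set z : R * V | z.1 <= T], continuous (F m j)}.
  have cd := continuous_sub cw (continuous_subspaceT (sb 0%N)).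
  by move=> z; exact: (continuousM (@cst_continuous _ _ s z) (cd z)).
have bottom x : F m j (t1 - 2 * tau, x) <= 0.
  have tl : t1 - 2 * tau <= t1 - 2 * tau <= t1 by apply/andP; split; lra.
  have := growth m j (t1 - 2 * tau) x tl.
  have -> : t1 - (t1 - 2 * tau) = 2 * tau by ring.
  rewrite mM.
  by have := slice0 x; lra.
have top x : F m j (t1, x) <= 0.
  rewrite FE subrr mul0r addr0 expr0n/= mulr0 mul0r mulr0 !addr0.
  have := gE (x - xb); rewrite (addrC xb) subrK.
  have -> : \sum_i0 (x - xb) 0 i0 * p 0 i0 = dot (x - xb) p by [].
  have := sle (g x - g xb - dot (x - xb) p - 2^-1 * quad_form H (x - xb)).
  have := norm_cube_le (x - xb) k0; rewrite -(ler_pM2l K0).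
  by have := wg x; lra.
have coer t x : t1 - 2 * tau <= t <= t1 ->
    F m j (t, x) <= A + B * `|x - xb| - 1 * `|x - xb| ^+ 2.
  move=> tt; apply: le_trans (growth m j t x tt) _.
  rewrite lerBlDr lerDl; apply: mulr_ge0 => //; apply: exprn_ge0.
  by case/andP: tt; lra.
have nom t x : t1 - 2 * tau < t < t1 -> ~ \forall z \near (t, x), F m j z <= F m j (t, x).
  exact: nomax.
have tm : t1 - 2 * tau <= t1 - tau <= t1 by apply/andP; split; lra.
have := strip_maximum_principle t1T ltr01 cF bottom top coer nom xb tm.
rewrite FE subrr dot0l quad_form0 sqnorm0.
have -> : t1 - (t1 - tau) = tau by ring.
by rewrite !mulr0 !addr0 add0r; lra.
Qed.

Let vertex_sqnorm (v : @cube n) : sqnorm (vertex v : V) <= n%:R.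
Proof.
apply: le_trans (sqnorm_le_norm _) _; rewrite ler_piMr//.
by rewrite expr_le1// vertex_norm.
Qed.

(* The constant of the N-term in the barrier is chosen so that its time
   derivative absorbs the second derivatives of the quartic term. *)
Let barrier_second_order (K k r N : R) (z : V) (v : @cube n) : 0 < K -> 0 < k ->
  0 <= r -> r <= 2 * k ^+ 2 -> N = sqnorm z ->
  2^-1 * (2 * (K * k) * sqnorm (vertex v : V)
    + K / k * (8 * dot z (vertex v) ^+ 2 + 4 * N * sqnorm (vertex v : V))
    + 2 * (K * dim / k) * r * sqnorm (vertex v : V)) <=
  K * dim / k * N + step_constant K * k.
Proof.
move=> K0 k0 r0 rk NE; set S := sqnorm _.
have S0 : 0 <= S := sqnorm_ge0 _; have Sn : S <= n%:R := vertex_sqnorm v.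
have N0 : 0 <= N by rewrite NE sqnorm_ge0.
have nn : 0 <= (n%:R : R) by [].
have Kk : 0 < K / k by rewrite divr_gt0.
have dim0 : 0 <= dim by rewrite addr_ge0// mulr_ge0// ?sqr_ge0.
have D : dot z (vertex v) ^+ 2 <= n%:R ^+ 2 * N.
  rewrite -real_normK ?num_real//.
  have := dot_le z (vertex v : V) => dl.
  have : `|dot z (vertex v)| <= n%:R * `|z|.
    by apply: le_trans dl _; rewrite ler_wpM2r// ler_piMr// vertex_norm.
  by move=> {}dl; apply: le_trans (ler_pM _ _ dl dl) _ => //;
    rewrite -expr2 exprMn ler_wpM2l ?sqr_ge0// NE norm_le_sqnorm.
have h1 : K * k * S <= K * n%:R * k.
  by rewrite mulrAC ler_pM2r// ler_pM2l.
have h2 : N * S <= n%:R * N by rewrite mulrC ler_wpM2r.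
have h3 : K / k * (4 * dot z (vertex v) ^+ 2 + 2 * (N * S)) <= K / k * (dim * N).
  by rewrite ler_pM2l//; lra.
have h4 : K / k * dim * (r * S) <= K / k * dim * (2 * k ^+ 2 * n%:R).
  apply: ler_wpM2l; [apply: mulr_ge0 => //; exact: ltW|exact: ler_pM].
have h5 : K / k * dim * (2 * k ^+ 2 * n%:R) = 2 * n%:R * (K * dim) * k.
  by field; rewrite gt_eqF.
rewrite h5 in h4; rewrite /step_constant.
have -> : K * dim / k = K / k * dim by ring.
lra.
Qed.

(** With speed [b] slightly above the claimed rate the barrier is a strict supersolution on the
    strip, so [w] minus the barrier has no interior local maximum. *)
Lemma viscosity_sub_step (t1 k K : R) (g : V -> R) (xb p : V) (H : 'M[R]_n) :
  t1 <= T -> 0 < k -> 0 < K -> expansion2 K g xb p H ->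
  (forall x, w t1 x <= g x) ->
  w (t1 - k ^+ 2) xb <= g xb + k ^+ 2 * (2^-1 * max_quad H + step_constant K * k).
Proof.
move=> t1T k0 K0 gE wg; have k20 : 0 < k ^+ 2 by exact: exprn_gt0.
apply/ler_addgt0Pr => i i0.
(* The slack [i / k ^ 2] makes the inequality strict and costs only [i] over a time [k ^ 2]. *)
pose b := 2^-1 * max_quad H + step_constant K * k + i / k ^+ 2.
have := @barrier_step 1 b t1 k K g xb p H (or_introl erefl) t1T k0 K0 gE.
rewrite !mul1r.
have -> : g xb + k ^+ 2 * b =
  g xb + k ^+ 2 * (2^-1 * max_quad H + step_constant K * k) + i.
  by rewrite /b; field; rewrite gt_eqF.
apply=> [x|m j t x m0 /andP[tl tu] touch]; first by rewrite !mul1r.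
pose B := step_barrier 1 b t1 k K g xb p H m j.
have sB : smooth B by exact: smooth_barrier.
have [_ _ /(_ t x B _ sB)] := visc; have tT : t < T by exact: lt_le_trans t1T.
move=> /(_ tT)[_ heat]; have {}heat := heat _.
have {heat} : 0 <= (fun t0 => B (t0, x))^`()%classic t
    + 2^-1 * max_quad (hessian (fun y => B (t, y)) x).
  by apply: heat; apply: filterS touch => z; rewrite !mul1r.
rewrite barrier_time_derivative mul1r.
set N := sqnorm (x - xb).
have e3N : 0 <= K * dim / k * N.
  by rewrite mulr_ge0 ?sqnorm_ge0// divr_ge0 ?(ltW k0)// mulr_ge0 ?(ltW K0)// addr_ge0// mulr_ge0// ?sqr_ge0.
have r0 : 0 <= t1 - t by lra.
have mr : 0 <= m * (j.+1%:R * (t1 - t) ^+ j) by rewrite !mulr_ge0// exprn_ge0.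
have sc0 : 0 <= step_constant K * k.
  by rewrite mulr_ge0 ?(ltW k0)// step_constant_ge0// ltW.
have mq : 2^-1 * max_quad (hessian (fun y => B (t, y)) x) <=
    2^-1 * max_quad H + K * dim / k * N + step_constant K * k.
  rewrite mulrC ler_pdivrMr//; apply: max_quad_le => [|v].
    by have := max_quad_ge0 H; lra.
  rewrite barrier_hessian mul1r.
  have r2 : t1 - t <= 2 * k ^+ 2 by lra.
  have := @barrier_second_order K k (t1 - t) N (x - xb) v K0 k0 r0 r2 erefl.
  have := le_max_quad H v; rewrite -/N; lra.
have : 0 < i / k ^+ 2 by rewrite divr_gt0.
by rewrite /b; lra.
Qed.

Lemma viscosity_super_step (t1 k K : R) (g : V -> R) (xb p : V) (H : 'M[R]_n)
    (v : @cube n) :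
  t1 <= T -> 0 < k -> 0 < K -> expansion2 K g xb p H ->
  (forall x, g x <= w t1 x) ->
  g xb + k ^+ 2 * (2^-1 * quad_form H (vertex v) - step_constant K * k) <=
  w (t1 - k ^+ 2) xb.
Proof.
move=> t1T k0 K0 gE wg; have k20 : 0 < k ^+ 2 by exact: exprn_gt0.
rewrite -lerN2; apply/ler_addgt0Pr => i i0.
pose b := 2^-1 * quad_form H (vertex v) - step_constant K * k - i / k ^+ 2.
have := @barrier_step (-1) b t1 k K g xb p H (or_intror erefl) t1T k0 K0 gE.
rewrite !mulN1r.
have -> : - (g xb + k ^+ 2 * b) =
  - (g xb + k ^+ 2 * (2^-1 * quad_form H (vertex v) - step_constant K * k)) + i.
  by rewrite /b; field; rewrite gt_eqF.
apply=> [x|m j t x m0 /andP[tl tu] touch]; first by rewrite !mulN1r lerN2.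
pose B := step_barrier (-1) b t1 k K g xb p H m j.
have sB : smooth B by exact: smooth_barrier.
have [_ _ /(_ t x B _ sB)] := visc; have tT : t < T by exact: lt_le_trans t1T.
move=> /(_ tT)[heat _]; have {}heat := heat _.
have {heat} : (fun t0 => B (t0, x))^`()%classic t
    + 2^-1 * max_quad (hessian (fun y => B (t, y)) x) <= 0.
  by apply: heat; apply: filterS touch => z; rewrite !mulN1r lerN2.
rewrite barrier_time_derivative mulN1r.
set N := sqnorm (x - xb).
have r0 : 0 <= t1 - t by lra.
have mr : 0 <= m * (j.+1%:R * (t1 - t) ^+ j) by rewrite !mulr_ge0// exprn_ge0.
have mq := le_max_quad (hessian (fun y => B (t, y)) x) v.
rewrite barrier_hessian mulN1r in mq.
have r2 : t1 - t <= 2 * k ^+ 2 by lra.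
have := @barrier_second_order K k (t1 - t) N (x - xb) v K0 k0 r0 r2 erefl.
have : 0 < i / k ^+ 2 by rewrite divr_gt0.
by rewrite /b -/N in mq *; lra.
Qed.

End ParabolicStep.

(** * Symmetric random walks along a vertex *)

Section RandomWalk.
Context {R : realType} {n : nat}.
Local Notation V := 'rV[R]_n.
Implicit Types (f g U : V -> R) (x p w : V) (H : 'M[R]_n) (h K : R).

Lemma expansion2_addc K g x p H (c : R) : expansion2 K g x p H ->
  expansion2 K (fun y => g y + c) x p H.
Proof.
move=> gE y; have -> // : g (x + y) + c - (g x + c) = g (x + y) - g x by ring.
Qed.

Lemma binary_expansion2 K g h w : (forall x, exists p H, expansion2 K g x p H) ->
  forall x, exists p H, expansion2 K (binary h w g) x p H.
Proof.
move=> gE x; have [p1 [H1 E1]] := gE (x + h *: w); have [p2 [H2 E2]] := gE (x - h *: w).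
exists (2^-1 *: (p1 + p2)), (2^-1 *: (H1 + H2)) => y.
have -> : \sum_i y 0 i * (2^-1 *: (p1 + p2)) 0 i =
    2^-1 * (\sum_i y 0 i * p1 0 i + \sum_i y 0 i * p2 0 i).
  by rewrite -big_split mulr_sumr; apply: eq_bigr => i _; rewrite !mxE/=; ring.
have -> : quad_form (2^-1 *: (H1 + H2)) y = 2^-1 * (quad_form H1 y + quad_form H2 y).
  rewrite !quad_formE -big_split mulr_sumr; apply: eq_bigr => i _ /=.
  rewrite -mulrDr -big_split mulrCA; congr (_ * _); rewrite mulr_sumr.
  by apply: eq_bigr => j _; rewrite !mxE/=; ring.
have := E1 y; have := E2 y; rewrite /binary !(addrAC x y).
by rewrite !ler_norml => /andP[? ?] /andP[? ?]; apply/andP; split; lra.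
Qed.

Lemma iter_binary_topical m h w f : topical f -> topical (iter m (binary h w) f).
Proof. by move=> tf; elim: m => // m IH; exact: topical_binary. Qed.

Lemma iter_binary_le m h w f g : (forall x, f x <= g x) ->
  forall x, iter m (binary h w) f x <= iter m (binary h w) g x.
Proof.
move=> fg; elim: m => // m IH x /=.
by rewrite /binary ler_pM2l ?invr_gt0// lerD.
Qed.

Lemma averaging_iter_binary A m h w f x : averaging A -> topical f ->
  A (iter m (binary h w) f) x = iter m (binary h w) (A f) x.
Proof.
move=> hA tf; elim: m x => // m IH x /=.
rewrite averaging_binary//; last exact/topical_lipschitz/iter_binary_topical.
by rewrite /binary !IH.
Qed.

(** Second and fourth moments of [m] symmetric steps: with variance [V = m * h ^ 2], the mean of
    [s ^ 4] becomes at most [s ^ 4 + 6 * s ^ 2 * V + 3 * V ^ 2], the Gaussian value. *)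
Lemma iter_binary_moments m h w g x (a p b c : R) : 0 <= c ->
  (forall s, a + p * s + b * s ^+ 2 - c * s ^+ 4 <= g (x + s *: w)) ->
  a + b * (m%:R * h ^+ 2) - 3 * c * (m%:R * h ^+ 2) ^+ 2 <= iter m (binary h w) g x.
Proof.
move=> c0 gE.
suff main s : a + p * s + b * (s ^+ 2 + m%:R * h ^+ 2)
    - c * (s ^+ 4 + 6 * s ^+ 2 * (m%:R * h ^+ 2) + 3 * (m%:R * h ^+ 2) ^+ 2) <=
    iter m (binary h w) g (x + s *: w).
  by have := main 0; rewrite scale0r addr0; apply: le_trans; lra.
elim: m s => [|m IH] s /=.
  by apply: le_trans (gE s); rewrite mul0r expr0n/=; lra.
have h1 := IH (s + h); have h2 := IH (s - h).
rewrite scalerDl addrA in h1; rewrite scalerBl addrA in h2.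
rewrite /binary -natr1.
have : 0 <= c * h ^+ 4 by rewrite mulr_ge0// exprn_even_ge0.
lra.
Qed.

(** The cubic remainder is split into a quadratic and a quartic part with weight [k]; at variance
    [k ^ 2] they cost [K * k ^ 3] and [3 * K * k ^ 3], independently of the number of steps. *)
Lemma iter_binary_expansion2 m h k K w U x p H : 0 < k -> 0 <= K -> `|w| <= 1 ->
  m%:R * h ^+ 2 = k ^+ 2 -> expansion2 K U x p H ->
  U x + k ^+ 2 * (2^-1 * quad_form H w - 4 * K * k) <= iter m (binary h w) U x.
Proof.
move=> k0 K0 w1 mk UE.
have c0 : 0 <= K / k by rewrite divr_ge0// ltW.
have := @iter_binary_moments m h w U x (U x) (\sum_i w 0 i * p 0 i)
  (2^-1 * quad_form H w - K * k) (K / k) c0.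
rewrite mk => E; apply: le_trans (E _).
  rewrite (_ : 3 * (K / k) * (k ^+ 2) ^+ 2 = 3 * K * k * k ^+ 2); first by lra.
  by field; rewrite gt_eqF.
move=> s; have := UE (s *: w); rewrite quad_formZ.
have -> : \sum_i (s *: w) 0 i * p 0 i = s * \sum_i w 0 i * p 0 i.
  by rewrite mulr_sumr; apply: eq_bigr => i _; rewrite mxE mulrA.
have : K * `|s *: w| ^+ 3 <= K * k * s ^+ 2 + K / k * s ^+ 4.
  have : `|s *: w| ^+ 3 <= `|s| ^+ 3.
    by rewrite lerXn2r ?nnegrE// normrZ ler_piMr.
  move=> /(ler_wpM2l K0) /le_trans; apply.
  rewrite -(real_normK (num_real s)) (_ : s ^+ 4 = `|s| ^+ 4); last first.
    by rewrite -normrX ger0_norm// exprn_even_ge0.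
  set r := `|s|; have r0 : 0 <= r := normr_ge0 s.
  have : 0 <= K / k * (r * (k - r)) ^+ 2 by rewrite mulr_ge0 ?sqr_ge0.
  have -> : K / k * (r * (k - r)) ^+ 2 = K * k * r ^+ 2 - 2 * K * r ^+ 3 + K / k * r ^+ 4.
    by field; rewrite gt_eqF.
  have : 0 <= K * r ^+ 3 by rewrite mulr_ge0// exprn_ge0.
  lra.
by move=> ?; rewrite ler_norml => /andP[? _]; lra.
Qed.

End RandomWalk.

Section ParabolicSupersolution.
Context {R : realType} {n : nat}.
Local Notation V := 'rV[R]_n.
Variables (T : R) (phi : V -> R) (w : R -> V -> R).
Hypotheses (visc : final_value_viscosity_solution T phi w)
  (lg : time_linear_growth T w).

(* On the mollification of f, many small steps of viscosity_super_step cost a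
   total error that vanishes with the step h, so that f itself may be merely
   Lipschitz. *)
Lemma supersolution_random_walk f t1 tau (v : @cube n) eta :
  topical f -> t1 <= T -> (forall x, f x <= w t1 x) -> 0 < tau -> 0 < eta ->
  exists (m : nat) (h : R), m%:R * h ^+ 2 = tau /\
    forall x, iter m (binary h (vertex v)) f x - eta <= w (t1 - tau) x.
Proof.
move=> tf t1T fw tau0 eta0; have d0 : 0 < eta / 2 by rewrite divr_gt0.
have [M [K [K0 hM Md M2]]] := mollifier (n := n) d0.
pose C := step_constant n K + K.
have C0 : 0 < C by rewrite ltr_wpDl// step_constant_ge0// ltW.
(* With [h <= q] the total loss [m * C * h ^ 3 = C * tau * h] of the walk is at most [eta / 2];
   mollification takes the other half. *)
pose q := eta / 2 / (C * tau); have q0 : 0 < q by rewrite divr_gt0// mulr_gt0.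
pose m := (Num.truncn (tau / q ^+ 2)).+1.
have mq : tau / q ^+ 2 < m%:R by exact: truncnS_gt.
have m0 : 0 < (m%:R : R) by rewrite ltr0n.
clearbody m; pose h := Num.sqrt (tau / m%:R).
have tm0 : 0 < tau / m%:R by rewrite divr_gt0.
have h0 : 0 < h by rewrite sqrtr_gt0.
have hh : h ^+ 2 = tau / m%:R by rewrite sqr_sqrtr// ltW.
have mh : m%:R * h ^+ 2 = tau by rewrite hh mulrC divfK// gt_eqF.
have hq : h <= q.
  rewrite -(@ler_pXn2r _ 2) ?nnegrE ?(ltW h0) ?(ltW q0)// hh.
  by rewrite ler_pdivrMr// mulrC -ler_pdivrMr ?exprn_gt0// ltW.
exists m, h; split=> // x.
pose G j := iter j (binary h (vertex v)) (M f).
have GE j : forall y, exists p H, expansion2 K (G j) y p H.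
  by elim: j => [|j IH]; [exact: M2|exact: binary_expansion2].
(* Each step loses [C * h ^ 3]: [step_constant] from the barrier, and [K] from trading the
   second-order term for a binary average. *)
have main j y : G j y + (- (eta / 2) - j%:R * (C * h ^+ 3)) <= w (t1 - j%:R * h ^+ 2) y.
  elim: j y => [|j IH] y.
    rewrite !mul0r !subr0; have /andP[_] := Md _ tf y; have := fw y; rewrite /G/=; lra.
  have [p [H E]] := GE j y.
  have jT : t1 - j%:R * h ^+ 2 <= T.
    by rewrite (le_trans _ t1T)// gerBl mulr_ge0// sqr_ge0.
  have E' := expansion2_addc (- (eta / 2) - j%:R * (C * h ^+ 3)) E.
  have := viscosity_super_step visc lg v jT h0 K0 E' IH.
  have -> : t1 - j%:R * h ^+ 2 - h ^+ 2 = t1 - j.+1%:R * h ^+ 2 by rewrite -natr1; ring.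
  apply: le_trans.
  have := expansion2_binary (vertex_norm v) (ltW K0) (ltW h0) E.
  rewrite ler_norml => /andP[_]; rewrite -natr1 /C.
  rewrite -[binary h (vertex v) (G j) y]/(G j.+1 y); lra.
have := main m x; rewrite mh; apply: le_trans.
have : m%:R * (C * h ^+ 3) <= eta / 2.
  have -> : m%:R * (C * h ^+ 3) = (m%:R * h ^+ 2) * C * h by ring.
  have Ct : 0 < C * tau by exact: mulr_gt0.
  by move: hq; rewrite mh (ler_pdivlMr _ _ Ct) mulrC [tau * C]mulrC.
have := @iter_binary_le _ _ m h (vertex v) f (M f) _ x.
rewrite -/(G m) => le; have := le (fun y => proj1 (andP (Md _ tf y))); lra.
Qed.

(** The walk along the zero vertex stays in place, so a topical lower bound persists to earlier
    times. *)
Lemma supersolution_nonincreasing f t1 t : topical f -> t <= t1 -> t1 <= T ->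
  (forall x, f x <= w t1 x) -> forall x, f x <= w t x.
Proof.
move=> tf; rewrite le_eqVlt => /predU1P[->//|tt1] t1T fw x.
apply/ler_addgt0Pr => eta eta0; have tau0 : 0 < t1 - t by rewrite subr_gt0.
have [m [h [_]]] := supersolution_random_walk [ffun=> false] tf t1T fw tau0 eta0.
move=> /(_ x); rewrite vertex0 subKr.
have -> : iter m (binary h 0) f x = f x by elim: m x => // m IH x /=; rewrite binary0.
lra.
Qed.

Hypothesis tphi : topical phi.

Lemma parabolic_supersolution_ge t x : t <= T -> phi x <= w t x.
Proof.
move=> tT; have [_ wT _] := visc.
by apply: (supersolution_nonincreasing tphi tT (lexx T)) => y; rewrite wT.
Qed.

Hypothesis n0 : (0 < n)%N.

(** The mollified envelopes of [w] at the grid times form a supersolution of the scheme. The loss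
    per step is [5 * K * eps ^ 3]: [4 * K] from the random walk and [K] from the player's gradient
    strategy. *)
Lemma parabolic_upper (d : R) : 0 < d -> exists2 C : R, 0 <= C &
  forall eps we, 0 < eps < 1 -> horizon_dpp T eps phi we ->
    forall (k : nat) x, we (T - k%:R * eps ^+ 2) x <=
      w (T - k%:R * eps ^+ 2) x + d + C * (k%:R * eps ^+ 2) * eps.
Proof.
move=> d0; have [M [K [K0 hM Md M2]]] := mollifier (n := n) d0.
exists (5 * K) => [|eps we eps01 [weT wed] k x]; first by rewrite mulr_ge0// ltW.
have [e0 e1] := andP eps01; have e20 : 0 < eps ^+ 2 by exact: exprn_gt0.
pose tk (j : nat) : R := T - j%:R * eps ^+ 2.
have tkT j : tk j <= T by rewrite gerBl mulr_ge0// ltW.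
have phiw j y : phi y <= w (tk j) y by exact: parabolic_supersolution_ge.
pose E j := envelope (w (tk j)).
have tE j : topical (E j) := envelope_topical tphi (phiw j).
have Ew j y : E j y <= w (tk j) y := envelope_le tphi (phiw j) y.
have ME j y : E j y <= M (E j) y by case/andP: (Md _ (tE j) y).
have tkS j : tk j - eps ^+ 2 = tk j.+1 by rewrite /tk -natr1; ring.
have step j y : minmax eps (M (E j)) y <= M (E j.+1) y + 5 * K * eps ^+ 3.
  have [p [H UE]] := M2 _ (tE j) y.
  have mm := minmax_expansion2 n0 (ltW e0) (ltW K0) (topical_averaging hM (tE j)) UE.
  apply/ler_addgt0Pr => eta eta0.
  (* The walk started from [E j] is topical and lies below [w] at the next time up to [eta], so it
     lies below the next envelope; [M] is applied only afterwards and commutes with the walk. *)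
  have low v : M (E j) y + eps ^+ 2 * (2^-1 * quad_form H (vertex v) - 4 * K * eps) - eta
      <= M (E j.+1) y.
    have [m [h [mh rw]]] := supersolution_random_walk v (tE j) (tkT j) (Ew j) e20 eta0.
    have := iter_binary_expansion2 e0 (ltW K0) (vertex_norm v) mh UE.
    rewrite -(averaging_iter_binary _ _ _ _ hM (tE j)).
    have ti := iter_binary_topical m h (vertex v) (tE j).
    rewrite tkS in rw.
    have := averaging_le hM (topical_lipschitz (topical_addc (- eta) ti))
      (topical_lipschitz (tE j.+1)) (fun z => le_envelope z (topical_addc _ ti) rw) y.
    rewrite (averaging_cstD hM); last exact: topical_lipschitz.
    lra.
  have mq : eps ^+ 2 * (2^-1 * max_quad H) <= M (E j.+1) y - M (E j) y + 4 * K * eps ^+ 3 + eta.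
    rewrite -ler_pdivlMl// mulrC ler_pdivrMr//; apply: max_quad_le => [|v].
      (* The zero vertex supplies the nonnegativity required by the default value 0 of
         [max_quad]. *)
      have := low [ffun=> false]; rewrite vertex0 quad_form0 => l0.
      by rewrite mulr_ge0// mulr_ge0 ?invr_ge0 ?(ltW e20)//; lra.
    rewrite -ler_pdivrMr// mulrC ler_pdivlMl//.
    by have := low v; lra.
  by move: mm; lra.
suff main j y : we (tk j) y <= M (E j) y + j%:R * (5 * K * eps ^+ 3).
  have := main k x; have /andP[_] := Md _ (tE k) x; have := Ew k x.
  by rewrite -/(tk k); lra.
elim: j y => [|j IH] y.
  have T0 : tk 0 = T by rewrite /tk mul0r subr0.
  rewrite mul0r addr0 T0 weT; apply: le_trans (ME 0%N y).
  by apply: (le_envelope _ tphi) => z; exact: phiw.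
have tkE : tk j.+1 + eps ^+ 2 = tk j by rewrite -tkS subrK.
rewrite wed ?tkE; [|by exists j.+1|by rewrite -tkS ltrBlDr (le_lt_trans (tkT j))// ltrDl].
have := le_minmax n0 (g1 := we (tk j)) (g2 := M (E j)) (x := y) (y := y)
  (c := j%:R * (5 * K * eps ^+ 3)) eps (fun d => IH (y + d)).
by have := step j y; rewrite -natr1; lra.
Qed.

(** [W j], the mollified discrete solution, is both a test function for [w] and a supersolution up
    to [K * eps ^ 3] per step; [viscosity_sub_step] accounts for the [step_constant] part of [C]. *)
Lemma parabolic_lower (d : R) : 0 < d -> exists2 C : R, 0 <= C &
  forall eps we, 0 < eps < 1 -> horizon_dpp T eps phi we ->
    forall (k : nat) x, w (T - k%:R * eps ^+ 2) x <=
      we (T - k%:R * eps ^+ 2) x + d + C * (k%:R * eps ^+ 2) * eps.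
Proof.
move=> d0; have [M [K [K0 hM Md M2]]] := mollifier (n := n) d0.
pose C := step_constant n K + K.
have C0 : 0 <= C by rewrite addr_ge0 ?step_constant_ge0// ltW.
exists C => // eps we eps01 [weT wed] k x.
have [e0 e1] := andP eps01; have e20 : 0 < eps ^+ 2 by exact: exprn_gt0.
pose tk (j : nat) : R := T - j%:R * eps ^+ 2.
have tkT j : tk j <= T by rewrite gerBl mulr_ge0// ltW.
have tkS j : tk j - eps ^+ 2 = tk j.+1 by rewrite /tk -natr1; ring.
have T0 : tk 0 = T by rewrite /tk mul0r subr0.
have weS j y : we (tk j.+1) y = minmax eps (we (tk j)) y.
  have tkE : tk j.+1 + eps ^+ 2 = tk j by rewrite -tkS subrK.
  rewrite wed ?tkE//; first by exists j.+1.
  by rewrite -tkS ltrBlDr (le_lt_trans (tkT j))// ltrDl.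
have twe j : topical (we (tk j)).
  elim: j => [|j IH]; first by rewrite T0 (_ : we T = phi)//; apply/funext.
  by rewrite (_ : we _ = minmax eps (we (tk j))); [exact: topical_minmax|apply/funext].
pose W j := M (we (tk j)).
have [_ wT _] := visc.
suff main j y : w (tk j) y <= W j y + j%:R * (C * eps ^+ 3).
  have := main k x; have /andP[_] := Md _ (twe k) x.
  by rewrite /W -/(tk k); lra.
elim: j y => [|j IH] y.
  rewrite mul0r addr0 T0 wT; have /andP[+ _] := Md _ (twe 0%N) y.
  by rewrite /W T0 weT.
have [p [H UE]] := M2 _ (twe j) y.
have := viscosity_sub_step visc lg (tkT j) e0 K0
  (expansion2_addc (j%:R * (C * eps ^+ 3)) UE) IH.
rewrite tkS => sub.
have low v : W j y + eps ^+ 2 * (2^-1 * quad_form H (vertex v)) - K * eps ^+ 3 <= W j.+1 y.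
  have := expansion2_binary (vertex_norm v) (ltW K0) (ltW e0) UE.
  rewrite ler_norml => /andP[bl _].
  have tb := topical_binary eps (vertex v) (twe j).
  have : M (binary eps (vertex v) (we (tk j))) y <= W j.+1 y.
    apply: (averaging_le hM); try exact: topical_lipschitz.
    by move=> z; rewrite weS; exact: binary_le_minmax.
  rewrite (averaging_binary _ _ _ hM); last exact: topical_lipschitz.
  by rewrite /W in bl *; lra.
have mq : eps ^+ 2 * (2^-1 * max_quad H) <= W j.+1 y - W j y + K * eps ^+ 3.
  rewrite -ler_pdivlMl// mulrC ler_pdivrMr//; apply: max_quad_le => [|v].
    have := low [ffun=> false]; rewrite vertex0 quad_form0 => l0.
    by rewrite mulr_ge0// mulr_ge0 ?invr_ge0 ?(ltW e20)//; lra.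
  rewrite -ler_pdivrMr// mulrC ler_pdivlMl//.
  by have := low v; lra.
by move: sub mq; rewrite -natr1 /C /W; lra.
Qed.

End ParabolicSupersolution.

(** * Passage to the limit *)

Lemma near_right0_small {R : realType} (A e : R) : 0 <= A -> 0 < e ->
  \forall eps \near (0 : R)^'+, 0 < eps < 1 /\ A * eps <= e.
Proof.
move=> A0 e0; have c0 : 0 < e / (A + 1) by rewrite divr_gt0// ltr_wpDl.
near=> eps.
have p0 : 0 < eps by near: eps; exact: nbhs_right_gt.
have p1 : eps < 1 by near: eps; exact: nbhs_right_lt.
have pe : eps < e / (A + 1) by near: eps; exact: nbhs_right_lt.
split; first by rewrite p0.
move: pe; rewrite ltr_pdivlMr ?ltr_wpDl// => pe.
by lra.
Unshelve. all: by end_near. Qed.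

Theorem theorem7 (R : realType) (n : nat) (T : R) (phi : 'rV[R]_n -> R)
    (hn : (1 <= n)%N) (hphi : admissible phi) :
  (forall (ueps : R -> 'rV[R]_n -> R) (u : 'rV[R]_n -> R),
     (forall eps : R, 0 < eps < 1 ->
        geometric_dpp eps phi (ueps eps) /\
        exists C : R, forall x, `|ueps eps x - phi x| <= C) ->
     stationary_viscosity_solution phi u ->
     linear_growth u ->
     forall x : 'rV[R]_n,
       (fun z : R * 'rV[R]_n => ueps z.1 z.2)
         @ filter_prod 0^'+ (nbhs x) --> u x)
  /\
  (forall (weps : R -> R -> 'rV[R]_n -> R) (w : R -> 'rV[R]_n -> R),
     (forall eps : R, 0 < eps < 1 -> horizon_dpp T eps phi (weps eps)) ->
     final_value_viscosity_solution T phi w ->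
     time_linear_growth T w ->
     forall (t : R) (x : 'rV[R]_n), t <= T ->
       (fun z : R * (R * 'rV[R]_n) => weps z.1 z.2.1 z.2.2)
         @ within [set z | time_grid T z.1 z.2.1]
             (filter_prod 0^'+ (nbhs (t, x))) --> w t x).
Proof.
have tphi := admissible_topical hphi; split.
  move=> ueps u hu visc lg x; apply/cvgrPdist_le => e e0.
  (* One third each for the mollification, for the errors linear in [eps], and for the continuity of
     [u] at [x]. *)
  have d0 : 0 < e / 3 by rewrite divr_gt0.
  have [C1 C10 low] := stationary_lower hn tphi visc lg d0.
  have [C2 C20 up] := stationary_upper tphi visc hn d0.
  have C0 : 0 <= C1 + C2 by rewrite addr_ge0.
  have [cu _] := visc; have /cvgrPdist_le/(_ _ d0) nu := cu x.
  exists ([set eps | 0 < eps < 1 /\ (C1 + C2) * eps <= e / 3],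
    [set y | `|u x - u y| <= e / 3]).
    by split; [exact: near_right0_small|exact: nu].
  move=> [eps y] /= [[eps01 Ce] uy]; have [dpp bd] := hu eps eps01.
  have [p0 _] := andP eps01.
  have := low eps _ eps01 dpp bd y; have := up eps _ eps01 dpp bd y.
  have : 0 <= C1 * eps by rewrite mulr_ge0// ltW.
  have : 0 <= C2 * eps by rewrite mulr_ge0// ltW.
  move: uy Ce; rewrite !ler_norml => /andP[? ?] ? ? ? ? ?.
  by apply/andP; split; lra.
move=> weps w hw visc lg t x tT; apply/cvgrPdist_le => e e0.
have d0 : 0 < e / 3 by rewrite divr_gt0.
have [C1 C10 low] := parabolic_lower visc lg tphi hn d0.
have [C2 C20 up] := parabolic_upper visc lg tphi hn d0.
(* For grid times within distance 1 of [t] the elapsed time [k * eps ^ 2] is at most [T - t + 1],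
   which makes the accumulated errors uniformly [O(eps)]. *)
have Tt : 0 <= T - t + 1 by rewrite addr_ge0 ?subr_ge0.
have A0 : 0 <= (C1 + C2) * (T - t + 1) := mulr_ge0 (addr_ge0 C10 C20) Tt.
have [cw _ _] := visc.
have /subspace_continuousP/(_ (t, x) tT)/cvgrPdist_le/(_ _ d0) := cw.
rewrite near_withinE => nw.
have nt : \forall z \near (t, x), `|t - z.1| <= 1.
  have : (fun z : R * 'rV[R]_n => z.1) @ (t, x) --> t by exact: cvg_fst.
  by move=> /cvgrPdist_le/(_ _ ltr01).
rewrite near_withinE.
exists ([set eps | 0 < eps < 1 /\ (C1 + C2) * (T - t + 1) * eps <= e / 3],
  [set z : R * 'rV[R]_n | (z.1 <= T -> `|w t x - w z.1 z.2| <= e / 3) /\ `|t - z.1| <= 1]).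
  split; first exact: near_right0_small.
  by apply: filterS2 nw nt => z.
move=> [eps [s y]] /= [[eps01 Ce] [wy ts]] [k sE].
have [p0 _] := andP eps01.
have k0 : 0 <= k%:R * eps ^+ 2 by rewrite mulr_ge0// sqr_ge0.
(* Grid times never exceed [T], so the continuity of [w] relative to times at most [T] suffices. *)
have sT : s <= T by rewrite sE gerBl.
have kT : k%:R * eps ^+ 2 <= T - t + 1.
  by move: ts; rewrite sE ler_norml => /andP[? ?]; lra.
have := low eps _ eps01 (hw eps eps01) k y; have := up eps _ eps01 (hw eps eps01) k y.
rewrite -sE; have {wy} := wy sT.
have : C1 * (k%:R * eps ^+ 2) * eps <= C1 * (T - t + 1) * eps.
  by rewrite ler_pM2r// ler_wpM2l.
have : C2 * (k%:R * eps ^+ 2) * eps <= C2 * (T - t + 1) * eps.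
  by rewrite ler_pM2r// ler_wpM2l.
have : 0 <= C1 * (k%:R * eps ^+ 2) * eps by rewrite !mulr_ge0// ltW.
have : 0 <= C2 * (k%:R * eps ^+ 2) * eps by rewrite !mulr_ge0// ltW.
move: Ce; rewrite !ler_norml => ? ? ? ? ? /andP[? ?] ? ?.
by apply/andP; split; lra.
Qed.
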